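(* Let $S_1=\{F_t\}_{t\ge0}$ and $S_2=\{G_t\}_{t\ge0}$ be two continuous semigroups on $\Delta$ generated by $f$ and $g$, respectively, and let $F_1\circ G_1=G_1\circ F_1$. Suppose that $\tau=1$ is a boundary null point of $f$ such that $f'(1)=0$. If $S_1,S_2\subset C^0(1)$ and one of the following conditions (i) $f,g\in C^2(1)$, $f''(1)\neq0$, $g''(1)\neq0$; (ii) $f,g\in C^3(1)$, $f''(1)=g''(1)=0$ holds, then the semigroups $S_1$ and $S_2$ commute.
   Context: $\Delta=\{z\in\mathbb{C}:|z|<1\}$. A continuous semigroup on $\Delta$ is a family $\{F_t\}_{t\ge0}$ of holomorphic self-mappings of $\Delta$ with $F_t\circ F_s=F_{t+s}$ for all $t,s\ge0$ and $\lim_{t\to0^+}F_t(z)=z$ for all $z\in\Delta$. Its generator is the holomorphic function $f(z)=\lim_{t\to0^+}\frac{z-F_t(z)}{t}$ on $\Delta$. The point $1$ is a boundary null point of $f$ if $\lim_{r\to1^-}f(r)=0$. The angular derivative is $f'(1)=\angle\lim_{z\to1}f'(z)$, where $\angle\lim_{z\to 1}$ denotes the limit as $z\to1$ within each Stolz angle $\{z\in\Delta:|\arg(1-z)|<\alpha\}$, $\alpha\in(0,\frac\pi2)$. Two semigroups $\{F_t\}$ and $\{G_t\}$ commute if $F_t\circ G_s=G_s\circ F_t$ for all $s,t\ge0$. For $n=0,1,2,\ldots$ and $\tau\in\partial\Delta$, $C^n(\tau)$ is the class of holomorphic functions $F:\Delta\to\mathbb{C}$ admitting a representation $F(z)=\sum_{k=0}^n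 a_k(z-\tau)^k+\gamma(z)$ with $\gamma$ holomorphic on $\Delta$ and $\lim_{z\to\tau,\,z\in\Delta}\frac{\gamma(z)}{(z-\tau)^n}=0$ (unrestricted limit). For $F\in C^n(\tau)$ and $0\le k\le n$, one writes $F^{(k)}(\tau)=k!\,a_k$ (this equals $\angle\lim_{z\to\tau}F^{(k)}(z)$). The inclusion $S_1\subset C^0(1)$ means that $F_t\in C^0(1)$ for all $t\ge0$.
   Formalization: Added hypothesis: if G_1 is the identity on Δ, then S_1 or S_2 is trivial (all its maps are the identity). Without it the claim fails, e.g. for a parabolic group S_1 fixing 1 and an elliptic group S_2 of period 1; only cases where the semigroups do not commute are excluded. *)

(* Defs.v *)
(* Standard-library reals, with the complex numbers of Coquelicot. *)
From Stdlib Require Export Arith Factorial Reals.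
From Coquelicot Require Export Coquelicot.
Open Scope R_scope.

Definition Delta (z : C) : Prop := Cmod z < 1.

Definition holomorphic_on_Delta (f : C -> C) : Prop :=
  forall z : C, Delta z ->
    ex_derive (K := C_AbsRing) (V := C_NormedModule) f z.

(* A family {F_t}_{t >= 0} of self-mappings of Delta is a total function
   F : R -> C -> C; its values for t < 0 or z outside Delta are junk and are
   constrained nowhere below. *)
Definition continuous_semigroup (F : R -> C -> C) : Prop :=
  (forall t : R, 0 <= t -> holomorphic_on_Delta (F t)) /\
  (forall (t : R) (z : C), 0 <= t -> Delta z -> Delta (F t z)) /\
  (forall (t s : R) (z : C), 0 <= t -> 0 <= s -> Delta z ->
     F t (F s z) = F (t + s) z) /\
  (forall z : C, Delta z ->
     filterlim (fun t : R => F t z) (at_right 0) (locally z)).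

(* Sign convention: the trajectories solve du/dt + f(u) = 0. *)
Definition generates (f : C -> C) (F : R -> C -> C) : Prop :=
  holomorphic_on_Delta f /\
  (forall z : C, Delta z ->
     filterlim (fun t : R => ((z - F t z) / RtoC t)%C)
       (at_right 0) (locally (f z))).

Definition boundary_null_point_1 (f : C -> C) : Prop :=
  filterlim (fun r : R => f (RtoC r)) (at_left 1) (locally (RtoC 0)).

(* The principal argument, for Re w > 0 only; note Re (1 - z) > 0 on Delta. *)
Definition arg_right_half_plane (w : C) : R := atan (Im w / Re w).

Definition Stolz_angle_1 (alpha : R) (z : C) : Prop :=
  Delta z /\ Rabs (arg_right_half_plane (1 - z)%C) < alpha.

Definition angular_limit_1 (f : C -> C) (l : C) : Prop :=
  forall alpha : R, 0 < alpha < PI / 2 ->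
    filterlim f (within (Stolz_angle_1 alpha) (locally (RtoC 1))) (locally l).

Definition angular_derivative_1 (f : C -> C) (l : C) : Prop :=
  angular_limit_1 (C_derive f) l.

(* The coefficients a_0, ..., a_n of an expansion of order n at tau; the values
   a k for k > n are irrelevant. *)
Definition boundary_expansion
    (n : nat) (tau : C) (F : C -> C) (a : nat -> C) : Prop :=
  exists gamma : C -> C,
    holomorphic_on_Delta gamma /\
    filterlim (fun z : C => (gamma z / (z - tau) ^ n)%C)
      (within Delta (locally tau)) (locally (RtoC 0)) /\
    (forall z : C, Delta z ->
       F z = (sum_n (fun k : nat => (a k * (z - tau) ^ k)%C) n + gamma z)%C).

Definition class_C (n : nat) (tau : C) (F : C -> C) : Prop :=
  holomorphic_on_Delta F /\
  exists a : nat -> C, boundary_expansion n tau F a.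

(* [boundary_derivative n tau F k v] : F^(k)(tau) = v, read off an expansion of
   order n (the coefficients of such an expansion are unique). *)
Definition boundary_derivative
    (n : nat) (tau : C) (F : C -> C) (k : nat) (v : C) : Prop :=
  (k <= n)%nat /\
  exists a : nat -> C,
    boundary_expansion n tau F a /\ v = (RtoC (INR (fact k)) * a k)%C.

Definition semigroup_in_C0_1 (F : R -> C -> C) : Prop :=
  forall t : R, 0 <= t -> class_C 0 (RtoC 1) (F t).

Definition commute_on_Delta (F G : C -> C) : Prop :=
  forall z : C, Delta z -> F (G z) = G (F z).

Definition semigroups_commute (F G : R -> C -> C) : Prop :=
  forall s t : R, 0 <= s -> 0 <= t -> commute_on_Delta (F t) (G s).

Definition identity_on_Delta (F : C -> C) : Prop :=
  forall z : C, Delta z -> F z = z.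

Definition trivial_semigroup (F : R -> C -> C) : Prop :=
  forall t : R, 0 <= t -> identity_on_Delta (F t).

(* Non-degeneracy of the pair (F_1, G_1): if G_1 is the identity, then
   F_1 o G_1 = G_1 o F_1 carries no information.  For example
   F_t = T^-1 (T + it) with T z = (1 + z)/(1 - z), and
   G_t = M^-1 (exp (2 pi i t) M) with M z = (z - 1/2)/(1 - z/2), have G_1 = id
   but do not commute, although both are analytic at 1 and their generators
   have a nonzero second derivative there. *)
Definition nondegenerate_pair (F G : R -> C -> C) : Prop :=
  identity_on_Delta (G 1) -> trivial_semigroup F \/ trivial_semigroup G.

(* Main.v *)
(** Put the Denjoy-Wolff point at infinity: in the coordinate [u = (1 / (1 - z)) ^ m],
    with [m = 1] in case (i) and [m = 2] in case (ii), a generator whose expansion at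
    [1] starts with [(z - 1) ^ (m + 1)] becomes a vector field with a limit [c] at
    infinity. If [c <> 0], its reciprocal has a primitive [h] on a convex region which
    the flow preserves, [h] is injective there, and [h (F_t) = h + t]. Let [Gam] be a
    self-map of the disc that commutes with [F_1] and moves [u] by [d + o(1)] near
    infinity. The orbits of [Gam (F_t z)] and [F_t (Gam z)] under [F_1] approach each
    other in the coordinate [u], so that both points have the same [h]: they coincide.
    This is applied to [(F, G_1)] and then to [(G, F_t)].

    That [g] has the required expansion follows from [G_1 -> 1] at [1], which holds
    because [G_1] commutes with [F_1]: if [g] does not vanish at [1], then [G_1] is the
    identity; if [g] has a linear part [b (z - 1)], then [b] is real since [G_t] preserves
    the disc, and comparing the growth of [F_n] at a point and at its image under [G_1]
    gives [b = 0]. In case (ii) the maximum principle shows that the vector field has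
    nonnegative real part in the coordinate [1 / (1 - z)]; hence the third coefficient is
    nonnegative, and by a boundary Schwarz lemma it vanishes only for the trivial
    semigroup. *)
Require Import Defs.
From Stdlib Require Import Lra Lia Psatz Classical ClassicalEpsilon.

(** * Limits, complex derivatives and right derivatives *)

(** In case (i) the limit [c] can be any non-zero number with [Re c >= 0]: other directions would
    push points out of the half-plane [Re u > 1/2], and with [Re c >= 0] the image of the disc
    contains points arbitrarily far out in the direction [c]. In case (ii) the image of the disc
    under [u] is the outside of a parabola around the negative axis, which is not convex; since [c]
    is positive there, the half-plane [Re u > 1] can be used instead. Commutation is therefore
    obtained only far out in the direction [c], and the identity theorem spreads it over the disc.

    The generator is a one-sided limit, so calculus along trajectories uses right derivatives and
    left continuity. The function theory rests on pointwise differentiability alone: Goursat's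
    theorem gives primitives on convex sets, these a weak mean value property, and this the maximum
    principle. Removable singularities and power series are bypassed by dividing by powers of a disc
    automorphism. *)

Definition clim {T : Type} (F : (T -> Prop) -> Prop) (f : T -> C) (l : C) : Prop :=
  forall eps : R, 0 < eps -> F (fun x => Cmod (f x - l) < eps).

Definition near (z : C) (P : C -> Prop) : Prop :=
  exists delta : R, 0 < delta /\ forall w, Cmod (w - z) < delta -> P w.

(** The filter of unrestricted approach to the boundary point 1 from inside the disc; since 1 is not
    in [Delta], the neighbourhoods are automatically punctured. *)
Definition near_in_Delta_1 (P : C -> Prop) : Prop :=
  exists delta : R, 0 < delta /\
    forall z, Delta z -> Cmod (z - RtoC 1) < delta -> P z.

Global Instance near_filter (z : C) : Filter (near z).
Proof.
  split.
  - exists 1; split; [lra | easy].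
  - intros P Q [d1 [H1 HP]] [d2 [H2 HQ]].
    exists (Rmin d1 d2); split; [now apply Rmin_glb_lt |].
    intros w Hw; split; [apply HP | apply HQ]; eapply Rlt_le_trans;
      try apply Hw; [apply Rmin_l | apply Rmin_r].
  - intros P Q HPQ [d [Hd HP]]; exists d; split; auto.
Qed.

Global Instance near_in_Delta_1_filter : Filter near_in_Delta_1.
Proof.
  split.
  - exists 1; split; [lra | easy].
  - intros P Q [d1 [H1 HP]] [d2 [H2 HQ]].
    exists (Rmin d1 d2); split; [now apply Rmin_glb_lt |].
    intros w HD Hw; split; [apply HP | apply HQ]; try easy; eapply Rlt_le_trans;
      try apply Hw; [apply Rmin_l | apply Rmin_r].
  - intros P Q HPQ [d [Hd HP]]; exists d; split; auto.
Qed.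

Lemma Cmod_sub_sym (a b : C) : Cmod (a - b) = Cmod (b - a).
Proof. rewrite <- Cmod_opp. f_equal. ring. Qed.

Lemma Cmod_sub_self (a : C) : Cmod (a - a) = 0.
Proof. replace (a - a)%C with (RtoC 0) by ring. apply Cmod_0. Qed.

Lemma Cmod_sub_triangle (a b c : C) : Cmod (a - c) <= Cmod (a - b) + Cmod (b - c).
Proof. replace (a - c)%C with ((a - b) + (b - c))%C by ring. apply Cmod_triangle. Qed.

Lemma Cmod_minus_le (a b : C) : Cmod (a - b) <= Cmod a + Cmod b.
Proof. unfold Cminus. rewrite <- (Cmod_opp b). apply Cmod_triangle. Qed.

Lemma Cmod_reverse_triangle (a b : C) : Cmod a - Cmod b <= Cmod (a - b).
Proof.
  assert (H := Cmod_triangle (a - b) b).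
  replace (a - b + b)%C with a in H by ring. lra.
Qed.

Lemma Re_le_Cmod (z : C) : Re z <= Cmod z.
Proof. eapply Rle_trans; [apply Rle_abs | apply re_le_Cmod]. Qed.

Lemma Re_ge_opp_Cmod (z : C) : - Cmod z <= Re z.
Proof.
  assert (H := re_le_Cmod z). assert (H1 := Rle_abs (- Re z)).
  rewrite Rabs_Ropp in H1. lra.
Qed.

Lemma Im_le_Cmod (z : C) : Rabs (Im z) <= Cmod z.
Proof.
  eapply Rle_trans; [| apply (Rmax_Cmod z)]. apply Rmax_r.
Qed.

Lemma Cmod_le_abs_sum (z : C) : Cmod z <= Rabs (Re z) + Rabs (Im z).
Proof.
  destruct z as [x y]. simpl.
  replace ((x, y) : C) with (RtoC x + Ci * RtoC y)%C
    by (apply injective_projections; simpl; ring).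
  eapply Rle_trans; [apply Cmod_triangle |].
  rewrite Cmod_mult, Cmod_Ci, !Cmod_R. lra.
Qed.

Lemma Cmod_eq_0_sub (a b : C) : Cmod (a - b) = 0 -> a = b.
Proof.
  intros H. apply Cmod_eq_0 in H. replace a with (a - b + b)%C by ring.
  rewrite H. ring.
Qed.

Section ClimRules.

Context {T : Type} (F : (T -> Prop) -> Prop) {FF : Filter F}.

Lemma clim_ext (f g : T -> C) (l : C) :
  F (fun x => f x = g x) -> clim F f l -> clim F g l.
Proof.
  intros He Hf eps Heps. generalize (filter_and _ _ He (Hf eps Heps)).
  apply filter_imp. intros x [-> H]. exact H.
Qed.

Lemma clim_const (a : C) : clim F (fun _ => a) a.
Proof.
  intros eps Heps. apply filter_forall. intros _. now rewrite Cmod_sub_self.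
Qed.

Lemma clim_plus (f g : T -> C) (a b : C) :
  clim F f a -> clim F g b -> clim F (fun x => f x + g x)%C (a + b)%C.
Proof.
  intros Hf Hg eps Heps. assert (He : 0 < eps / 2) by lra.
  generalize (filter_and _ _ (Hf _ He) (Hg _ He)).
  apply filter_imp. intros x [H1 H2].
  replace (f x + g x - (a + b))%C with ((f x - a) + (g x - b))%C by ring.
  eapply Rle_lt_trans; [apply Cmod_triangle | lra].
Qed.

Lemma clim_opp (f : T -> C) (a : C) :
  clim F f a -> clim F (fun x => - f x)%C (- a)%C.
Proof.
  intros Hf eps Heps. generalize (Hf eps Heps). apply filter_imp. intros x H.
  replace (- f x - - a)%C with (- (f x - a))%C by ring. now rewrite Cmod_opp.
Qed.

Lemma clim_minus (f g : T -> C) (a b : C) :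
  clim F f a -> clim F g b -> clim F (fun x => f x - g x)%C (a - b)%C.
Proof. intros Hf Hg. apply clim_plus; [easy | now apply clim_opp]. Qed.

Lemma clim_bounded (f : T -> C) (a : C) :
  clim F f a -> F (fun x => Cmod (f x) < Cmod a + 1).
Proof.
  intros Hf. generalize (Hf 1 Rlt_0_1). apply filter_imp. intros x H.
  assert (H1 := Cmod_reverse_triangle (f x) a). lra.
Qed.

Lemma clim_mult (f g : T -> C) (a b : C) :
  clim F f a -> clim F g b -> clim F (fun x => f x * g x)%C (a * b)%C.
Proof.
  intros Hf Hg eps Heps.
  assert (HA : 0 < Cmod a + 1) by (generalize (Cmod_ge_0 a); lra).
  assert (HB : 0 < Cmod b + 1) by (generalize (Cmod_ge_0 b); lra).
  assert (E1 : 0 < eps / 2 / (Cmod b + 1)) by (apply Rdiv_lt_0_compat; lra).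
  assert (E2 : 0 < eps / 2 / (Cmod a + 1)) by (apply Rdiv_lt_0_compat; lra).
  generalize (filter_and _ _ (clim_bounded f a Hf)
               (filter_and _ _ (Hf _ E1) (Hg _ E2))).
  apply filter_imp. intros x [H0 [H1 H2]].
  replace (f x * g x - a * b)%C with (f x * (g x - b) + (f x - a) * b)%C by ring.
  eapply Rle_lt_trans; [apply Cmod_triangle |]. rewrite !Cmod_mult.
  assert (Cmod (f x) * Cmod (g x - b) <= (Cmod a + 1) * (eps / 2 / (Cmod a + 1))).
  { apply Rmult_le_compat; try apply Cmod_ge_0; lra. }
  assert (Cmod (f x - a) * Cmod b < eps / 2 / (Cmod b + 1) * (Cmod b + 1)).
  { apply Rmult_le_0_lt_compat; try apply Cmod_ge_0; lra. }
  replace ((Cmod a + 1) * (eps / 2 / (Cmod a + 1))) with (eps / 2) in H by (field; lra).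
  replace (eps / 2 / (Cmod b + 1) * (Cmod b + 1)) with (eps / 2) in H3 by (field; lra).
  lra.
Qed.

Lemma clim_away_from_0 (f : T -> C) (a : C) :
  a <> RtoC 0 -> clim F f a -> F (fun x => Cmod a / 2 < Cmod (f x)).
Proof.
  intros Ha Hf. apply Cmod_gt_0 in Ha. assert (He : 0 < Cmod a / 2) by lra.
  generalize (Hf _ He). apply filter_imp. intros x H.
  assert (H1 := Cmod_reverse_triangle a (f x)). rewrite Cmod_sub_sym in H1. lra.
Qed.

Lemma clim_inv (f : T -> C) (a : C) :
  a <> RtoC 0 -> clim F f a -> clim F (fun x => / f x)%C (/ a)%C.
Proof.
  intros Ha Hf eps Heps. assert (Ha' := Ha). apply Cmod_gt_0 in Ha'.
  assert (E : 0 < eps * (Cmod a * (Cmod a / 2))) by (repeat apply Rmult_lt_0_compat; lra).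
  generalize (filter_and _ _ (clim_away_from_0 f a Ha Hf) (Hf _ E)).
  apply filter_imp. intros x [H1 H2].
  assert (Hx : f x <> RtoC 0) by (apply Cmod_gt_0; lra).
  replace (/ f x - / a)%C with ((a - f x) / (f x * a))%C by (field; auto).
  rewrite Cmod_div, Cmod_mult, Cmod_sub_sym by now apply Cmult_neq_0.
  apply Rlt_div_l; [apply Rmult_lt_0_compat; lra |].
  eapply Rlt_le_trans; [apply H2 |]. apply Rmult_le_compat_l; [lra |].
  rewrite Rmult_comm. apply Rmult_le_compat_r; lra.
Qed.

Lemma clim_div (f g : T -> C) (a b : C) :
  b <> RtoC 0 -> clim F f a -> clim F g b -> clim F (fun x => f x / g x)%C (a / b)%C.
Proof. intros Hb Hf Hg. apply clim_mult; [easy | now apply clim_inv]. Qed.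

Lemma clim_pow (f : T -> C) (a : C) (n : nat) :
  clim F f a -> clim F (fun x => f x ^ n)%C (a ^ n)%C.
Proof.
  intros Hf. induction n as [|n IH]; [apply (clim_const (RtoC 1)) |].
  now apply (clim_mult f (fun x => f x ^ n)%C).
Qed.

Lemma clim_unique (f : T -> C) (a b : C) :
  ProperFilter F -> clim F f a -> clim F f b -> a = b.
Proof.
  intros HP Ha Hb. apply Cmod_eq_0_sub.
  destruct (Req_dec (Cmod (a - b)) 0) as [H | H]; [easy | exfalso].
  assert (H0 := Cmod_ge_0 (a - b)). assert (He : 0 < Cmod (a - b) / 2) by lra.
  destruct (filter_ex _ (filter_and _ _ (Ha _ He) (Hb _ He))) as [x [H1 H2]].
  assert (H3 := Cmod_sub_triangle a (f x) b).
  rewrite (Cmod_sub_sym a (f x)) in H3. lra.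
Qed.

End ClimRules.

Lemma clim_comp {T : Type} (F : (T -> Prop) -> Prop) {FF : Filter F}
    (f : T -> C) (g : C -> C) (a b : C) :
  clim F f a -> clim (near a) g b -> clim F (fun x => g (f x)) b.
Proof.
  intros Hf Hg eps Heps. destruct (Hg eps Heps) as [d [Hd H]].
  generalize (Hf d Hd). apply filter_imp. intros x Hx. now apply H.
Qed.

Lemma clim_near_id (z : C) : clim (near z) (fun w => w) z.
Proof. intros eps Heps. exists eps; split; auto. Qed.

(** Caratheodory's form of complex differentiability. *)
Definition cderiv (f : C -> C) (z d : C) : Prop :=
  exists phi : C -> C,
    clim (near z) phi d /\ phi z = d /\
    forall w, (f w - f z = phi w * (w - z))%C.

Definition holo (U : C -> Prop) (f : C -> C) : Prop :=
  forall z, U z -> exists d, cderiv f z d.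

Lemma cderiv_cont (f : C -> C) (z d : C) : cderiv f z d -> clim (near z) f (f z).
Proof.
  intros [phi [H1 [H2 H3]]].
  apply (clim_ext _ (fun w => f z + phi w * (w - z))%C).
  - apply filter_forall. intros w. rewrite <- H3. ring.
  - assert (H : clim (near z) (fun w => f z + phi w * (w - z))%C (f z + d * (z - z))%C).
    { apply clim_plus; [apply _ | apply clim_const, _ |].
      apply clim_mult; [apply _ | easy |].
      apply clim_minus; [apply _ | | apply clim_const, _]. apply clim_near_id. }
    now replace (f z + d * (z - z))%C with (f z) in H by ring.
Qed.

Lemma cderiv_of_eps (f : C -> C) (z d : C) :
  (forall eps, 0 < eps ->
     near z (fun w => Cmod (f w - f z - d * (w - z)) <= eps * Cmod (w - z))) ->
  cderiv f z d.
Proof.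
  intros H.
  (* The slope function; the value [d] at [z] makes it continuous there. *)
  exists (fun w => if excluded_middle_informative (w = z) then d
                   else ((f w - f z) / (w - z))%C).
  split; [| split].
  - intros eps Heps. assert (He : 0 < eps / 2) by lra.
    destruct (H _ He) as [dl [Hd Hw]].
    exists dl; split; [easy |]. intros w Hwz.
    destruct (excluded_middle_informative (w = z)) as [E | E].
    + now rewrite Cmod_sub_self.
    + assert (N : (w - z)%C <> RtoC 0).
      { intros E'. apply E. replace w with (w - z + z)%C by ring. rewrite E'. ring. }
      assert (N' := N). apply Cmod_gt_0 in N'.
      replace ((f w - f z) / (w - z) - d)%C
        with ((f w - f z - d * (w - z)) / (w - z))%C by (field; exact N).
      rewrite Cmod_div by exact N. apply Rlt_div_l; [easy |].
      eapply Rle_lt_trans; [apply Hw, Hwz |]. apply Rmult_lt_compat_r; lra.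
  - now destruct (excluded_middle_informative (z = z)).
  - intros w. destruct (excluded_middle_informative (w = z)) as [-> | E]; [ring |].
    field. intros E'. apply E. replace w with (w - z + z)%C by ring. rewrite E'. ring.
Qed.

Lemma cderiv_eps (f : C -> C) (z d : C) :
  cderiv f z d -> forall eps, 0 < eps ->
    near z (fun w => Cmod (f w - f z - d * (w - z)) <= eps * Cmod (w - z)).
Proof.
  intros [phi [H1 [H2 H3]]] eps Heps. generalize (H1 eps Heps).
  apply filter_imp. intros w Hw. rewrite H3.
  replace (phi w * (w - z) - d * (w - z))%C with ((phi w - d) * (w - z))%C by ring.
  rewrite Cmod_mult. apply Rmult_le_compat_r; [apply Cmod_ge_0 | lra].
Qed.

Lemma cderiv_ext (f g : C -> C) (z d : C) :
  near z (fun w => f w = g w) -> cderiv f z d -> cderiv g z d.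
Proof.
  intros He Hf. apply cderiv_of_eps. intros eps Heps.
  assert (Hz : f z = g z).
  { destruct He as [dl [Hd H]]. apply H. now rewrite Cmod_sub_self. }
  generalize (filter_and _ _ He (cderiv_eps _ _ _ Hf eps Heps)).
  apply filter_imp. intros w [E H]. now rewrite <- E, <- Hz.
Qed.

Lemma cderiv_const (a z : C) : cderiv (fun _ => a) z (RtoC 0).
Proof.
  exists (fun _ => RtoC 0). split; [apply clim_const, _ | split; [easy |]].
  intros w. ring.
Qed.

Lemma cderiv_id (z : C) : cderiv (fun w => w) z (RtoC 1).
Proof.
  exists (fun _ => RtoC 1). split; [apply clim_const, _ | split; [easy |]].
  intros w. ring.
Qed.

Lemma cderiv_plus (f g : C -> C) (z a b : C) :
  cderiv f z a -> cderiv g z b -> cderiv (fun w => f w + g w)%C z (a + b)%C.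
Proof.
  intros [p [H1 [H2 H3]]] [q [K1 [K2 K3]]].
  exists (fun w => p w + q w)%C. split; [| split].
  - apply clim_plus; auto with typeclass_instances.
  - now rewrite H2, K2.
  - intros w. replace (f w + g w - (f z + g z))%C
      with ((f w - f z) + (g w - g z))%C by ring. rewrite H3, K3. ring.
Qed.

Lemma cderiv_mult (f g : C -> C) (z a b : C) :
  cderiv f z a -> cderiv g z b ->
  cderiv (fun w => f w * g w)%C z (a * g z + f z * b)%C.
Proof.
  intros Hf Hg. assert (Hc := cderiv_cont _ _ _ Hf).
  destruct Hf as [p [H1 [H2 H3]]]. destruct Hg as [q [K1 [K2 K3]]].
  exists (fun w => p w * g z + f w * q w)%C. split; [| split].
  - apply clim_plus; [apply _ | |]; (apply clim_mult; [apply _ | |]); auto.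
    apply clim_const, _.
  - now rewrite H2, K2.
  - intros w. replace (f w * g w - f z * g z)%C
      with ((f w - f z) * g z + f w * (g w - g z))%C by ring. rewrite H3, K3. ring.
Qed.

Lemma cderiv_opp (f : C -> C) (z a : C) :
  cderiv f z a -> cderiv (fun w => - f w)%C z (- a)%C.
Proof.
  intros [p [H1 [H2 H3]]]. exists (fun w => - p w)%C. split; [| split].
  - apply clim_opp; auto with typeclass_instances.
  - now rewrite H2.
  - intros w. replace (- f w - - f z)%C with (- (f w - f z))%C by ring. rewrite H3. ring.
Qed.

Lemma cderiv_minus (f g : C -> C) (z a b : C) :
  cderiv f z a -> cderiv g z b -> cderiv (fun w => f w - g w)%C z (a - b)%C.
Proof. intros Hf Hg. apply cderiv_plus; [easy | now apply cderiv_opp]. Qed.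

Lemma cderiv_scal (k : C) (f : C -> C) (z a : C) :
  cderiv f z a -> cderiv (fun w => k * f w)%C z (k * a)%C.
Proof.
  intros Hf. replace (k * a)%C with (RtoC 0 * f z + k * a)%C by ring.
  apply (cderiv_mult (fun _ => k)); [apply cderiv_const | easy].
Qed.

Lemma cderiv_comp (f g : C -> C) (z a b : C) :
  cderiv g z b -> cderiv f (g z) a -> cderiv (fun w => f (g w)) z (a * b)%C.
Proof.
  intros Hg [p [H1 [H2 H3]]]. assert (Hc := cderiv_cont _ _ _ Hg).
  destruct Hg as [q [K1 [K2 K3]]].
  exists (fun w => p (g w) * q w)%C. split; [| split].
  - apply clim_mult; [apply _ | | easy]. now apply (clim_comp _ g p (g z)).
  - now rewrite H2, K2.
  - intros w. rewrite H3, K3. ring.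
Qed.

Lemma cderiv_inv (f : C -> C) (z a : C) :
  f z <> RtoC 0 -> cderiv f z a -> cderiv (fun w => / f w)%C z (- a / f z ^ 2)%C.
Proof.
  intros Hz Hf. assert (Hc := cderiv_cont _ _ _ Hf).
  assert (Hn : near z (fun w => f w <> RtoC 0)).
  { generalize (clim_away_from_0 (near z) f (f z) Hz Hc). apply filter_imp.
    intros w Hw E. rewrite E, Cmod_0 in Hw. generalize (Cmod_ge_0 (f z)). lra. }
  apply cderiv_of_eps. intros eps Heps.
  destruct Hf as [p [H1 [H2 H3]]].
  assert (Hl : clim (near z) (fun w => - p w / (f w * f z))%C (- a / f z ^ 2)%C).
  { replace (- a / f z ^ 2)%C with (- a / (f z * f z))%C by (field; exact Hz).
    apply clim_div; [apply _ | now apply Cmult_neq_0 | apply clim_opp; auto with typeclass_instances |].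
    apply clim_mult; [apply _ | easy | apply clim_const, _]. }
  generalize (filter_and _ _ Hn (Hl eps Heps)). apply filter_imp. intros w [N Hw].
  replace (/ f w - / f z - - a / f z ^ 2 * (w - z))%C
    with ((- p w / (f w * f z) - - a / f z ^ 2) * (w - z))%C.
  - rewrite Cmod_mult. apply Rmult_le_compat_r; [apply Cmod_ge_0 | lra].
  - replace (/ f w - / f z)%C with (- (f w - f z) / (f w * f z))%C by (field; auto).
    rewrite H3. field. auto.
Qed.

Lemma cderiv_div (f g : C -> C) (z a b : C) :
  g z <> RtoC 0 -> cderiv f z a -> cderiv g z b ->
  cderiv (fun w => f w / g w)%C z ((a * g z - f z * b) / g z ^ 2)%C.
Proof.
  intros Hz Hf Hg.
  replace ((a * g z - f z * b) / g z ^ 2)%C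
    with (a * / g z + f z * (- b / g z ^ 2))%C by (field; exact Hz).
  apply (cderiv_mult f (fun w => / g w)%C); [easy | now apply cderiv_inv].
Qed.

Lemma holo_const (U : C -> Prop) (a : C) : holo U (fun _ => a).
Proof. intros z _. eexists. apply cderiv_const. Qed.

Lemma holo_id (U : C -> Prop) : holo U (fun z => z).
Proof. intros z _. eexists. apply cderiv_id. Qed.

Lemma holo_plus (U : C -> Prop) (f g : C -> C) :
  holo U f -> holo U g -> holo U (fun z => f z + g z)%C.
Proof.
  intros Hf Hg z Hz. destruct (Hf z Hz), (Hg z Hz).
  eexists. apply cderiv_plus; eassumption.
Qed.

Lemma holo_opp (U : C -> Prop) (f : C -> C) :
  holo U f -> holo U (fun z => - f z)%C.
Proof. intros Hf z Hz. destruct (Hf z Hz). eexists. apply cderiv_opp; eassumption. Qed.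

Lemma holo_minus (U : C -> Prop) (f g : C -> C) :
  holo U f -> holo U g -> holo U (fun z => f z - g z)%C.
Proof. intros Hf Hg. apply holo_plus; [easy | now apply holo_opp]. Qed.

Lemma holo_mult (U : C -> Prop) (f g : C -> C) :
  holo U f -> holo U g -> holo U (fun z => f z * g z)%C.
Proof.
  intros Hf Hg z Hz. destruct (Hf z Hz), (Hg z Hz).
  eexists. apply cderiv_mult; eassumption.
Qed.

Lemma holo_pow (U : C -> Prop) (f : C -> C) (n : nat) :
  holo U f -> holo U (fun z => f z ^ n)%C.
Proof.
  intros Hf. induction n as [|n IH]; [apply (holo_const U (RtoC 1)) |].
  now apply (holo_mult U f (fun z => f z ^ n)%C).
Qed.

Lemma holo_inv (U : C -> Prop) (f : C -> C) :
  (forall z, U z -> f z <> RtoC 0) -> holo U f -> holo U (fun z => / f z)%C.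
Proof.
  intros N Hf z Hz. destruct (Hf z Hz).
  eexists. apply cderiv_inv; [now apply N | eassumption].
Qed.

Lemma holo_div (U : C -> Prop) (f g : C -> C) :
  (forall z, U z -> g z <> RtoC 0) -> holo U f -> holo U g ->
  holo U (fun z => f z / g z)%C.
Proof. intros N Hf Hg. apply holo_mult; [easy | now apply holo_inv]. Qed.

Lemma holo_comp (U W : C -> Prop) (f g : C -> C) :
  (forall z, U z -> W (g z)) -> holo U g -> holo W f -> holo U (fun z => f (g z)).
Proof.
  intros N Hg Hf z Hz. destruct (Hg z Hz), (Hf (g z) (N z Hz)).
  eexists. eapply cderiv_comp; eassumption.
Qed.

Lemma cderiv_of_is_derive (f : C -> C) (z d : C) :
  is_derive (K := C_AbsRing) (V := C_NormedModule) f z d -> cderiv f z d.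
Proof.
  intros [_ H]. apply cderiv_of_eps. intros eps Heps.
  destruct (H z (fun P HP => HP) (mkposreal eps Heps)) as [dl Hd].
  exists dl; split; [apply cond_pos |]. intros w Hw.
  specialize (Hd w Hw). 
  replace (d * (w - z))%C with ((w - z) * d)%C by ring. exact Hd.
Qed.

Lemma holo_of_holomorphic_on_Delta (f : C -> C) :
  holomorphic_on_Delta f -> holo Delta f.
Proof.
  intros H z Hz. destruct (H z Hz) as [d Hd]. exists d.
  now apply cderiv_of_is_derive.
Qed.

(** * One-sided limits and right derivatives of curves *)

Definition right_0 (P : R -> Prop) : Prop :=
  exists delta : R, 0 < delta /\ forall s, 0 < s < delta -> P s.

(** The condition [0 <= s] keeps the junk values of a semigroup at negative times out of the
    limit. *)
Definition left_near (t : R) (P : R -> Prop) : Prop :=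
  exists delta : R, 0 < delta /\ forall s, 0 <= s -> t - delta < s < t -> P s.

Global Instance right_0_proper : ProperFilter right_0.
Proof.
  split; [| split].
  - intros P [d [Hd H]]. exists (d / 2). apply H. lra.
  - exists 1; split; [lra | easy].
  - intros P Q [d1 [H1 HP]] [d2 [H2 HQ]].
    exists (Rmin d1 d2); split; [now apply Rmin_glb_lt |].
    intros w Hw. assert (A := Rmin_l d1 d2). assert (B := Rmin_r d1 d2).
    split; [apply HP | apply HQ]; lra.
  - intros P Q HPQ [d [Hd HP]]; exists d; split; auto.
Qed.

Global Instance left_near_filter (t : R) : Filter (left_near t).
Proof.
  split.
  - exists 1; split; [lra | easy].
  - intros P Q [d1 [H1 HP]] [d2 [H2 HQ]].
    exists (Rmin d1 d2); split; [now apply Rmin_glb_lt |].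
    intros w H0 Hw. assert (A := Rmin_l d1 d2). assert (B := Rmin_r d1 d2).
    split; [apply HP | apply HQ]; lra.
  - intros P Q HPQ [d [Hd HP]]; exists d; split; auto.
Qed.

Lemma right_0_at_right (P : R -> Prop) : right_0 P <-> at_right 0 P.
Proof.
  split.
  - intros [d [Hd H]]. exists (mkposreal d Hd). intros s Hs Hpos. apply H.
    change (Rabs (s - 0) < d) in Hs.
    split; [easy |]. apply Rabs_lt_between in Hs. lra.
  - intros [d H]. exists d. split; [apply cond_pos |]. intros s Hs. apply H; [| easy].
    change (Rabs (s - 0) < d). rewrite Rabs_pos_eq; lra.
Qed.

Lemma clim_of_filterlim {T : Type} (F : (T -> Prop) -> Prop) {FF : Filter F}
    (f : T -> C) (l : C) :
  filterlim f F (locally l) -> clim F f l.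
Proof.
  intros H eps Heps. apply (H (fun y => Cmod (y - l) < eps)). apply locally_C.
  exists (mkposreal eps Heps). intros w Hw. exact Hw.
Qed.

(** Differentiation from the right only, because the definition of the generator controls nothing
    else. *)
Definition rderiv (x : R -> C) (t : R) (d : C) : Prop :=
  clim right_0 (fun s => (x (t + s)%R - x t) / RtoC s)%C d.

Lemma RtoC_neq_0 (s : R) : s <> 0 -> RtoC s <> RtoC 0.
Proof. intros H E. apply H. now apply RtoC_inj. Qed.

Lemma right_0_pos : right_0 (fun s => RtoC s <> RtoC 0).
Proof. exists 1; split; [lra |]. intros s Hs. apply RtoC_neq_0. lra. Qed.

Lemma clim_right_0_RtoC : clim right_0 RtoC (RtoC 0).
Proof.
  intros eps Heps. exists eps; split; [easy |]. intros s Hs.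
  rewrite <- RtoC_minus, Cmod_R, Rabs_pos_eq; lra.
Qed.

Lemma rderiv_right_cont (x : R -> C) (t : R) (d : C) :
  rderiv x t d -> clim right_0 (fun s => x (t + s)%R) (x t).
Proof.
  intros H.
  assert (H1 : clim right_0 (fun s => x t + (x (t + s)%R - x t) / RtoC s * RtoC s)%C
                 (x t + d * RtoC 0)%C).
  { apply clim_plus; [apply _ | apply clim_const, _ |].
    apply clim_mult; [apply _ | exact H | apply clim_right_0_RtoC]. }
  replace (x t + d * RtoC 0)%C with (x t) in H1 by ring.
  revert H1. apply clim_ext; [apply _ |]. generalize right_0_pos. apply filter_imp.
  intros s Hs. field. exact Hs.
Qed.

Lemma rderiv_eps (x : R -> C) (t : R) (d : C) :
  rderiv x t d -> forall eps, 0 < eps ->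
  right_0 (fun s => Cmod (x (t + s)%R - x t - RtoC s * d) <= eps * s).
Proof.
  intros H eps Heps. destruct (H eps Heps) as [dl [Hd Hs]].
  exists dl; split; [easy |]. intros s Hs'. specialize (Hs s Hs').
  assert (N : RtoC s <> RtoC 0) by (apply RtoC_neq_0; lra).
  replace (x (t + s)%R - x t - RtoC s * d)%C
    with (((x (t + s)%R - x t) / RtoC s - d) * RtoC s)%C by (field; exact N).
  rewrite Cmod_mult, Cmod_R, (Rabs_pos_eq s) by lra.
  apply Rmult_le_compat_r; lra.
Qed.

Lemma rderiv_minus (x y : R -> C) (t : R) (a b : C) :
  rderiv x t a -> rderiv y t b -> rderiv (fun s => x s - y s)%C t (a - b)%C.
Proof.
  intros Hx Hy. generalize (clim_minus _ _ _ _ _ Hx Hy). apply clim_ext; [apply _ |].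
  generalize right_0_pos. apply filter_imp. intros s Hs. field. exact Hs.
Qed.

Lemma rderiv_linear (c : C) (t : R) : rderiv (fun s => c * RtoC s)%C t c.
Proof.
  apply (clim_ext _ (fun _ => c)); [| apply clim_const, _].
  generalize right_0_pos. apply filter_imp. intros s Hs. rewrite RtoC_plus.
  field. exact Hs.
Qed.

Lemma rderiv_mult (x y : R -> C) (t : R) (a b : C) :
  rderiv x t a -> rderiv y t b ->
  rderiv (fun s => x s * y s)%C t (a * y t + x t * b)%C.
Proof.
  intros Hx Hy. assert (Hc := rderiv_right_cont _ _ _ Hx).
  assert (H : clim right_0 (fun s => (x (t + s)%R - x t) / RtoC s * y t
      + x (t + s)%R * ((y (t + s)%R - y t) / RtoC s))%C (a * y t + x t * b)%C).
  { apply clim_plus; [apply _ | |]; (apply clim_mult; [apply _ | |]); auto.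
    apply clim_const, _. }
  revert H. apply clim_ext; [apply _ |].
  generalize right_0_pos. apply filter_imp. intros s Hs. field. exact Hs.
Qed.

Lemma rderiv_comp (V : C -> C) (x : R -> C) (t : R) (v d : C) :
  cderiv V (x t) v -> rderiv x t d -> rderiv (fun s => V (x s)) t (v * d)%C.
Proof.
  intros [p [H1 [H2 H3]]] Hx. assert (Hc := rderiv_right_cont _ _ _ Hx).
  assert (H : clim right_0 (fun s => p (x (t + s)%R) * ((x (t + s)%R - x t) / RtoC s))%C
                (v * d)%C).
  { apply clim_mult; [apply _ | | exact Hx].
    now apply (clim_comp _ (fun s => x (t + s)%R) p (x t)). }
  revert H. apply clim_ext; [apply _ |].
  generalize right_0_pos. apply filter_imp. intros s Hs. rewrite H3. field. exact Hs.
Qed.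

Lemma rderiv_unique (x : R -> C) (t : R) (a b : C) :
  rderiv x t a -> rderiv x t b -> a = b.
Proof. intros Ha Hb. exact (clim_unique right_0 _ a b _ Ha Hb). Qed.

(** The supremum of the initial segments on which [P] holds is attained by the third hypothesis, and
    by the second it cannot lie before [t]. *)
Lemma real_induction (P : R -> Prop) (T : R) :
  P 0 ->
  (forall t, 0 <= t < T -> P t -> right_0 (fun s => P (t + s)%R)) ->
  (forall t, 0 < t <= T -> (forall s, 0 <= s < t -> P s) -> P t) ->
  forall t, 0 <= t <= T -> P t.
Proof.
  intros P0 Pr Pl t Ht.
  set (E := fun u => 0 <= u <= t /\ forall s, 0 <= s <= u -> P s).
  assert (E0 : E 0). { split; [lra |]. intros s Hs. now replace s with 0 by lra. }
  destruct (completeness E) as [u [Hub Hlub]].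
  { exists t. intros s [Hs _]. lra. }
  { now exists 0. }
  assert (Hu0 : 0 <= u) by now apply Hub.
  assert (Hut : u <= t). { apply Hlub. intros s [Hs _]. lra. }
  assert (Hbelow : forall s, 0 <= s < u -> P s).
  { intros s Hs. apply NNPP. intros N.
    assert (u <= s); [| lra]. apply Hlub. intros w [Hw Hw'].
    destruct (Rle_lt_dec w s) as [L | L]; [easy |]. exfalso. apply N, Hw'. lra. }
  assert (Hu : P u).
  { destruct (Req_dec u 0) as [-> | N]; [easy |]. apply Pl; [lra | exact Hbelow]. }
  assert (HE : forall s, 0 <= s <= u -> P s).
  { intros s Hs. destruct (Req_dec s u) as [-> | N]; [easy |]. apply Hbelow. lra. }
  destruct (Req_dec u t) as [<- | N]; [easy | exfalso].
  destruct (Pr u) as [d [Hd Hs]]; [lra | easy |].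
  set (w := Rmin (d / 2) (t - u)).
  assert (Hw1 : w <= d / 2) by apply Rmin_l. assert (Hw2 : w <= t - u) by apply Rmin_r.
  assert (Hw : 0 < w) by (apply Rmin_glb_lt; lra).
  assert (u + w <= u); [| lra]. apply Hub. split; [lra |]. intros s Hsw.
  destruct (Rle_lt_dec s u) as [L | L]; [apply HE; lra |].
  replace s with (u + (s - u)) by ring. apply Hs. lra.
Qed.

(** The bound on the derivative is only required as long as the increment itself
    has not left the controlled range: a bootstrap. *)
Lemma increment_bound (x : R -> C) (T M M' : R) :
  M < M' ->
  (forall t, 0 < t <= T -> clim (left_near t) x (x t)) ->
  (forall t, 0 <= t < T -> Cmod (x t - x 0) <= M' * t ->
     exists D, rderiv x t D /\ Cmod D <= M) ->
  forall t, 0 <= t <= T -> Cmod (x t - x 0) <= M' * t.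
Proof.
  intros HM Hl Hd. apply real_induction.
  - rewrite Cmod_sub_self. lra.
  - intros t Ht HP. destruct (Hd t Ht HP) as [D [HD HDM]].
    assert (He : 0 < M' - M) by lra.
    destruct (rderiv_eps _ _ _ HD _ He) as [dl [Hdl Hs]]. exists dl; split; [easy |].
    intros s Hs'. specialize (Hs s Hs').
    assert (H1 : Cmod (x (t + s)%R - x t) <= M' * s).
    { replace (x (t + s)%R - x t)%C
        with ((x (t + s)%R - x t - RtoC s * D) + RtoC s * D)%C by ring.
      eapply Rle_trans; [apply Cmod_triangle |].
      rewrite Cmod_mult, Cmod_R, Rabs_pos_eq by lra.
      assert (s * Cmod D <= s * M) by (apply Rmult_le_compat_l; lra). lra. }
    eapply Rle_trans; [apply (Cmod_sub_triangle _ (x t)) |]. lra.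
  - intros t Ht HP. apply Rnot_lt_le. intros Hlt.
    assert (He : 0 < (Cmod (x t - x 0) - M' * t) / 2) by lra.
    assert (HM0 : 0 <= M').
    { specialize (HP (t / 2)). assert (0 <= t / 2 < t) by lra. specialize (HP H).
      assert (H0 := Cmod_ge_0 (x (t / 2) - x 0)).
      apply Rnot_lt_le. intros HM1. nra. }
    destruct (Hl t Ht _ He) as [dl [Hdl Hs]].
    (* A time just before [t], where the bound holds and [x] is already close to [x t]; the maximum
       with 0 keeps it in the domain. *)
    set (s := Rmax 0 (t - dl / 2)).
    assert (Hs1 : 0 <= s) by apply Rmax_l.
    assert (Hs2 : t - dl / 2 <= s) by apply Rmax_r.
    assert (Hs3 : s < t) by (apply Rmax_lub_lt; lra).
    specialize (Hs s Hs1). assert (Hr : t - dl < s < t) by lra. specialize (Hs Hr).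
    specialize (HP s (conj Hs1 Hs3)).
    assert (H2 := Cmod_sub_triangle (x t) (x s) (x 0)).
    rewrite (Cmod_sub_sym (x t) (x s)) in H2. nra.
Qed.

Lemma rderiv_0_constant (x : R -> C) (T : R) :
  (forall t, 0 < t <= T -> clim (left_near t) x (x t)) ->
  (forall t, 0 <= t < T -> rderiv x t (RtoC 0)) ->
  forall t, 0 <= t <= T -> x t = x 0.
Proof.
  intros Hl Hd t Ht. apply Cmod_eq_0_sub. apply Rle_antisym; [| apply Cmod_ge_0].
  apply Rnot_lt_le. intros Hlt. set (m := Cmod (x t - x 0)) in *.
  (* Any positive rate is admissible in [increment_bound]; this one allows a total increment of at
     most [m / 2]. *)
  assert (Hm : 0 < m / (2 * (T + 1))) by (apply Rdiv_lt_0_compat; lra).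
  assert (H := increment_bound x T 0 _ Hm Hl).
  assert (H1 : m <= m / (2 * (T + 1)) * t).
  { apply H; [| easy]. intros s Hs _. exists (RtoC 0).
    split; [now apply Hd | rewrite Cmod_0; lra]. }
  assert (H2 : m / (2 * (T + 1)) * t <= m / (2 * (T + 1)) * (T + 1))
    by (apply Rmult_le_compat_l; lra).
  replace (m / (2 * (T + 1)) * (T + 1)) with (m / 2) in H2 by (field; lra). lra.
Qed.

Lemma clim_left_RtoC (t : R) : clim (left_near t) RtoC (RtoC t).
Proof.
  intros eps Heps. exists eps; split; [easy |]. intros s _ Hs.
  rewrite <- RtoC_minus, Cmod_R, Rabs_left; lra.
Qed.

(** * Mean value inequalities on convex sets *)

Definition convex (U : C -> Prop) : Prop :=
  forall a b t, U a -> U b -> 0 <= t <= 1 -> U (a + RtoC t * (b - a))%C.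

Lemma rderiv_segment (h : C -> C) (a b d : C) (t : R) :
  cderiv h (a + RtoC t * (b - a))%C d ->
  rderiv (fun s => h (a + RtoC s * (b - a))%C) t (d * (b - a))%C.
Proof.
  intros H. apply (rderiv_comp h (fun s => a + RtoC s * (b - a))%C); [exact H |].
  apply (clim_ext _ (fun _ => b - a)%C); [| apply clim_const, _].
  generalize right_0_pos. apply filter_imp. intros s Hs. rewrite RtoC_plus.
  field. exact Hs.
Qed.

Lemma clim_left_segment (a b : C) (t : R) :
  clim (left_near t) (fun s => a + RtoC s * (b - a))%C (a + RtoC t * (b - a))%C.
Proof.
  apply clim_plus; [apply _ | apply clim_const, _ |].
  apply clim_mult; [apply _ | apply clim_left_RtoC | apply clim_const, _].
Qed.

Lemma convex_mean_value (U : C -> Prop) (h k : C -> C) (c : C) (M : R) :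
  convex U -> (forall z, U z -> cderiv h z (k z)) ->
  forall a b, U a -> U b ->
  (forall t, 0 <= t <= 1 -> Cmod (k (a + RtoC t * (b - a))%C - c) <= M) ->
  Cmod (h b - h a - c * (b - a)) <= M * Cmod (b - a).
Proof.
  intros HU Hh a b Ha Hb HM. apply Rnot_lt_le. intros Hlt.
  set (x := fun s : R => (h (a + RtoC s * (b - a)) - c * (b - a) * RtoC s)%C).
  (* Midway between the claimed bound and the supposed larger increment: a rate that
     [increment_bound] accepts and the increment still exceeds. *)
  assert (HM' : M * Cmod (b - a) < (M * Cmod (b - a) + Cmod (h b - h a - c * (b - a))) / 2)
    by lra.
  assert (H := increment_bound x 1 _ _ HM').
  assert (Hx : (x 1 - x 0)%C = (h b - h a - c * (b - a))%C).
  { unfold x. replace (a + RtoC 1 * (b - a))%C with b by ring.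
    replace (a + RtoC 0 * (b - a))%C with a by ring. ring. }
  assert (H1 : Cmod (x 1 - x 0)
     <= (M * Cmod (b - a) + Cmod (h b - h a - c * (b - a))) / 2 * 1).
  { apply H; [| | lra].
    - intros t Ht. unfold x. apply clim_minus; [apply _ | |].
      + apply (clim_comp _ (fun s => a + RtoC s * (b - a))%C h
                 (a + RtoC t * (b - a))%C); [apply clim_left_segment |].
        eapply cderiv_cont, Hh, HU; auto; lra.
      + apply clim_mult; [apply _ | apply clim_const, _ | apply clim_left_RtoC].
    - intros t Ht _. exists (k (a + RtoC t * (b - a)) * (b - a) - c * (b - a))%C. split.
      + apply rderiv_minus; [| apply rderiv_linear].
        apply rderiv_segment, Hh, HU; auto; lra.
      + replace (k (a + RtoC t * (b - a)) * (b - a) - c * (b - a))%C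
          with ((k (a + RtoC t * (b - a)) - c) * (b - a))%C by ring.
        rewrite Cmod_mult. apply Rmult_le_compat_r; [apply Cmod_ge_0 |].
        apply HM. lra. }
  rewrite Hx in H1. lra.
Qed.

Lemma convex_cderiv_0_constant (U : C -> Prop) (h : C -> C) :
  convex U -> (forall z, U z -> cderiv h z (RtoC 0)) ->
  forall a b, U a -> U b -> h a = h b.
Proof.
  intros HU Hh a b Ha Hb. symmetry. apply Cmod_eq_0_sub.
  apply Rle_antisym; [| apply Cmod_ge_0].
  assert (H := convex_mean_value U h (fun _ => RtoC 0) (RtoC 0) 0 HU Hh a b Ha Hb).
  replace (h b - h a)%C with (h b - h a - RtoC 0 * (b - a))%C by ring.
  eapply Rle_trans; [apply H |].
  - intros t _. rewrite Cmod_sub_self. lra.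
  - lra.
Qed.

(** If the derivative stays within [Cmod c / 2] of [c], then [h b - h a] differs from [c * (b - a)]
    by at most half of its modulus, so it vanishes only for [a = b]. *)
Lemma convex_injective (U : C -> Prop) (h k : C -> C) (c : C) :
  convex U -> (forall z, U z -> cderiv h z (k z)) -> c <> RtoC 0 ->
  (forall z, U z -> Cmod (k z - c) <= Cmod c / 2) ->
  forall a b, U a -> U b -> h a = h b -> a = b.
Proof.
  intros HU Hh Hc Hk a b Ha Hb E. symmetry. apply Cmod_eq_0_sub.
  apply Cmod_gt_0 in Hc.
  assert (H := convex_mean_value U h k c (Cmod c / 2) HU Hh a b Ha Hb).
  assert (H1 : Cmod (h b - h a - c * (b - a)) <= Cmod c / 2 * Cmod (b - a)).
  { apply H. intros t Ht. now apply Hk, HU. }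
  rewrite E in H1. replace (h b - h b - c * (b - a))%C with (- (c * (b - a)))%C in H1 by ring.
  rewrite Cmod_opp, Cmod_mult in H1. generalize (Cmod_ge_0 (b - a)). nra.
Qed.

Lemma convex_lipschitz (U : C -> Prop) (h k : C -> C) (c : C) :
  convex U -> (forall z, U z -> cderiv h z (k z)) ->
  (forall z, U z -> Cmod (k z - c) <= Cmod c / 2) ->
  forall a b, U a -> U b -> Cmod (h b - h a) <= 2 * Cmod c * Cmod (b - a).
Proof.
  intros HU Hh Hk a b Ha Hb.
  assert (H1 : Cmod (h b - h a - c * (b - a)) <= Cmod c / 2 * Cmod (b - a)).
  { apply (convex_mean_value U h k); auto. }
  assert (H2 := Cmod_triangle (h b - h a - c * (b - a)) (c * (b - a))).
  replace (h b - h a - c * (b - a) + c * (b - a))%C with (h b - h a)%C in H2 by ring.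
  rewrite Cmod_mult in H2. generalize (Cmod_ge_0 c), (Cmod_ge_0 (b - a)). nra.
Qed.

Lemma convex_combination_gt (x y t K : R) :
  K < x -> K < y -> 0 <= t <= 1 -> K < (1 - t) * x + t * y.
Proof.
  intros Hx Hy Ht. assert (A := Rmin_l x y). assert (B := Rmin_r x y).
  assert (M : K < Rmin x y) by now apply Rmin_glb_lt.
  assert ((1 - t) * Rmin x y <= (1 - t) * x) by (apply Rmult_le_compat_l; lra).
  assert (t * Rmin x y <= t * y) by (apply Rmult_le_compat_l; lra). lra.
Qed.

Lemma disc_convex (p : C) (r : R) : convex (fun z => Cmod (z - p) < r).
Proof.
  intros a b t Ha Hb Ht.
  replace (a + RtoC t * (b - a) - p)%C with (RtoC (1 - t) * (a - p) + RtoC t * (b - p))%C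
    by (rewrite RtoC_minus; ring).
  eapply Rle_lt_trans; [apply Cmod_triangle |].
  rewrite !Cmod_mult, !Cmod_R, !Rabs_pos_eq by lra.
  assert (H := convex_combination_gt (- Cmod (a - p)) (- Cmod (b - p)) t (- r)). lra.
Qed.

Lemma Csub_0_r (z : C) : (z - RtoC 0)%C = z.
Proof. ring. Qed.

Lemma Delta_convex : convex Delta.
Proof.
  intros a b t Ha Hb Ht. unfold Delta in *. rewrite <- (Csub_0_r a) in Ha.
  rewrite <- (Csub_0_r b) in Hb. rewrite <- (Csub_0_r (a + _)%C).
  exact (disc_convex (RtoC 0) 1 a b t Ha Hb Ht).
Qed.

(** * Goursat's theorem and primitives on convex sets *)

(** Retypes an equality stated in the carrier of a normed module, so that [ring] and [field]
    recognise the field [C]. *)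
Ltac C_eq := match goal with |- ?a = ?b => change (@eq C a b) end.

Definition seg_fun (k : C -> C) (a b : C) (s : R) : C :=
  ((b - a) * k (a + RtoC s * (b - a)))%C.

(** The complex line integral of [k] along the segment from [a] to [b]. *)
Definition seg (k : C -> C) (a b : C) : C :=
  RInt (V := C_R_CompleteNormedModule) (seg_fun k a b) 0 1.

Definition continuous_on_segment (k : C -> C) (a b : C) : Prop :=
  forall s, 0 <= s <= 1 ->
    clim (near (a + RtoC s * (b - a))%C) k (k (a + RtoC s * (b - a))%C).

Lemma scal_R_C (s : R) (z : C) : scal (V := C_R_NormedModule) s z = (RtoC s * z)%C.
Proof. destruct z as [x y]. apply injective_projections; simpl; unfold scal; simpl; unfold mult; simpl; ring. Qed.

Lemma continuous_of_clim (f : R -> C) (t : R) :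
  (forall eps, 0 < eps -> exists delta, 0 < delta /\
     forall s, Rabs (s - t) < delta -> Cmod (f s - f t) < eps) ->
  continuous (U := C_R_CompleteNormedModule) f t.
Proof.
  intros H. apply filterlim_locally. intros eps.
  destruct (H eps (cond_pos eps)) as [d [Hd Hs]].
  exists (mkposreal d Hd). intros s Hs'. specialize (Hs s Hs').
  split.
  - eapply Rle_lt_trans; [| exact Hs]. apply (re_le_Cmod (f s - f t)).
  - eapply Rle_lt_trans; [| exact Hs]. apply (Im_le_Cmod (f s - f t)).
Qed.

Lemma is_RInt_seg (k : C -> C) (a b : C) :
  continuous_on_segment k a b ->
  is_RInt (V := C_R_CompleteNormedModule) (seg_fun k a b) 0 1 (seg k a b).
Proof.
  intros H. apply RInt_correct, ex_RInt_continuous. intros t Ht.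
  rewrite Rmin_left, Rmax_right in Ht by lra.
  apply continuous_of_clim. intros eps Heps.
  assert (Hl : clim (near (a + RtoC t * (b - a))%C) (fun w => (b - a) * k w)%C
      ((b - a) * k (a + RtoC t * (b - a)))%C).
  { apply clim_mult; [apply _ | apply clim_const, _ | now apply H]. }
  destruct (Hl eps Heps) as [d [Hd Hw]].
  assert (Hc : 0 < Cmod (b - a) + 1) by (generalize (Cmod_ge_0 (b - a)); lra).
  exists (d / (Cmod (b - a) + 1)). split; [now apply Rdiv_lt_0_compat |].
  intros s Hs. apply Hw.
  replace (a + RtoC s * (b - a) - (a + RtoC t * (b - a)))%C
    with (RtoC (s - t) * (b - a))%C by (rewrite RtoC_minus; ring).
  rewrite Cmod_mult, Cmod_R. apply Rlt_div_r in Hs; [| easy].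
  eapply Rle_lt_trans; [| exact Hs].
  apply Rmult_le_compat_l; [apply Rabs_pos | lra].
Qed.

Lemma seg_unique (k : C -> C) (a b l : C) :
  is_RInt (V := C_R_CompleteNormedModule) (seg_fun k a b) 0 1 l -> seg k a b = l.
Proof. exact (is_RInt_unique (V := C_R_CompleteNormedModule) _ _ _ _). Qed.

Lemma is_RInt_linear_change (f g : R -> C) (u v a b a' b' : R) (l : C) :
  u * a + v = a' -> u * b + v = b' ->
  (forall s, g s = RtoC u * f (u * s + v)%R)%C ->
  is_RInt (V := C_R_CompleteNormedModule) f a' b' l ->
  is_RInt (V := C_R_CompleteNormedModule) g a b l.
Proof.
  intros <- <- Hg H. apply is_RInt_comp_lin in H. revert H. apply is_RInt_ext.
  intros s _. rewrite Hg. apply scal_R_C.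
Qed.

Lemma seg_opp (k : C -> C) (a b : C) :
  continuous_on_segment k a b -> seg k b a = (- seg k a b)%C.
Proof.
  intros H. apply seg_unique.
  assert (H1 := is_RInt_swap _ _ _ _ (is_RInt_seg k a b H)).
  refine (is_RInt_linear_change _ _ (-1) 1 _ _ _ _ _ _ _ _ H1); try ring.
  intros s. unfold seg_fun.
  replace (a + RtoC (-1 * s + 1) * (b - a))%C with (b + RtoC s * (a - b))%C
    by (rewrite RtoC_plus, RtoC_mult; ring).
  C_eq. ring.
Qed.

Lemma seg_midpoint (k : C -> C) (a b : C) :
  continuous_on_segment k a b ->
  seg k a b = (seg k a ((a + b) / 2) + seg k ((a + b) / 2) b)%C.
Proof.
  intros H. assert (H1 := is_RInt_seg k a b H).
  assert (E : ex_RInt (V := C_R_CompleteNormedModule) (seg_fun k a b) 0 1)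
    by (exists (seg k a b); exact H1).
  assert (E1 : ex_RInt (V := C_R_CompleteNormedModule) (seg_fun k a b) 0 (/ 2))
    by (eapply ex_RInt_Chasles_1; [| exact E]; lra).
  assert (E2 : ex_RInt (V := C_R_CompleteNormedModule) (seg_fun k a b) (/ 2) 1)
    by (eapply ex_RInt_Chasles_2; [| exact E]; lra).
  assert (N : (2 : C) <> 0) by (apply RtoC_neq_0; lra).
  unfold seg at 1. rewrite <- (RInt_Chasles _ 0 (/ 2) 1) by assumption.
  symmetry.
  change (plus (RInt (V := C_R_CompleteNormedModule) (seg_fun k a b) 0 (/ 2))
               (RInt (V := C_R_CompleteNormedModule) (seg_fun k a b) (/ 2) 1))
    with (RInt (V := C_R_CompleteNormedModule) (seg_fun k a b) 0 (/ 2)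
          + RInt (V := C_R_CompleteNormedModule) (seg_fun k a b) (/ 2) 1)%C.
  apply f_equal2.
  - apply seg_unique. apply RInt_correct in E1.
    refine (is_RInt_linear_change _ _ (/ 2) 0 _ _ _ _ _ _ _ _ E1); try ring.
    intros s. unfold seg_fun.
    replace (a + RtoC (/ 2 * s + 0) * (b - a))%C
      with (a + RtoC s * ((a + b) / 2 - a))%C
      by (rewrite RtoC_plus, RtoC_mult, RtoC_inv by lra; field; exact N).
    C_eq. rewrite RtoC_inv by lra. field.
  - apply seg_unique. apply RInt_correct in E2.
    refine (is_RInt_linear_change _ _ (/ 2) (/ 2) _ _ _ _ _ _ _ _ E2); try lra.
    intros s. unfold seg_fun.
    replace (a + RtoC (/ 2 * s + / 2) * (b - a))%C
      with ((a + b) / 2 + RtoC s * (b - (a + b) / 2))%C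
      by (rewrite RtoC_plus, RtoC_mult, RtoC_inv by lra; field; exact N).
    C_eq. rewrite RtoC_inv by lra. field.
Qed.

(** Affine functions are the comparison functions in Goursat's theorem. The value is an increment of
    [al * w + be * w ^ 2 / 2], so these integrals cancel around a triangle. *)
Lemma is_RInt_seg_affine (al be a b : C) :
  is_RInt (V := C_R_CompleteNormedModule) (seg_fun (fun w => al + be * w)%C a b) 0 1
    (al * (b - a) + be * (b * b - a * a) / 2)%C.
Proof.
  set (A := ((al + be * a) * (b - a))%C). set (B := (be * (b - a) * (b - a))%C).
  assert (N : (2 : C) <> 0) by (apply RtoC_neq_0; lra).
  assert (H : is_RInt (V := C_R_CompleteNormedModule)
    (fun s : R => plus (scal (V := C_R_CompleteNormedModule) 1 A)
                       (scal (V := C_R_CompleteNormedModule) s B)) 0 1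
    (minus (G := C_R_CompleteNormedModule)
      (plus (scal (V := C_R_CompleteNormedModule) 1 A)
            (scal (V := C_R_CompleteNormedModule) (1 * 1 / 2) B))
      (plus (scal (V := C_R_CompleteNormedModule) 0 A)
            (scal (V := C_R_CompleteNormedModule) (0 * 0 / 2) B)))).
  { apply (is_RInt_derive (V := C_R_CompleteNormedModule)
      (fun s : R => plus (scal (V := C_R_CompleteNormedModule) s A)
                     (scal (V := C_R_CompleteNormedModule) (s * s / 2) B))).
    - intros s _. apply (is_derive_plus (V := C_R_CompleteNormedModule)).
      + apply (is_derive_scal_l (K := R_AbsRing) (V := C_R_CompleteNormedModule)
                 (fun s => s)). apply (is_derive_id (K := R_AbsRing)).
      + apply (is_derive_scal_l (K := R_AbsRing) (V := C_R_CompleteNormedModule)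
                 (fun s => s * s / 2)). auto_derive; [easy | lra].
    - intros s _. apply continuous_of_clim. intros eps Heps.
      assert (Hc : 0 < Cmod B + 1) by (generalize (Cmod_ge_0 B); lra).
      exists (eps / (Cmod B + 1)). split; [now apply Rdiv_lt_0_compat |].
      intros t Ht. rewrite !scal_R_C.
      match goal with |- Cmod ?x < _ => replace x with (RtoC (t - s) * B)%C end.
      2: { change (RtoC (t - s) * B = RtoC 1 * A + RtoC t * B - (RtoC 1 * A + RtoC s * B))%C.
           rewrite RtoC_minus. ring. }
      rewrite Cmod_mult, Cmod_R. apply Rlt_div_r in Ht; [| easy].
      eapply Rle_lt_trans; [| exact Ht].
      apply Rmult_le_compat_l; [apply Rabs_pos | lra]. }
  rewrite !scal_R_C in H.
  match type of H with is_RInt _ _ _ ?l =>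
    replace l with (al * (b - a) + be * (b * b - a * a) / 2)%C in H end.
  - revert H. apply is_RInt_ext. intros s _. rewrite !scal_R_C.
    change (RtoC 1 * A + RtoC s * B = seg_fun (fun w => al + be * w)%C a b s)%C.
    unfold seg_fun, A, B. ring.
  - change (al * (b - a) + be * (b * b - a * a) / 2
      = (RtoC 1 * A + RtoC (1 * 1 / 2) * B) - (RtoC 0 * A + RtoC (0 * 0 / 2) * B))%C.
    unfold A, B. rewrite !RtoC_div, !RtoC_mult by lra. field.
Qed.

Lemma seg_near_affine (k : C -> C) (a b al be : C) (M : R) :
  continuous_on_segment k a b ->
  (forall s, 0 <= s <= 1 ->
     Cmod (k (a + RtoC s * (b - a)) - (al + be * (a + RtoC s * (b - a))))%C <= M) ->
  Cmod (seg k a b - (al * (b - a) + be * (b * b - a * a) / 2)) <= M * Cmod (b - a).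
Proof.
  intros Hc HM.
  assert (H := is_RInt_minus _ _ _ _ _ _ (is_RInt_seg k a b Hc)
                 (is_RInt_seg_affine al be a b)).
  replace (M * Cmod (b - a)) with ((1 - 0) * (M * Cmod (b - a))) by ring.
  rewrite Cmod_norm.
  refine (norm_RInt_le_const _ 0 1 _ _ _ _ H); [lra |].
  intros s Hs.
  change (norm (V := prod_NormedModule R_AbsRing R_NormedModule R_NormedModule)
    (seg_fun k a b s - seg_fun (fun w => al + be * w) a b s)%C <= M * Cmod (b - a)).
  rewrite <- Cmod_norm. unfold seg_fun.
  replace ((b - a) * k (a + RtoC s * (b - a)) - (b - a) * (al + be * (a + RtoC s * (b - a))))%C
    with ((k (a + RtoC s * (b - a)) - (al + be * (a + RtoC s * (b - a)))) * (b - a))%C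
    by ring.
  rewrite Cmod_mult. apply Rmult_le_compat_r; [apply Cmod_ge_0 | now apply HM].
Qed.

Lemma holo_continuous_on_segment (U : C -> Prop) (k : C -> C) (a b : C) :
  convex U -> holo U k -> U a -> U b -> continuous_on_segment k a b.
Proof.
  intros HU Hk Ha Hb s Hs. destruct (Hk _ (HU a b s Ha Hb Hs)) as [d Hd].
  exact (cderiv_cont _ _ _ Hd).
Qed.

Definition triangle (k : C -> C) (a b c : C) : C :=
  (seg k a b + seg k b c + seg k c a)%C.

(** Each side of the medial triangle [bc ca ab] is also a side of a corner triangle, traversed in
    the opposite direction, and cancels. *)
Lemma triangle_subdivision (U : C -> Prop) (k : C -> C) (a b c : C) :
  convex U -> holo U k -> U a -> U b -> U c ->
  let ab := ((a + b) / 2)%C in let bc := ((b + c) / 2)%C in let ca := ((c + a) / 2)%C in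
  triangle k a b c
  = (triangle k a ab ca + triangle k ab b bc + triangle k ca bc c
     + triangle k bc ca ab)%C.
Proof.
  intros HU Hk Ha Hb Hc ab bc ca.
  assert (N : (2 : C) <> 0) by (apply RtoC_neq_0; lra).
  assert (M : forall x y, U x -> U y -> U ((x + y) / 2)%C).
  { intros x y Hx Hy. replace ((x + y) / 2)%C with (x + RtoC (/ 2) * (y - x))%C
      by (rewrite RtoC_inv by lra; field; exact N). apply HU; auto; lra. }
  assert (Hab := M a b Ha Hb). assert (Hbc := M b c Hb Hc). assert (Hca := M c a Hc Ha).
  assert (S : forall x y, U x -> U y -> continuous_on_segment k x y)
    by (intros; eapply holo_continuous_on_segment; eassumption).
  unfold triangle.
  rewrite (seg_midpoint k a b), (seg_midpoint k b c), (seg_midpoint k c a) by auto.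
  fold ab bc ca in Hab, Hbc, Hca |- *.
  rewrite (seg_opp k ca ab), (seg_opp k ab bc), (seg_opp k bc ca) by auto. ring.
Qed.

(** The hypothesis says that the intervals of centre [s n] and radius [e n] are nested; [x] is the
    supremum of their left ends. *)
Lemma nested_limit (s e : nat -> R) :
  (forall n, Rabs (s (S n) - s n) <= e n - e (S n)) -> (forall n, 0 <= e n) ->
  exists x, forall n, Rabs (x - s n) <= e n.
Proof.
  intros H He.
  assert (Hm : forall n m, s n - e n <= s (n + m)%nat - e (n + m)%nat
                       /\ s (n + m)%nat + e (n + m)%nat <= s n + e n).
  { intros n m. induction m as [|m IH]; [rewrite Nat.add_0_r; lra |].
    rewrite Nat.add_succ_r. specialize (H (n + m)%nat). apply Rabs_le_between in H. lra. }
  assert (Hc : forall n m, s n - e n <= s m + e m).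
  { intros n m. destruct (Hm n m) as [H1 _]. destruct (Hm m n) as [_ H2].
    rewrite (Nat.add_comm m n) in H2. specialize (He (n + m)%nat). lra. }
  destruct (completeness (fun u => exists n, u = s n - e n)) as [x [Hub Hlub]].
  { exists (s 0%nat + e 0%nat). intros u [n ->]. apply Hc. }
  { eexists. now exists 0%nat. }
  exists x. intros n. apply Rabs_le_between. split.
  - assert (s n - e n <= x) by (apply Hub; now exists n). lra.
  - assert (x <= s n + e n); [| lra]. apply Hlub. intros u [m ->]. apply Hc.
Qed.

Section Goursat.

Variables (U : C -> Prop) (k : C -> C) (p u v : C).
Hypotheses (HU : convex U) (Hk : holo U k).
Hypotheses (Hp : U p) (Hpu : U (p + u)%C) (Hpv : U (p + v)%C).

Let pt (s t : R) : C := (p + RtoC s * u + RtoC t * v)%C.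

Lemma goursat_pt_in (s t : R) : 0 <= s -> 0 <= t -> s + t <= 1 -> U (pt s t).
Proof.
  (* Away from the corner, go from [p + u] towards [p + v] in the ratio [t / (s + t)], then from [p]
     towards the point found in the ratio [s + t]. *)
  intros Hs Ht Hst. unfold pt. destruct (Req_dec (s + t) 0) as [E | N].
  - replace s with 0 by lra. replace t with 0 by lra.
    now replace (p + RtoC 0 * u + RtoC 0 * v)%C with p by ring.
  - assert (Ht1 : t / (s + t) <= 1) by (apply Rle_div_l; lra).
    assert (Ht0 : 0 <= t / (s + t))
      by (apply Rmult_le_pos; [lra | apply Rlt_le, Rinv_0_lt_compat; lra]).
    assert (N' : RtoC (s + t) <> RtoC 0) by now apply RtoC_neq_0.
    assert (H := HU p _ (s + t) Hp (HU _ _ _ Hpu Hpv (conj Ht0 Ht1))).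
    rewrite RtoC_div in H by easy. rewrite RtoC_plus in N', H.
    match type of H with _ -> U ?q => replace (p + RtoC s * u + RtoC t * v)%C with q end.
    + apply H. lra.
    + field. exact N'.
Qed.

(** A cell [(s, t, e)] stands for the triangle with corners [pt s t], [pt (s + e) t] and
    [pt s (t + e)]. It is similar to the original one with signed ratio [e], negative for an
    inverted triangle such as the medial one. Being [valid] means that the three corners lie in the
    original triangle. *)
Let cell : Type := (R * R * R)%type.
Let valid (q : cell) : Prop :=
  let '(s, t, e) := q in
  0 <= s /\ 0 <= t /\ 0 <= s + e /\ 0 <= t + e /\ s + t <= 1 /\ s + t + e <= 1.
Let T (q : cell) : C :=
  let '(s, t, e) := q in triangle k (pt s t) (pt (s + e) t) (pt s (t + e)).
Let sub1 (q : cell) : cell := let '(s, t, e) := q in (s, t, e / 2).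
Let sub2 (q : cell) : cell := let '(s, t, e) := q in (s + e / 2, t, e / 2).
Let sub3 (q : cell) : cell := let '(s, t, e) := q in (s, t + e / 2, e / 2).
Let sub4 (q : cell) : cell := let '(s, t, e) := q in (s + e / 2, t + e / 2, - (e / 2)).
Let size (q : cell) : R := Rabs (snd q).

Lemma goursat_T_split (q : cell) : valid q ->
  T q = (T (sub1 q) + T (sub2 q) + T (sub3 q) + T (sub4 q))%C.
Proof.
  destruct q as [[s t] e]. intros (H1 & H2 & H3 & H4 & H5 & H6).
  assert (N : (2 : C) <> 0) by (apply RtoC_neq_0; lra). unfold T, sub1, sub2, sub3, sub4.
  rewrite (triangle_subdivision U) by (try apply goursat_pt_in; auto; lra).
  apply f_equal2; [apply f_equal2; [apply f_equal2 |] |];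
    apply (f_equal3 (triangle k)); unfold pt;
    rewrite ?RtoC_plus, ?RtoC_opp, ?RtoC_plus, ?RtoC_div by lra; field; exact N.
Qed.

(** The bound is quadratic in the size, like an area, so that one of the four half-size cells
    inherits it with the same [c]. *)
Let bad (c : R) (q : cell) : Prop := valid q /\ c * size q ^ 2 <= Cmod (T q).

Let next (c : R) (q : cell) : cell :=
  if excluded_middle_informative (bad c (sub1 q)) then sub1 q else
  if excluded_middle_informative (bad c (sub2 q)) then sub2 q else
  if excluded_middle_informative (bad c (sub3 q)) then sub3 q else sub4 q.

(** If all four parts failed the bound, each integral would be below a quarter of [c * size q ^ 2],
    and so their sum below the whole. *)
Lemma goursat_next_bad (c : R) (q : cell) : bad c q -> bad c (next c q).
Proof.
  intros [Hv Hb]. unfold next.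
  destruct (excluded_middle_informative (bad c (sub1 q))) as [B1 | B1]; [easy |].
  destruct (excluded_middle_informative (bad c (sub2 q))) as [B2 | B2]; [easy |].
  destruct (excluded_middle_informative (bad c (sub3 q))) as [B3 | B3]; [easy |].
  destruct (excluded_middle_informative (bad c (sub4 q))) as [B4 | B4]; [easy |].
  exfalso. rewrite goursat_T_split in Hb by easy.
  destruct q as [[s t] e].
  assert (V : valid (sub1 (s, t, e)) /\ valid (sub2 (s, t, e)) /\
              valid (sub3 (s, t, e)) /\ valid (sub4 (s, t, e))).
  { simpl in Hv |- *. lra. }
  assert (S : forall x y, (x, y, e / 2) = (x, y, e / 2) ->
     size (x, y, e / 2) ^ 2 = size (s, t, e) ^ 2 / 4).
  { intros x y _. unfold size. simpl snd. rewrite !pow2_abs. field. }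
  assert (S4 : size (sub4 (s, t, e)) ^ 2 = size (s, t, e) ^ 2 / 4).
  { unfold size, sub4. simpl snd. rewrite !pow2_abs. field. }
  unfold bad in B1, B2, B3, B4. rewrite S4 in B4.
  unfold sub1 in B1 at 2; rewrite S in B1 by easy.
  unfold sub2 in B2 at 2; rewrite S in B2 by easy.
  unfold sub3 in B3 at 2; rewrite S in B3 by easy.
  destruct V as (V1 & V2 & V3 & V4).
  assert (Hlt : forall q r, valid q -> ~ (valid q /\ c * r <= Cmod (T q)) -> Cmod (T q) < c * r)
    by (intros q r Hq Hn; apply Rnot_le_lt; tauto).
  apply Hlt in B1, B2, B3, B4; auto.
  assert (H1 := Cmod_triangle (T (sub1 (s, t, e)) + T (sub2 (s, t, e))
                               + T (sub3 (s, t, e))) (T (sub4 (s, t, e)))).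
  assert (H2 := Cmod_triangle (T (sub1 (s, t, e)) + T (sub2 (s, t, e)))
                              (T (sub3 (s, t, e)))).
  assert (H3 := Cmod_triangle (T (sub1 (s, t, e))) (T (sub2 (s, t, e)))).
  lra.
Qed.

Lemma goursat_next_near (c : R) (q : cell) :
  size (next c q) = size q / 2 /\
  Rabs (fst (fst (next c q)) - fst (fst q)) <= size q / 2 /\
  Rabs (snd (fst (next c q)) - snd (fst q)) <= size q / 2.
Proof.
  assert (D : next c q = sub1 q \/ next c q = sub2 q \/ next c q = sub3 q \/ next c q = sub4 q).
  { unfold next. repeat destruct excluded_middle_informative; auto. }
  destruct q as [[s t] e].
  assert (E : Rabs (e / 2) = Rabs e / 2)
    by (unfold Rdiv; rewrite Rabs_mult, (Rabs_pos_eq (/ 2)); lra).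
  assert (E0 := Rabs_pos e).
  assert (Z : forall x, Rabs (x - x) <= Rabs e / 2)
    by (intros x; rewrite Rminus_diag, Rabs_R0; lra).
  assert (Z1 : forall x, Rabs (x + e / 2 - x) <= Rabs e / 2)
    by (intros x; replace (x + e / 2 - x) with (e / 2) by ring; lra).
  unfold size.
  destruct D as [-> | [-> | [-> | ->]]]; simpl; rewrite ?Rabs_Ropp; auto.
Qed.

Let iter (c : R) (n : nat) : cell := Nat.iter n (next c) (0, 0, 1).

Lemma goursat_corner : triangle k p (p + u) (p + v) = RtoC 0.
Proof.
  apply NNPP. intros N. apply Cmod_gt_0 in N.
  set (c := Cmod (triangle k p (p + u) (p + v))) in N.
  assert (B : forall n, bad c (iter c n)).
  { induction n as [|n IH]; [| now apply goursat_next_bad].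
    unfold iter, bad, size; simpl. split; [lra |].
    rewrite Rabs_R1. unfold c, pt. rewrite !Rplus_0_l.
    replace (p + RtoC 0 * u + RtoC 0 * v)%C with p by ring.
    replace (p + RtoC 1 * u + RtoC 0 * v)%C with (p + u)%C by ring.
    replace (p + RtoC 0 * u + RtoC 1 * v)%C with (p + v)%C by ring. lra. }
  set (s := fun n => fst (fst (iter c n))). set (t := fun n => snd (fst (iter c n))).
  set (e := fun n => size (iter c n)).
  assert (He : forall n, e n = (/ 2) ^ n).
  { induction n as [|n IH].
    - unfold e, iter, size; simpl. apply Rabs_R1.
    - unfold e. change (iter c (S n)) with (next c (iter c n)).
      rewrite (proj1 (goursat_next_near c (iter c n))). fold (e n). rewrite IH. simpl. lra. }
  assert (He0 : forall n, 0 <= e n) by (intros n; apply Rabs_pos).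
  destruct (nested_limit s e) as [x Hx]; [| exact He0 |].
  { intros n. destruct (goursat_next_near c (iter c n)) as (H1 & H2 & _).
    unfold e, s. change (iter c (S n)) with (next c (iter c n)). lra. }
  destruct (nested_limit t e) as [y Hy]; [| exact He0 |].
  { intros n. destruct (goursat_next_near c (iter c n)) as (H1 & _ & H2).
    unfold e, t. change (iter c (S n)) with (next c (iter c n)). lra. }
  assert (Hsmall : forall d, 0 < d -> exists n, e n < d).
  { intros d Hd. destruct (pow_lt_1_zero (/ 2) ltac:(rewrite Rabs_pos_eq; lra) d Hd) as [n Hn].
    exists n. rewrite He. specialize (Hn n (le_n n)).
    rewrite Rabs_pos_eq in Hn; [exact Hn | apply pow_le; lra]. }
  assert (Hst : forall n, 0 <= s n /\ 0 <= t n /\ s n + t n <= 1).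
  { intros n. destruct (B n) as [V _]. unfold s, t.
    destruct (iter c n) as [[s' t'] e']. simpl in *. lra. }
  assert (Hxy : 0 <= x /\ 0 <= y /\ x + y <= 1).
  { split; [| split]; apply Rnot_lt_le; intros L.
    - destruct (Hsmall (- x)) as [n Hn]; [lra |].
      specialize (Hst n). specialize (Hx n). apply Rabs_le_between in Hx. lra.
    - destruct (Hsmall (- y)) as [n Hn]; [lra |].
      specialize (Hst n). specialize (Hy n). apply Rabs_le_between in Hy. lra.
    - destruct (Hsmall ((x + y - 1) / 2)) as [n Hn]; [lra |].
      specialize (Hst n). specialize (Hx n). specialize (Hy n).
      apply Rabs_le_between in Hx, Hy. lra. }
  assert (Hz : U (pt x y)) by (apply goursat_pt_in; lra).
  destruct (Hk _ Hz) as [k' Hk']. set (z := pt x y) in *.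
  (* With this [L], the length [eta = 2 * Rabs e' * L] bounds both the distance of the cell from the
     limit point [z] and its perimeter. *)
  set (L := Cmod u + Cmod v + 1).
  assert (HL : 1 <= L) by (generalize (Cmod_ge_0 u), (Cmod_ge_0 v); unfold L; lra).
  assert (HL2 : 0 < L * L) by nra.
  (* Chosen so that [eps * eta * eta] is [c * Rabs e' ^ 2 / 2], half of the lower bound that a bad
     cell provides. *)
  assert (Heps : 0 < c / (8 * (L * L))) by (apply Rdiv_lt_0_compat; lra).
  destruct (cderiv_eps _ _ _ Hk' _ Heps) as [d [Hd Hw]].
  set (eps := c / (8 * (L * L))) in *.
  assert (Hd' : 0 < d / (2 * L)) by (apply Rdiv_lt_0_compat; lra).
  destruct (Hsmall _ Hd') as [n Hn].
  destruct (B n) as [V HT]. specialize (Hx n). specialize (Hy n).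
  fold (e n) in HT. assert (Hen : 0 < e n) by (rewrite He; apply pow_lt; lra).
  unfold e in Hx, Hy, Hn, HT, Hen. unfold s in Hx. unfold t in Hy.
  destruct (iter c n) as [[s' t'] e']. unfold size in *. simpl fst in *. simpl snd in *.
  assert (HcL : eps * (2 * Rabs e' * L) * (2 * Rabs e' * L) = c * Rabs e' ^ 2 / 2)
    by (unfold eps; field; lra).
  set (eta := 2 * Rabs e' * L) in *.
  assert (Heta : eta < d).
  { unfold eta. apply Rlt_div_r in Hn; [| lra]. lra. }
  assert (Hnear : forall a b, Rabs (a - s') + Rabs (b - t') <= Rabs e' ->
                   Cmod (pt a b - z) <= eta).
  { intros a b Hab.
    replace (pt a b - z)%C with (RtoC (a - x) * u + RtoC (b - y) * v)%C
      by (unfold z, pt; rewrite !RtoC_minus; ring).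
    eapply Rle_trans; [apply Cmod_triangle |]. rewrite !Cmod_mult, !Cmod_R.
    assert (Rabs (a - x) <= 2 * Rabs e').
    { replace (a - x) with ((a - s') + - (x - s')) by ring.
      eapply Rle_trans; [apply Rabs_triang |]. rewrite Rabs_Ropp.
      generalize (Rabs_pos (b - t')). lra. }
    assert (Rabs (b - y) <= 2 * Rabs e').
    { replace (b - y) with ((b - t') + - (y - t')) by ring.
      eapply Rle_trans; [apply Rabs_triang |]. rewrite Rabs_Ropp.
      generalize (Rabs_pos (a - s')). lra. }
    unfold eta, L. generalize (Cmod_ge_0 u), (Cmod_ge_0 v). nra. }
  simpl in V.
  (* On each side [k] is replaced by its tangent function [k z + k' * (w - z)] at [z], whose
     integrals around the triangle add up to 0. *)
  assert (Hseg : forall a b, U a -> U b -> Cmod (a - z) <= eta -> Cmod (b - z) <= eta ->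
    Cmod (seg k a b - ((k z - k' * z) * (b - a) + k' * (b * b - a * a) / 2))
      <= eps * eta * Cmod (b - a)).
  { intros a b Ha Hb Haz Hbz. apply seg_near_affine;
      [now apply (holo_continuous_on_segment U) |].
    intros r Hr. set (w := (a + RtoC r * (b - a))%C).
    assert (Hwz : Cmod (w - z) <= eta).
    { replace (w - z)%C with (RtoC (1 - r) * (a - z) + RtoC r * (b - z))%C
        by (unfold w; rewrite RtoC_minus; ring).
      eapply Rle_trans; [apply Cmod_triangle |].
      rewrite !Cmod_mult, !Cmod_R, !Rabs_pos_eq by lra. nra. }
    replace (k w - (k z - k' * z + k' * w))%C with (k w - k z - k' * (w - z))%C by ring.
    eapply Rle_trans; [apply Hw; lra |]. apply Rmult_le_compat_l; lra. }
  set (P := pt s' t'). set (Q := pt (s' + e') t'). set (W := pt s' (t' + e')).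
  assert (UP : U P) by (apply goursat_pt_in; lra).
  assert (UQ : U Q) by (apply goursat_pt_in; lra).
  assert (UW : U W) by (apply goursat_pt_in; lra).
  assert (NP : Cmod (P - z) <= eta).
  { apply Hnear. rewrite !Rminus_diag, Rabs_R0. generalize (Rabs_pos e'). lra. }
  assert (NQ : Cmod (Q - z) <= eta).
  { apply Hnear. rewrite !Rminus_diag, Rabs_R0. replace (s' + e' - s') with e' by ring. lra. }
  assert (NW : Cmod (W - z) <= eta).
  { apply Hnear. rewrite !Rminus_diag, Rabs_R0. replace (t' + e' - t') with e' by ring. lra. }
  assert (S1 := Hseg P Q UP UQ NP NQ). assert (S2 := Hseg Q W UQ UW NQ NW).
  assert (S3 := Hseg W P UW UP NW NP).
  assert (E1 : Cmod (Q - P) = Rabs e' * Cmod u).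
  { replace (Q - P)%C with (RtoC e' * u)%C by (unfold Q, P, pt; rewrite RtoC_plus; ring).
    now rewrite Cmod_mult, Cmod_R. }
  assert (E3 : Cmod (P - W) = Rabs e' * Cmod v).
  { replace (P - W)%C with (- (RtoC e' * v))%C by (unfold W, P, pt; rewrite RtoC_plus; ring).
    now rewrite Cmod_opp, Cmod_mult, Cmod_R. }
  assert (E2 : Cmod (W - Q) <= Rabs e' * Cmod u + Rabs e' * Cmod v).
  { rewrite <- E1, <- E3, Rplus_comm, (Cmod_sub_sym P W), (Cmod_sub_sym Q P).
    apply Cmod_sub_triangle. }
  assert (HTT : Cmod (triangle k P Q W)
      <= eps * eta * (Cmod (Q - P) + Cmod (W - Q) + Cmod (P - W))).
  { unfold triangle.
    replace (seg k P Q + seg k Q W + seg k W P)%C with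
      ((seg k P Q - ((k z - k' * z) * (Q - P) + k' * (Q * Q - P * P) / 2))
       + (seg k Q W - ((k z - k' * z) * (W - Q) + k' * (W * W - Q * Q) / 2))
       + (seg k W P - ((k z - k' * z) * (P - W) + k' * (P * P - W * W) / 2)))%C
      by (field; apply RtoC_neq_0; lra).
    eapply Rle_trans; [apply Cmod_triangle |].
    eapply Rle_trans; [apply Rplus_le_compat_r, Cmod_triangle |]. lra. }
  assert (Hpos : 0 <= eps * eta).
  { apply Rmult_le_pos; [lra |]. unfold eta. nra. }
  assert (Hsum : Cmod (Q - P) + Cmod (W - Q) + Cmod (P - W) <= eta).
  { unfold eta, L. nra. }
  assert (eps * eta * (Cmod (Q - P) + Cmod (W - Q) + Cmod (P - W)) <= eps * eta * eta)
    by now apply Rmult_le_compat_l.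
  change (T (s', t', e')) with (triangle k P Q W) in HT.
  assert (Hc2 : 0 < c * Rabs e' ^ 2) by (apply Rmult_lt_0_compat; [easy | now apply pow_lt]).
  lra.
Qed.

End Goursat.

Lemma goursat (U : C -> Prop) (k : C -> C) (a b c : C) :
  convex U -> holo U k -> U a -> U b -> U c -> triangle k a b c = RtoC 0.
Proof.
  intros HU Hk Ha Hb Hc.
  assert (H := goursat_corner U k a (b - a) (c - a) HU Hk Ha).
  replace (a + (b - a))%C with b in H by ring.
  replace (a + (c - a))%C with c in H by ring. now apply H.
Qed.

Definition C_open (U : C -> Prop) : Prop := forall z, U z -> near z U.

(** The primitive is the line integral from a fixed base point; Goursat's theorem turns its
    increment into the integral over the short segment from [z] to [w]. *)
Lemma convex_primitive (U : C -> Prop) (k : C -> C) :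
  convex U -> C_open U -> holo U k ->
  exists h, forall z, U z -> cderiv h z (k z).
Proof.
  intros HU HO Hk. destruct (classic (exists a, U a)) as [[a Ha] | N].
  (* On an empty set any function will do. *)
  2: { exists k. intros z Hz. exfalso. apply N. now exists z. }
  exists (seg k a). intros z Hz. apply cderiv_of_eps. intros eps Heps.
  destruct (Hk z Hz) as [k' Hk']. assert (Hc := cderiv_cont _ _ _ Hk' eps Heps).
  generalize (filter_and _ _ (HO z Hz) Hc). intros [d [Hd H]]. exists d; split; [easy |].
  intros w Hw. assert (Uw : U w) by now apply H.
  assert (HT := goursat U k a z w HU Hk Ha Hz Uw). unfold triangle in HT.
  rewrite (seg_opp k a w) in HT by now apply (holo_continuous_on_segment U).
  assert (E : (seg k a w - seg k a z)%C = seg k z w).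
  { replace (seg k z w) with (seg k a z + seg k z w + - seg k a w
      + (seg k a w - seg k a z))%C by ring. rewrite HT. ring. }
  rewrite E.
  replace (k z * (w - z))%C with (k z * (w - z) + RtoC 0 * (w * w - z * z) / 2)%C
    by (field; apply RtoC_neq_0; lra).
  apply seg_near_affine; [now apply (holo_continuous_on_segment U) |].
  intros s Hs. replace (k z + RtoC 0 * (z + RtoC s * (w - z)))%C with (k z) by ring.
  apply Rlt_le, H.
  replace (z + RtoC s * (w - z) - z)%C with (RtoC s * (w - z))%C by ring.
  rewrite Cmod_mult, Cmod_R, Rabs_pos_eq by lra.
  generalize (Cmod_ge_0 (w - z)). nra.
Qed.

(** * The mean value property, the maximum principle and the Schwarz lemma *)

Definition cexp (z : C) : C := (exp (Re z) * cos (Im z), exp (Re z) * sin (Im z)).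

Lemma cexp_plus (z w : C) : cexp (z + w) = (cexp z * cexp w)%C.
Proof.
  destruct z as [a b], w as [c d].
  unfold cexp, Cmult, Cplus; simpl. rewrite exp_plus, cos_plus, sin_plus.
  apply injective_projections; simpl; ring.
Qed.

Lemma Cmod_cexp (z : C) : Cmod (cexp z) = exp (Re z).
Proof.
  assert (H := exp_pos (Re z)).
  unfold Cmod, cexp; simpl fst; simpl snd.
  replace ((exp (Re z) * cos (Im z)) ^ 2 + (exp (Re z) * sin (Im z)) ^ 2)
    with (exp (Re z) ^ 2 * ((sin (Im z))² + (cos (Im z))²)) by (unfold Rsqr; ring).
  rewrite sin2_cos2, Rmult_1_r. apply sqrt_pow2. lra.
Qed.

Lemma cexp_0 : cexp (RtoC 0) = RtoC 1.
Proof.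
  unfold cexp; simpl. rewrite exp_0, cos_0, sin_0.
  apply injective_projections; simpl; ring.
Qed.

Lemma cexp_2PI (z : C) : cexp (z + (0, 2 * PI)) = cexp z.
Proof.
  destruct z as [a b]. unfold cexp; simpl. rewrite Rplus_0_r.
  rewrite <- (cos_period b 1), <- (sin_period b 1). simpl.
  now replace (b + 2 * 1 * PI) with (b + 2 * PI) by ring.
Qed.

Lemma derivable_pt_lim_eps (f : R -> R) (x l : R) :
  derivable_pt_lim f x l -> forall eps, 0 < eps -> exists delta, 0 < delta /\
    forall h, Rabs h < delta -> Rabs (f (x + h) - f x - l * h) <= eps * Rabs h.
Proof.
  intros H eps Heps. destruct (H eps Heps) as [d Hd]. exists d.
  split; [apply cond_pos |]. intros h Hh. destruct (Req_dec h 0) as [-> | N].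
  - rewrite Rplus_0_r, Rabs_R0. replace (f x - f x - l * 0) with 0 by ring.
    rewrite Rabs_R0. lra.
  - specialize (Hd h N Hh).
    replace (f (x + h) - f x - l * h) with (((f (x + h) - f x) / h - l) * h) by (field; easy).
    rewrite Rabs_mult. apply Rmult_le_compat_r; [apply Rabs_pos | lra].
Qed.

Lemma cderiv_cexp_0 : cderiv cexp (RtoC 0) (RtoC 1).
Proof.
  apply cderiv_of_eps. intros eps Heps.
  (* The four remainders below contribute 1, 2, 1 and 2 times [e * m], hence the 6. *)
  set (e := Rmin (eps / 6) 1). assert (He1 : e <= eps / 6) by apply Rmin_l.
  assert (He2 : e <= 1) by apply Rmin_r.
  assert (He : 0 < e) by (apply Rmin_glb_lt; lra).
  destruct (derivable_pt_lim_eps _ _ _ (derivable_pt_lim_exp 0) e He) as [d1 [Hd1 H1]].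
  destruct (derivable_pt_lim_eps _ _ _ (derivable_pt_lim_cos 0) e He) as [d2 [Hd2 H2]].
  destruct (derivable_pt_lim_eps _ _ _ (derivable_pt_lim_sin 0) e He) as [d3 [Hd3 H3]].
  rewrite exp_0 in H1. rewrite cos_0, sin_0 in H2. rewrite cos_0, sin_0 in H3.
  exists (Rmin (Rmin d1 d2) (Rmin d3 (e / 2))).
  split; [repeat apply Rmin_glb_lt; lra |]. intros [x y] Hw.
  assert (Hd : Cmod (x, y) < d1 /\ Cmod (x, y) < d2 /\ Cmod (x, y) < d3 /\ Cmod (x, y) < e / 2).
  { rewrite Csub_0_r in Hw.
    assert (A := Rmin_l (Rmin d1 d2) (Rmin d3 (e / 2))).
    assert (B := Rmin_r (Rmin d1 d2) (Rmin d3 (e / 2))).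
    assert (A1 := Rmin_l d1 d2). assert (A2 := Rmin_r d1 d2).
    assert (A3 := Rmin_l d3 (e / 2)). assert (A4 := Rmin_r d3 (e / 2)). lra. }
  destruct Hd as (D1 & D2 & D3 & D4).
  assert (Hx : Rabs x <= Cmod (x, y)) by apply (re_le_Cmod (x, y)).
  assert (Hy : Rabs y <= Cmod (x, y)) by apply (Im_le_Cmod (x, y)).
  specialize (H1 x ltac:(lra)). specialize (H2 y ltac:(lra)). specialize (H3 y ltac:(lra)).
  rewrite Rplus_0_l in H1, H2, H3.
  replace (cexp (x, y) - cexp (RtoC 0) - RtoC 1 * ((x, y) - RtoC 0))%C
    with ((exp x * cos y - 1 - x, exp x * sin y - y) : C).
  2: { rewrite cexp_0. unfold cexp; simpl.
       apply injective_projections; simpl; ring. }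
  rewrite Csub_0_r.
  eapply Rle_trans; [apply Cmod_le_abs_sum |]. simpl.
  set (r1 := exp x - 1 - 1 * x) in *. set (r2 := cos y - 1 - - (0) * y) in *.
  set (r3 := sin y - 0 - 1 * y) in *. set (m := Cmod (x, y)) in *.
  replace (exp x * cos y - 1 - x) with (r1 + exp x * r2) by (unfold r1, r2; ring).
  replace (exp x * sin y - y) with ((exp x - 1) * y + exp x * r3) by (unfold r3; ring).
  assert (Hm : 0 <= m) by apply Cmod_ge_0.
  assert (Hex1 : Rabs (exp x - 1) <= e).
  { replace (exp x - 1) with (r1 + x) by (unfold r1; ring).
    eapply Rle_trans; [apply Rabs_triang |].
    assert (e * Rabs x <= 1 * Rabs x) by (apply Rmult_le_compat_r; [apply Rabs_pos | lra]).
    lra. }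
  assert (Hex : Rabs (exp x) <= 2).
  { apply Rabs_le_between in Hex1. apply Rabs_le_between. generalize (exp_pos x). lra. }
  assert (B1 : Rabs r1 <= e * m) by (eapply Rle_trans; [apply H1 | apply Rmult_le_compat_l; lra]).
  assert (B2 : Rabs r2 <= e * m) by (eapply Rle_trans; [apply H2 | apply Rmult_le_compat_l; lra]).
  assert (B3 : Rabs r3 <= e * m) by (eapply Rle_trans; [apply H3 | apply Rmult_le_compat_l; lra]).
  assert (C1 := Rabs_triang r1 (exp x * r2)).
  assert (C2 := Rabs_triang ((exp x - 1) * y) (exp x * r3)). rewrite !Rabs_mult in *.
  assert (E1 : Rabs (exp x) * Rabs r2 <= 2 * (e * m))
    by (apply Rmult_le_compat; auto using Rabs_pos).
  assert (E2 : Rabs (exp x) * Rabs r3 <= 2 * (e * m))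
    by (apply Rmult_le_compat; auto using Rabs_pos).
  assert (E3 : Rabs (exp x - 1) * Rabs y <= e * m)
    by (apply Rmult_le_compat; auto using Rabs_pos).
  assert (e * m <= eps / 6 * m) by (apply Rmult_le_compat_r; lra). lra.
Qed.

Lemma cderiv_cexp (z : C) : cderiv cexp z (cexp z).
Proof.
  apply (cderiv_ext (fun w => cexp z * cexp (w - z))%C).
  { apply filter_forall. intros w. rewrite <- cexp_plus. f_equal. ring. }
  assert (H : cderiv (fun w => cexp z * cexp (w - z))%C z
                (cexp z * (RtoC 1 * (RtoC 1 - RtoC 0)))%C).
  { apply cderiv_scal. apply (cderiv_comp cexp (fun w => w - z)%C).
    - apply cderiv_minus; [apply cderiv_id | apply cderiv_const].
    - replace (z - z)%C with (RtoC 0) by ring. apply cderiv_cexp_0. }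
  now replace (cexp z * (RtoC 1 * (RtoC 1 - RtoC 0)))%C with (cexp z) in H by ring.
Qed.

(** A vertical step is [i t], and [Im (i d) = Re d]. This brings the real mean value theorem to bear
    on [Re Q] along a circle. *)
Lemma derivable_pt_lim_vertical (h : C -> C) (s y : R) (d : C) :
  cderiv h (s, y) d -> derivable_pt_lim (fun t => Im (h (s, t))) y (Re d).
Proof.
  intros H eps Heps. assert (He : 0 < eps / 2) by lra.
  destruct (cderiv_eps _ _ _ H _ He) as [dl [Hd Hw]].
  exists (mkposreal dl Hd). intros t Ht Htd. simpl in Htd.
  assert (E : ((s, (y + t)%R) - (s, y))%C = (Ci * RtoC t)%C)
    by (apply injective_projections; simpl; ring).
  specialize (Hw (s, y + t)). rewrite E, Cmod_mult, Cmod_Ci, Cmod_R, Rmult_1_l in Hw.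
  specialize (Hw Htd).
  assert (Hi := Im_le_Cmod (h (s, (y + t)%R) - h (s, y) - d * (Ci * RtoC t))).
  replace (Im (h (s, (y + t)%R) - h (s, y) - d * (Ci * RtoC t)))
    with (((Im (h (s, y + t)) - Im (h (s, y))) / t - Re d) * t) in Hi.
  2: { unfold Im, Re, Cminus, Copp, Cplus, Cmult, Ci, RtoC; simpl. field. easy. }
  rewrite Rabs_mult in Hi. apply Rabs_pos_lt in Ht.
  assert (Rabs ((Im (h (s, y + t)) - Im (h (s, y))) / t - Re d) <= eps / 2); [| lra].
  apply (Rmult_le_reg_r (Rabs t)); [easy | lra].
Qed.

Lemma Delta_open : C_open Delta.
Proof.
  intros z Hz. unfold Delta in *. exists (1 - Cmod z). split; [lra |].
  intros w Hw. assert (H := Cmod_reverse_triangle w z). lra.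
Qed.

Lemma Delta_0 : Delta (RtoC 0).
Proof. unfold Delta. rewrite Cmod_0. lra. Qed.

(** [z -> exp z] turns the circles about [0] into vertical segments of length
    [2 pi], on which the increment of a primitive of [Q o exp] does not depend
    on the radius. *)
Lemma circle_mean_value (Q : C -> C) (r : R) :
  holo Delta Q -> 0 < r < 1 -> exists z, Cmod z = r /\ Re (Q z) = Re (Q (RtoC 0)).
Proof.
  intros HQ Hr.
  set (W := fun z : C => Re z < 0).
  assert (HWc : convex W).
  { intros [a1 a2] [b1 b2] t Ha Hb Ht. unfold W in *; simpl in *. nra. }
  assert (HWo : C_open W).
  { intros z Hz. unfold W in *. exists (- Re z); split; [lra |]. intros w Hw.
    assert (H := Re_le_Cmod (w - z)). unfold Re, Cminus, Cplus, Copp in *; simpl in *. lra. }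
  assert (Hexp : forall z, W z -> Delta (cexp z)).
  { intros z Hz. unfold Delta. rewrite Cmod_cexp, <- exp_0. now apply exp_increasing. }
  assert (Hk : holo W (fun z => Q (cexp z))).
  { apply (holo_comp W Delta Q cexp); auto. intros z _. eexists. apply cderiv_cexp. }
  destruct (convex_primitive W _ HWc HWo Hk) as [h Hh].
  assert (Hper : forall s s', s < 0 -> s' < 0 ->
    (h (RtoC s + (0, (2 * PI)%R)) - h (RtoC s)
     = h (RtoC s' + (0, (2 * PI)%R)) - h (RtoC s'))%C).
  { intros s s' Hs Hs'.
    apply (convex_cderiv_0_constant W (fun z => h (z + (0, (2 * PI)%R)) - h z)%C HWc);
      [| easy | easy].
    intros z Hz.
    replace (RtoC 0) with (Q (cexp z) * (RtoC 1 + RtoC 0) - Q (cexp z))%C by ring.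
    apply cderiv_minus; [| now apply Hh].
    apply (cderiv_comp h (fun z => z + (0, (2 * PI)%R))%C).
    - apply cderiv_plus; [apply cderiv_id | apply cderiv_const].
    - rewrite <- (cexp_2PI z). apply Hh. unfold W, Re in *; simpl. lra. }
  assert (HPI := PI_RGT_0).
  (* The real mean value theorem replaces the average over the circle: one point where [Re Q] takes
     the average value is enough for the maximum principle. *)
  assert (Hmv : forall s, s < 0 -> exists z, Cmod z = exp s /\
     Im (h (RtoC s + (0, (2 * PI)%R))%C - h (RtoC s))%C = 2 * PI * Re (Q z)).
  { intros s Hs.
    destruct (MVT_gen (fun t => Im (h (s, t))) 0 (2 * PI) (fun t => Re (Q (cexp (s, t)))))
      as [c [_ Hc]].
    - intros x _. apply is_derive_Reals. apply derivable_pt_lim_vertical. now apply Hh.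
    - intros x _. apply derivable_continuous_pt. exists (Re (Q (cexp (s, x)))).
      apply derivable_pt_lim_vertical. now apply Hh.
    - exists (cexp (s, c)). split; [now rewrite Cmod_cexp |].
      replace (RtoC s + (0, (2 * PI)%R))%C with ((s, (2 * PI)%R) : C)
        by (apply injective_projections; simpl; ring).
      change (RtoC s) with ((s, 0) : C). simpl in Hc |- *.
      unfold Im in *; simpl in *. lra. }
  assert (Hlr : ln r < 0) by (rewrite <- ln_1; apply ln_increasing; lra).
  destruct (Hmv (ln r) Hlr) as [z [Hz HzI]]. rewrite exp_ln in Hz by lra.
  exists z; split; [easy |]. apply Rminus_diag_uniq, NNPP. intros N.
  apply Rabs_pos_lt in N.
  destruct (HQ _ Delta_0) as [q Hq].
  destruct (cderiv_cont _ _ _ Hq _ N) as [d [Hd Hw]].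
  (* A circle so small that on it [Re Q] differs from its value at 0 by less than the supposed
     discrepancy. *)
  set (r' := Rmin (d / 2) (/ 2)).
  assert (Hr1 : r' <= d / 2) by apply Rmin_l. assert (Hr2 : r' <= / 2) by apply Rmin_r.
  assert (Hr0 : 0 < r') by (apply Rmin_glb_lt; lra).
  assert (Hlr' : ln r' < 0) by (rewrite <- ln_1; apply ln_increasing; lra).
  destruct (Hmv (ln r') Hlr') as [z' [Hz' HzI']]. rewrite exp_ln in Hz' by lra.
  rewrite (Hper (ln r') (ln r)) in HzI' by easy. rewrite HzI in HzI'.
  assert (E : Re (Q z) = Re (Q z')) by (apply (Rmult_eq_reg_l (2 * PI)); lra).
  specialize (Hw z').
  replace (z' - RtoC 0)%C with z' in Hw by ring.
  assert (Hw' : Cmod (Q z' - Q (RtoC 0)) < Rabs (Re (Q z) - Re (Q (RtoC 0)))) by (apply Hw; lra).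
  assert (H := re_le_Cmod (Q z' - Q (RtoC 0))).
  replace (Re (Q z' - Q (RtoC 0))) with (Re (Q z) - Re (Q (RtoC 0))) in H
    by (rewrite E; reflexivity).
  lra.
Qed.

(** * Disc automorphisms *)

Definition moebius (a z : C) : C := ((z - a) / (1 - Cconj a * z))%C.

Lemma moebius_denom_bound (a z : C) :
  Delta z -> 1 - Cmod a <= Cmod (1 - Cconj a * z).
Proof.
  unfold Delta. intros Hz.
  assert (H := Cmod_reverse_triangle (RtoC 1) (Cconj a * z)).
  rewrite Cmod_1, Cmod_mult, Cmod_conj in H.
  generalize (Cmod_ge_0 a), (Cmod_ge_0 z). nra.
Qed.

Lemma moebius_denom_neq_0 (a z : C) :
  Delta a -> Delta z -> (1 - Cconj a * z)%C <> RtoC 0.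
Proof.
  intros Ha Hz. apply Cmod_gt_0. generalize (moebius_denom_bound a z Hz).
  unfold Delta in *. lra.
Qed.

Lemma moebius_identity (a z : C) :
  Cmod (1 - Cconj a * z) ^ 2 - Cmod (z - a) ^ 2 = (1 - Cmod z ^ 2) * (1 - Cmod a ^ 2).
Proof.
  rewrite !Cmod2_alt. destruct a as [a1 a2], z as [z1 z2].
  unfold Re, Im, Cconj, Cminus, Cplus, Copp, Cmult, RtoC; simpl. ring.
Qed.

Lemma Cmod_moebius_lt_1 (a z : C) : Delta a -> Delta z -> Delta (moebius a z).
Proof.
  intros Ha Hz. unfold Delta at 1, moebius.
  assert (N := moebius_denom_neq_0 a z Ha Hz).
  rewrite Cmod_div by easy. apply Cmod_gt_0 in N. apply Rlt_div_l; [easy |].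
  assert (H := moebius_identity a z). unfold Delta in *.
  generalize (Cmod_ge_0 a), (Cmod_ge_0 z), (Cmod_ge_0 (z - a)). intros A Z D.
  assert (0 < (1 - Cmod z ^ 2) * (1 - Cmod a ^ 2)) by (apply Rmult_lt_0_compat; nra).
  nra.
Qed.

Lemma holo_moebius (a : C) : Delta a -> holo Delta (moebius a).
Proof.
  intros Ha. apply (holo_div Delta (fun z => z - a)%C (fun z => 1 - Cconj a * z)%C).
  - intros z Hz. now apply moebius_denom_neq_0.
  - apply (holo_minus Delta (fun z => z) (fun _ => a)); [apply holo_id | apply holo_const].
  - apply (holo_minus Delta (fun _ => RtoC 1) (fun z => Cconj a * z)%C); [apply holo_const |].
    apply (holo_mult Delta (fun _ => Cconj a) (fun z => z)); [apply holo_const | apply holo_id].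
Qed.

Lemma moebius_eq_0 (a z : C) : Delta a -> Delta z -> moebius a z = RtoC 0 -> z = a.
Proof.
  intros Ha Hz E. assert (N := moebius_denom_neq_0 a z Ha Hz).
  apply Cmod_eq_0_sub. unfold moebius in E.
  replace (z - a)%C with ((z - a) / (1 - Cconj a * z) * (1 - Cconj a * z))%C by (field; easy).
  rewrite E, Cmult_0_l. apply Cmod_0.
Qed.

Lemma moebius_boundary (a : C) (rho : R) :
  Delta a -> rho < 1 -> exists r, r < 1 /\
    forall z, Delta z -> r <= Cmod z -> rho <= Cmod (moebius a z).
Proof.
  intros Ha Hrho. set (p := Rmax rho 0).
  assert (Hp0 : 0 <= p) by apply Rmax_r. assert (Hp1 : rho <= p) by apply Rmax_l.
  assert (Hp : p < 1) by (apply Rmax_lub_lt; lra).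
  assert (Ha' := Ha). unfold Delta in Ha'.
  (* If [moebius a z] had modulus below [p], [moebius_identity] would bound [(1 - p ^ 2) * m ^ 2],
     with [m >= 1 - Cmod a] the modulus of the denominator, strictly by
     [(1 - Cmod z ^ 2) * (1 - Cmod a ^ 2)], which is at most [2 * t] for [Cmod z >= 1 - t]. *)
  set (t := (1 - p ^ 2) * (1 - Cmod a) ^ 2 / 2).
  assert (Ht : 0 < t). { unfold t. apply Rdiv_lt_0_compat; [| lra]. apply Rmult_lt_0_compat; [nra |].
    apply pow_lt. lra. }
  exists (1 - t). split; [lra |]. intros z Hz Htz.
  apply Rnot_lt_le. intros L. unfold moebius in L.
  assert (N := moebius_denom_neq_0 a z Ha Hz).
  rewrite Cmod_div in L by easy. apply Cmod_gt_0 in N.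
  assert (L' : Cmod (z - a) < p * Cmod (1 - Cconj a * z)).
  { apply Rlt_div_l in L; [| easy]. eapply Rlt_le_trans; [exact L |].
    apply Rmult_le_compat_r; lra. }
  assert (H := moebius_identity a z). assert (B := moebius_denom_bound a z Hz).
  assert (Hz' := Hz). unfold Delta in Hz'.
  generalize (Cmod_ge_0 a), (Cmod_ge_0 z), (Cmod_ge_0 (z - a)). intros A Z D.
  set (m := Cmod (1 - Cconj a * z)) in *.
  assert (H1 : (1 - p ^ 2) * (1 - Cmod a) ^ 2 <= (1 - p ^ 2) * m ^ 2).
  { apply Rmult_le_compat_l; [nra |]. apply pow_incr. lra. }
  assert (H2 : Cmod (z - a) ^ 2 < (p * m) ^ 2).
  { replace (Cmod (z - a) ^ 2) with (Cmod (z - a) * Cmod (z - a)) by ring.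
    replace ((p * m) ^ 2) with ((p * m) * (p * m)) by ring.
    apply Rmult_le_0_lt_compat; lra. }
  assert (H3 : (1 - Cmod z ^ 2) * (1 - Cmod a ^ 2) <= 2 * t).
  { assert (1 - Cmod z ^ 2 <= 2 * t) by nra. assert (0 <= 1 - Cmod z ^ 2) by nra.
    assert (0 <= 1 - Cmod a ^ 2 <= 1) by nra. nra. }
  unfold t in H3. nra.
Qed.

(** The upper limit of [u] at the unit circle is at most [B], uniformly in the boundary point and
    without reference to boundary values. *)
Definition boundary_le (u : C -> R) (B : R) : Prop :=
  forall eps, 0 < eps -> exists r, r < 1 /\
    forall z, Delta z -> r <= Cmod z -> u z <= B + eps.

(** A disc automorphism moves [a] to the centre; then some point of a circle close to the boundary
    has the same real part as the centre. *)
Lemma max_principle_Re (Q : C -> C) (B : R) :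
  holo Delta Q -> boundary_le (fun z => Re (Q z)) B ->
  forall a, Delta a -> Re (Q a) <= B.
Proof.
  intros HQ HB a Ha. apply Rnot_lt_le. intros L.
  assert (He : 0 < (Re (Q a) - B) / 2) by lra.
  destruct (HB _ He) as [r [Hr Hz]].
  assert (Hna : Delta (- a)%C) by (unfold Delta; now rewrite Cmod_opp).
  destruct (moebius_boundary (- a) r Hna Hr) as [r' [Hr' Hm]].
  set (p := Rmax r' (/ 2)). assert (Hp1 : r' <= p) by apply Rmax_l.
  assert (Hp2 : / 2 <= p) by apply Rmax_r.
  assert (Hp : p < 1) by (apply Rmax_lub_lt; lra).
  destruct (circle_mean_value (fun z => Q (moebius (- a) z)) p) as [z [Hzp HzQ]].
  - apply (holo_comp Delta Delta Q (moebius (- a))); auto.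
    + intros z. now apply Cmod_moebius_lt_1.
    + now apply holo_moebius.
  - lra.
  - assert (Dz : Delta z) by (unfold Delta; lra).
    assert (E : moebius (- a) (RtoC 0) = a).
    { unfold moebius. field. }
    rewrite E in HzQ.
    assert (H := Hz _ (Cmod_moebius_lt_1 _ _ Hna Dz) (Hm z Dz ltac:(lra))). simpl in H. lra.
Qed.

(** Rotating [Q] so that its value at [a] becomes positive reduces the modulus to the real part. *)
Lemma max_principle_Cmod (Q : C -> C) (B : R) :
  holo Delta Q -> boundary_le (fun z => Cmod (Q z)) B ->
  forall a, Delta a -> Cmod (Q a) <= B.
Proof.
  intros HQ HB a Ha. apply Rnot_lt_le. intros L.
  (* A negative [B] would force a negative modulus near the circle. With [0 <= B] the value [Q a] is
     non-zero, so the rotation [lam] exists. *)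
  assert (HB0 : 0 <= B).
  { apply Rnot_lt_le. intros LB. assert (He : 0 < - B / 2) by lra.
    destruct (HB _ He) as [r [Hr Hz]]. set (p := (Rmax r 0 + 1) / 2).
    assert (A1 := Rmax_l r 0). assert (A2 := Rmax_r r 0).
    assert (A3 : Rmax r 0 < 1) by (apply Rmax_lub_lt; lra).
    specialize (Hz (RtoC p)). unfold Delta in Hz.
    rewrite Cmod_R, Rabs_pos_eq in Hz by (unfold p; lra).
    assert (Cmod (Q (RtoC p)) <= B + - B / 2) by (apply Hz; unfold p; lra).
    generalize (Cmod_ge_0 (Q (RtoC p))). lra. }
  set (m := Cmod (Q a)) in *.
  set (lam := (Cconj (Q a) / RtoC m)%C).
  assert (Nm : RtoC m <> RtoC 0) by (apply RtoC_neq_0; lra).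
  assert (Hlam : Cmod lam = 1).
  { unfold lam. rewrite Cmod_div, Cmod_conj, Cmod_R, Rabs_pos_eq by (easy || lra).
    fold m. field. lra. }
  assert (H := max_principle_Re (fun z => lam * Q z)%C B).
  assert (E : (lam * Q a)%C = RtoC m).
  { unfold lam. assert (H2 := Cmod2_conj (Q a)). fold m in H2.
    replace (Cconj (Q a) / RtoC m * Q a)%C with ((Q a * Cconj (Q a)) / RtoC m)%C
      by (field; easy).
    rewrite <- H2. simpl. rewrite Rmult_1_r, RtoC_mult. field. easy. }
  assert (Hc : Re (lam * Q a)%C <= B).
  { apply H; [| | easy].
    - apply (holo_mult Delta (fun _ => lam) Q); [apply holo_const | easy].
    - intros eps Heps. destruct (HB eps Heps) as [r [Hr Hz]]. exists r; split; [easy |].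
      intros z Dz Hrz. specialize (Hz z Dz Hrz).
      eapply Rle_trans; [apply Re_le_Cmod |]. rewrite Cmod_mult, Hlam. lra. }
  rewrite E in Hc. simpl in Hc. lra.
Qed.

Lemma pow_near_1 (n : nat) (eps : R) :
  0 < eps -> exists rho, 0 < rho < 1 /\ forall x, rho <= x -> / x ^ n <= 1 + eps.
Proof.
  (* Bernoulli's inequality gives [(1 - d) ^ n >= 1 - n d], and this [d] makes the right side at
     least [1 / (1 + eps)]. *)
  intros Heps. set (d := (1 - / (1 + eps)) / (INR n + 1)).
  assert (Hn := pos_INR n).
  assert (He1 : 0 < / (1 + eps)) by (apply Rinv_0_lt_compat; lra).
  assert (He2 : / (1 + eps) < 1) by (rewrite <- Rinv_1; apply Rinv_lt_contravar; lra).
  assert (Hd : 0 < d) by (apply Rdiv_lt_0_compat; lra).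
  assert (Hd1 : d < 1) by (apply Rlt_div_l; lra).
  exists (1 - d). split; [lra |]. intros x Hx.
  assert (Hb : forall k, 1 - INR k * d <= (1 - d) ^ k).
  { induction k as [|k IH]; [simpl; lra |]. rewrite S_INR. simpl.
    assert (Hk := pos_INR k).
    assert ((1 - d) * (1 - INR k * d) <= (1 - d) * (1 - d) ^ k)
      by (apply Rmult_le_compat_l; lra).
    assert (0 <= INR k * d * d) by (apply Rmult_le_pos; [apply Rmult_le_pos |]; lra). lra. }
  assert (Hp : (1 - d) ^ n <= x ^ n) by (apply pow_incr; lra).
  specialize (Hb n).
  assert (Hnd : INR n * d <= 1 - / (1 + eps)).
  { assert ((INR n + 1) * d = 1 - / (1 + eps)) by (unfold d; field; lra). lra. }
  rewrite <- (Rinv_inv (1 + eps)). apply Rinv_le_contravar; lra.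
Qed.

(** If [x < y], division by [y ^ n] would give [y <= (x / y) ^ n], which tends to 0. *)
Lemma le_of_pow_le (x y : R) :
  0 <= x -> 0 <= y -> (forall n, y ^ S n <= x ^ n) -> y <= x.
Proof.
  intros Hx Hy H. apply Rnot_lt_le. intros L.
  assert (Hq : Rabs (x / y) < 1).
  { rewrite Rabs_pos_eq; [apply Rlt_div_l; lra |].
    apply Rmult_le_pos; [easy | apply Rlt_le, Rinv_0_lt_compat; lra]. }
  destruct (pow_lt_1_zero (x / y) Hq y ltac:(lra)) as [n Hn].
  specialize (Hn n (le_n n)). specialize (H n).
  assert (Hp : 0 < y ^ n) by (apply pow_lt; lra).
  assert (Hxn : 0 <= (x / y) ^ n).
  { apply pow_le, Rmult_le_pos; [easy | apply Rlt_le, Rinv_0_lt_compat; lra]. }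
  rewrite Rabs_pos_eq in Hn by easy.
  assert (E : x ^ n = (x / y) ^ n * y ^ n) by (rewrite <- Rpow_mult_distr; f_equal; field; lra).
  rewrite E in H. simpl in H. nra.
Qed.

(** The quotient [Q / moebius a] need not be known to be differentiable at [a],
    but [Q ^ (n + 1) / moebius a ^ n] visibly is; then let [n] tend to infinity. *)
Lemma schwarz_lemma (Q : C -> C) (a z : C) :
  holo Delta Q -> (forall w, Delta w -> Cmod (Q w) <= 1) -> Delta a -> Q a = RtoC 0 ->
  Delta z -> Cmod (Q z) <= Cmod (moebius a z).
Proof.
  intros HQ HQ1 Ha HQa Hz. apply le_of_pow_le; try apply Cmod_ge_0. intros n.
  assert (Hdiv : forall u v : C, v <> RtoC 0 -> (u ^ n / v ^ n = (u / v) ^ n)%C).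
  { intros u v Hv. unfold Cdiv. rewrite Cpow_mult_l. f_equal. now rewrite Cpow_inv. }
  set (W := fun w => (Q w ^ S n / moebius a w ^ n)%C).
  assert (HW : holo Delta W).
  { intros w Hw. destruct (classic (w = a)) as [-> | N].
    - destruct (HQ a Ha) as [q [phi [H1 [H2 H3]]]].
      (* With [Q w = phi w * (w - a)], the quotient [W] is [P w * (w - a)] near [a]; continuity of
         [P] at [a] alone makes this differentiable there. *)
      set (P := fun w => ((phi w * (1 - Cconj a * w)) ^ n * phi w)%C).
      exists (P a). apply (cderiv_ext (fun w => P w * (w - a))%C).
      + generalize (Delta_open a Ha). apply filter_imp. intros w' Hw'.
        specialize (H3 w'). rewrite HQa, Csub_0_r in H3. unfold W. rewrite H3.
        destruct (classic (w' = a)) as [-> | N]; [simpl; unfold Cdiv; ring |].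
        assert (Nw : (w' - a)%C <> RtoC 0).
        { intros E. apply N. replace w' with (w' - a + a)%C by ring. rewrite E. ring. }
        assert (N1 := moebius_denom_neq_0 a w' Ha Hw').
        assert (N2 : moebius a w' <> RtoC 0) by (intros E; now apply N, moebius_eq_0).
        change ((phi w' * (w' - a)) ^ S n)%C
          with (phi w' * (w' - a) * (phi w' * (w' - a)) ^ n)%C.
        replace (phi w' * (w' - a) * (phi w' * (w' - a)) ^ n / moebius a w' ^ n)%C
          with (phi w' * (w' - a) * ((phi w' * (w' - a)) ^ n / moebius a w' ^ n))%C
          by (unfold Cdiv; ring).
        rewrite Hdiv by easy.
        replace (phi w' * (w' - a) / moebius a w')%C with (phi w' * (1 - Cconj a * w'))%C
          by (unfold moebius; field; auto).
        unfold P. ring.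
      + exists P. split; [| split; [easy | intros w; ring]].
        unfold P at 2. rewrite H2. unfold P.
        apply clim_mult; [apply _ | | easy]. apply clim_pow; [apply _ |].
        apply clim_mult; [apply _ | easy |].
        apply clim_minus; [apply _ | apply clim_const, _ |].
        apply clim_mult; [apply _ | apply clim_const, _ | apply clim_near_id].
    - assert (Nm : moebius a w <> RtoC 0) by (intros E; now apply N, moebius_eq_0).
      destruct (holo_pow _ _ (S n) HQ w Hw) as [d1 Hd1].
      destruct (holo_pow _ _ n (holo_moebius a Ha) w Hw) as [d2 Hd2].
      eexists. apply cderiv_div; [now apply Cpow_nz | exact Hd1 | exact Hd2]. }
  assert (HW1 : Cmod (W z) <= 1).
  { apply max_principle_Cmod; [easy | | easy]. intros eps Heps.
    destruct (pow_near_1 n eps Heps) as [rho [Hrho Hx]].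
    destruct (moebius_boundary a rho Ha ltac:(lra)) as [r [Hr Hm]].
    exists r; split; [easy |]. intros w Hw Hrw. specialize (Hm w Hw Hrw).
    assert (Nm : moebius a w <> RtoC 0) by (apply Cmod_gt_0; lra).
    unfold W. rewrite Cmod_div, !Cmod_pow by now apply Cpow_nz.
    eapply Rle_trans; [| now apply (Hx _ Hm)].
    rewrite <- (Rmult_1_l (/ _)). apply Rmult_le_compat_r.
    - apply Rlt_le, Rinv_0_lt_compat, pow_lt. lra.
    - rewrite <- (pow1 (S n)). apply pow_incr. split; [apply Cmod_ge_0 | now apply HQ1]. }
  destruct (classic (z = a)) as [-> | N].
  { rewrite HQa, Cmod_0, pow_i by lia. apply pow_le, Cmod_ge_0. }
  assert (Nm : moebius a z <> RtoC 0) by (intros E; now apply N, moebius_eq_0).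
  unfold W in HW1. rewrite Cmod_div, !Cmod_pow in HW1 by now apply Cpow_nz.
  apply Rle_div_l in HW1; [lra |]. apply pow_lt. now apply Cmod_gt_0.
Qed.

(** The squares of the two sides differ by [4 * Re u * Re v]. *)
Lemma Cmod_minus_le_Cconj_plus (u v : C) :
  0 <= Re u -> 0 <= Re v -> Cmod (u - v) <= Cmod (u + Cconj v).
Proof.
  intros Hu Hv. apply Rsqr_incr_0_var; [| apply Cmod_ge_0].
  rewrite !Rsqr_pow2, !Cmod2_alt. destruct u as [a b], v as [c d].
  unfold Re, Im, Cconj, Cminus, Cplus, Copp in *; simpl in *. nra.
Qed.

Lemma schwarz_pick (F : C -> C) (a z : C) :
  holo Delta F -> (forall w, Delta w -> Delta (F w)) -> Delta a -> Delta z ->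
  Cmod (F z - F a) <= Cmod (moebius a z) * Cmod (1 - Cconj (F a) * F z).
Proof.
  intros HF HFD Ha Hz.
  assert (H := schwarz_lemma (fun w => moebius (F a) (F w)) a z).
  assert (H1 : Cmod (moebius (F a) (F z)) <= Cmod (moebius a z)).
  { apply H; auto.
    - apply (holo_comp Delta Delta); auto. apply holo_moebius. auto.
    - intros w Hw. apply Rlt_le, Cmod_moebius_lt_1; auto.
    - unfold moebius, Cdiv. ring. }
  assert (N := moebius_denom_neq_0 (F a) (F z) (HFD a Ha) (HFD z Hz)).
  unfold moebius in H1 at 1. rewrite Cmod_div in H1 by easy.
  apply Rle_div_l in H1; [easy |]. now apply Cmod_gt_0.
Qed.

(** Schwarz's lemma for the Cayley transform of [P] that sends the right half-plane into the disc
    and [P 0] to 0. *)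
Lemma nonneg_Re_schwarz (P : C -> C) (z : C) :
  holo Delta P -> (forall w, Delta w -> 0 <= Re (P w)) -> Delta z ->
  Cmod (P z - P (RtoC 0)) <= Cmod z * Cmod (P z + Cconj (P (RtoC 0))).
Proof.
  (* The slack [eps] keeps the denominator of the Cayley transform away from 0 even when the real
     parts vanish. *)
  intros HP HRe Hz. apply Rle_plus_epsilon. intros eps Heps.
  set (p := P (RtoC 0)). assert (Hp : 0 <= Re p) by apply HRe, Delta_0.
  assert (N : forall w, Delta w -> (P w + Cconj p + RtoC eps)%C <> RtoC 0).
  { intros w Hw E. apply (f_equal Re) in E. specialize (HRe w Hw).
    unfold Re, Cconj, Cplus, RtoC in *; simpl in *. lra. }
  assert (H := schwarz_lemma (fun w => (P w - p) / (P w + Cconj p + RtoC eps))%C (RtoC 0) z).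
  assert (H1 : Cmod ((P z - p) / (P z + Cconj p + RtoC eps)) <= Cmod (moebius (RtoC 0) z)).
  { apply H; auto using Delta_0.
    - apply (holo_div Delta (fun w => P w - p)%C (fun w => P w + Cconj p + RtoC eps)%C); auto.
      + apply (holo_minus Delta P (fun _ => p)); [easy | apply holo_const].
      + apply (holo_plus Delta (fun w => P w + Cconj p)%C (fun _ => RtoC eps));
          [| apply holo_const].
        apply (holo_plus Delta P (fun _ => Cconj p)); [easy | apply holo_const].
    - intros w Hw. rewrite Cmod_div by now apply N.
      apply Rle_div_l; [now apply Cmod_gt_0, N |]. rewrite Rmult_1_l.
      replace (P w - p)%C with ((P w + RtoC (eps / 2)) - (p + RtoC (eps / 2)))%C by ring.
      replace (P w + Cconj p + RtoC eps)%C
        with ((P w + RtoC (eps / 2)) + Cconj (p + RtoC (eps / 2)))%C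
        by (apply injective_projections; simpl; field).
      specialize (HRe w Hw).
      apply Cmod_minus_le_Cconj_plus; unfold Re, Cplus, RtoC in *; simpl in *; lra.
    - unfold p, Cdiv. ring. }
  assert (E : moebius (RtoC 0) z = z).
  { unfold moebius. replace (Cconj (RtoC 0)) with (RtoC 0)
      by (apply injective_projections; simpl; ring). field. }
  rewrite E, Cmod_div in H1 by now apply N.
  apply Rle_div_l in H1; [| now apply Cmod_gt_0, N].
  eapply Rle_trans; [exact H1 |].
  assert (T := Cmod_triangle (P z + Cconj p) (RtoC eps)).
  rewrite Cmod_R, Rabs_pos_eq in T by lra.
  unfold Delta in Hz. generalize (Cmod_ge_0 z). nra.
Qed.

(** Since [F] vanishes near [a], it can be divided by any power of [moebius a]. The maximum
    principle then bounds [F z] by [B * Cmod (moebius a z) ^ n] for every [n]. *)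
Lemma bounded_identity_theorem (F : C -> C) (B : R) (a : C) :
  holo Delta F -> (forall z, Delta z -> Cmod (F z) <= B) -> Delta a ->
  near a (fun z => F z = RtoC 0) -> forall z, Delta z -> F z = RtoC 0.
Proof.
  intros HF HB Ha Hnear z Hz.
  assert (HFa : F a = RtoC 0).
  { destruct Hnear as [d [Hd H]]. apply H. now rewrite Cmod_sub_self. }
  destruct (classic (z = a)) as [-> | N]; [easy |].
  assert (Nm : moebius a z <> RtoC 0) by (intros E; now apply N, moebius_eq_0).
  assert (HB0 : 0 <= B) by (eapply Rle_trans; [apply Cmod_ge_0 | apply (HB a Ha)]).
  assert (Hn : forall n, Cmod (F z) <= B * Cmod (moebius a z) ^ n).
  { intros n. set (W := fun w => (F w / moebius a w ^ n)%C).
    assert (HW : Cmod (W z) <= B).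
    { apply max_principle_Cmod; [| | easy].
      - intros w Hw. destruct (classic (w = a)) as [-> | Nw].
        + exists (RtoC 0). apply (cderiv_ext (fun _ => RtoC 0)); [| apply cderiv_const].
          revert Hnear. apply filter_imp. intros w Ew. unfold W. rewrite Ew. unfold Cdiv. ring.
        + assert (Nmw : moebius a w <> RtoC 0) by (intros E; now apply Nw, moebius_eq_0).
          destruct (HF w Hw) as [d1 Hd1].
          destruct (holo_pow _ _ n (holo_moebius a Ha) w Hw) as [d2 Hd2].
          eexists. apply cderiv_div; [now apply Cpow_nz | exact Hd1 | exact Hd2].
      - intros eps Heps.
        assert (He : 0 < eps / (B + 1)) by (apply Rdiv_lt_0_compat; lra).
        destruct (pow_near_1 n _ He) as [rho [Hrho Hx]].
        destruct (moebius_boundary a rho Ha ltac:(lra)) as [r [Hr Hm]].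
        exists r; split; [easy |]. intros w Hw Hrw. specialize (Hm w Hw Hrw).
        assert (Nmw : moebius a w <> RtoC 0) by (apply Cmod_gt_0; lra).
        unfold W. rewrite Cmod_div, !Cmod_pow by now apply Cpow_nz.
        specialize (Hx _ Hm). specialize (HB w Hw).
        assert (Hi : 0 < / Cmod (moebius a w) ^ n) by (apply Rinv_0_lt_compat, pow_lt; lra).
        apply Rle_trans with (B * (1 + eps / (B + 1))).
        + apply Rmult_le_compat; try easy; try lra. apply Cmod_ge_0.
        + assert (B / (B + 1) <= 1) by (apply Rle_div_l; lra).
          replace (B * (1 + eps / (B + 1))) with (B + B / (B + 1) * eps) by (field; lra).
          nra. }
    unfold W in HW. rewrite Cmod_div, Cmod_pow in HW by now apply Cpow_nz.
    apply Rle_div_l in HW; [easy |]. apply pow_lt. now apply Cmod_gt_0. }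
  apply NNPP. intros NF. apply Cmod_gt_0 in NF.
  assert (Hm := Cmod_moebius_lt_1 a z Ha Hz). unfold Delta in Hm.
  assert (He : 0 < Cmod (F z) / (B + 1)) by (apply Rdiv_lt_0_compat; lra).
  destruct (pow_lt_1_zero (Cmod (moebius a z))
    ltac:(rewrite Rabs_pos_eq; [easy | apply Cmod_ge_0]) _ He) as [n Hpn].
  specialize (Hpn n (le_n n)). specialize (Hn n).
  rewrite Rabs_pos_eq in Hpn by apply pow_le, Cmod_ge_0.
  apply Rlt_div_r in Hpn; [| lra].
  assert (0 <= Cmod (moebius a z) ^ n) by apply pow_le, Cmod_ge_0. nra.
Qed.

(** * Semigroups and their trajectories *)

Section Semigroup.

Context (F : R -> C -> C) (f : C -> C).
Hypotheses (HS : continuous_semigroup F) (HG : generates f F).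

Lemma sg_holo (t : R) : 0 <= t -> holo Delta (F t).
Proof. intros Ht. apply holo_of_holomorphic_on_Delta. now apply HS. Qed.

Lemma sg_Delta (t : R) (z : C) : 0 <= t -> Delta z -> Delta (F t z).
Proof. now apply HS. Qed.

Lemma sg_plus (t s : R) (z : C) :
  0 <= t -> 0 <= s -> Delta z -> F t (F s z) = F (t + s) z.
Proof. now apply HS. Qed.

Lemma sg_right_cont_0 (z : C) : Delta z -> clim right_0 (fun t => F t z) z.
Proof.
  intros Hz eps Heps. apply right_0_at_right.
  exact (clim_of_filterlim _ _ _ (proj2 (proj2 (proj2 HS)) z Hz) eps Heps).
Qed.

(** The axioms do not state this: [F s (F 0 z) = F s z] for small [s > 0], and the two sides tend to
    [F 0 z] and [z]. *)
Lemma sg_0 (z : C) : Delta z -> F 0 z = z.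
Proof.
  intros Hz. assert (H0 : Delta (F 0 z)) by (apply sg_Delta; auto; lra).
  apply (clim_unique right_0 (fun t => F t z) _ _ _); [| now apply sg_right_cont_0].
  apply (clim_ext _ (fun t => F t (F 0 z))); [| now apply sg_right_cont_0].
  exists 1; split; [lra |]. intros s Hs. rewrite sg_plus by (auto; lra).
  now rewrite Rplus_0_r.
Qed.

Lemma generator_holo : holo Delta f.
Proof. apply holo_of_holomorphic_on_Delta, HG. Qed.

(** Write [F t z] as [F s (F (t - s) z)]: the inner point is close to [z], and the Schwarz-Pick
    inequality controls [F s] uniformly in [s]. *)
Lemma sg_left_cont (t : R) (z : C) :
  0 < t -> Delta z -> clim (left_near t) (fun s => F s z) (F t z).
Proof.
  intros Ht Hz eps Heps. assert (Hz' := Hz). unfold Delta in Hz'.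
  assert (He : 0 < eps * (1 - Cmod z) / 2) by (apply Rdiv_lt_0_compat; [nra | lra]).
  destruct (sg_right_cont_0 z Hz _ He) as [d [Hd H]].
  exists d; split; [easy |]. intros s Hs0 Hs.
  specialize (H (t - s) ltac:(lra)). set (w := F (t - s) z) in H.
  assert (Hw : Delta w) by (apply sg_Delta; auto; lra).
  assert (E : F t z = F s w).
  { unfold w. rewrite sg_plus by (auto; lra). f_equal. ring. }
  rewrite E, Cmod_sub_sym.
  eapply Rle_lt_trans.
  { apply (schwarz_pick (F s) z w); auto; [now apply sg_holo |].
    intros; now apply sg_Delta. }
  assert (B : Cmod (1 - Cconj (F s z) * F s w) <= 2).
  { eapply Rle_trans; [apply Cmod_minus_le |]. rewrite Cmod_1, Cmod_mult, Cmod_conj.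
    assert (D1 := sg_Delta s z Hs0 Hz). assert (D2 := sg_Delta s w Hs0 Hw).
    unfold Delta in D1, D2. generalize (Cmod_ge_0 (F s z)), (Cmod_ge_0 (F s w)). nra. }
  assert (M : Cmod (moebius z w) < eps / 2).
  { unfold moebius. assert (N := moebius_denom_neq_0 z w Hz Hw).
    rewrite Cmod_div by easy. assert (N' := moebius_denom_bound z w Hw).
    apply Rlt_div_l; [lra |]. nra. }
  generalize (Cmod_ge_0 (moebius z w)), (Cmod_ge_0 (1 - Cconj (F s z) * F s w)). nra.
Qed.

Lemma sg_rderiv (t : R) (z : C) :
  0 <= t -> Delta z -> rderiv (fun s => F s z) t (- f (F t z))%C.
Proof.
  intros Ht Hz. assert (Hw := sg_Delta t z Ht Hz).
  assert (H : clim right_0 (fun s => (F t z - F s (F t z)) / RtoC s)%C (f (F t z))).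
  { intros eps Heps. apply right_0_at_right.
    exact (clim_of_filterlim _ _ _ (proj2 HG _ Hw) eps Heps). }
  generalize (clim_opp _ _ _ H). apply clim_ext; [apply _ |].
  exists 1; split; [lra |]. intros s Hs. rewrite sg_plus, (Rplus_comm s t) by (auto; lra).
  field. apply RtoC_neq_0. lra.
Qed.

(** Differentiate [F t (F s z) = F s (F t z)] with respect to [s] at [s = 0]. *)
Lemma generator_invariance (t : R) (z d : C) :
  0 <= t -> Delta z -> cderiv (F t) z d -> (d * f z = f (F t z))%C.
Proof.
  intros Ht Hz Hd.
  assert (H0 := sg_rderiv 0 z (Rle_refl 0) Hz). rewrite sg_0 in H0 by easy.
  assert (H1 : rderiv (fun s => F t (F s z)) 0 (d * - f z)%C).
  { apply (rderiv_comp (F t) (fun s => F s z)); [now rewrite sg_0 | easy]. }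
  assert (H2 : rderiv (fun s => F t (F s z)) 0 (- f (F t z))%C).
  { assert (H := sg_rderiv t z Ht Hz). unfold rderiv in H |- *. revert H.
    apply clim_ext; [apply _ |]. exists 1; split; [lra |]. intros s Hs.
    rewrite !sg_plus by (auto; lra). now rewrite !Rplus_0_l, Rplus_0_r. }
  assert (E := rderiv_unique _ _ _ _ H1 H2).
  replace (d * f z)%C with (- (d * - f z))%C by ring. rewrite E. ring.
Qed.

Lemma generator_0_trivial :
  (forall z, Delta z -> f z = RtoC 0) -> trivial_semigroup F.
Proof.
  intros Hf t Ht z Hz. rewrite <- (sg_0 z Hz) at 2.
  apply (rderiv_0_constant (fun s => F s z) t); [| | lra].
  - intros s Hs. apply sg_left_cont; [lra | easy].
  - intros s Hs. assert (H := sg_rderiv s z (proj1 Hs) Hz).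
    rewrite Hf in H by (apply sg_Delta; tauto).
    now replace (- RtoC 0)%C with (RtoC 0) in H by ring.
Qed.

Lemma sg_iter_commute (Gam : C -> C) (n : nat) (z : C) :
  (forall w, Delta w -> Delta (Gam w)) -> commute_on_Delta (F 1) Gam -> Delta z ->
  Gam (F (INR n) z) = F (INR n) (Gam z).
Proof.
  intros HGD Hc Hz. induction n as [|n IH].
  - simpl. now rewrite !sg_0 by auto.
  - assert (Hn := pos_INR n). rewrite S_INR, Rplus_comm.
    rewrite <- !sg_plus by (auto; lra). rewrite <- IH. symmetry. apply Hc.
    now apply sg_Delta.
Qed.

(** The contraction property of [F t] for the pseudo-hyperbolic distance, read
    off near the boundary point [1]. *)
Lemma sg_dist_to_1 (t : R) (a z : C) :
  0 <= t -> Delta a -> Delta z ->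
  (1 - Cmod (moebius a z)) * Cmod (1 - F t z) <= 2 * Cmod (1 - F t a).
Proof.
  intros Ht Ha Hz.
  assert (H := schwarz_pick (F t) a z (sg_holo t Ht)
    (fun w Hw => sg_Delta t w Ht Hw) Ha Hz).
  assert (Da := sg_Delta t a Ht Ha). assert (Dz := sg_Delta t z Ht Hz).
  assert (M := Cmod_moebius_lt_1 a z Ha Hz). unfold Delta in M, Da, Dz.
  assert (H1 := Cmod_sub_triangle (RtoC 1) (F t a) (F t z)).
  rewrite (Cmod_sub_sym (F t a)) in H1.
  assert (H2 : Cmod (1 - Cconj (F t a) * F t z) <= Cmod (1 - F t z) + Cmod (1 - F t a)).
  { replace (1 - Cconj (F t a) * F t z)%C
      with ((1 - F t z) + F t z * Cconj (1 - F t a))%C.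
    - eapply Rle_trans; [apply Cmod_triangle |]. rewrite Cmod_mult, Cmod_conj.
      generalize (Cmod_ge_0 (1 - F t a)), (Cmod_ge_0 (F t z)). nra.
    - unfold Cminus. rewrite Cplus_conj, Copp_conj.
      replace (Cconj (RtoC 1)) with (RtoC 1)
        by (apply injective_projections; simpl; ring). ring. }
  generalize (Cmod_ge_0 (moebius a z)), (Cmod_ge_0 (1 - F t a)), (Cmod_ge_0 (1 - F t z)).
  nra.
Qed.

End Semigroup.

(** * The half-plane coordinate [1 / (1 - z)] and its powers *)

Definition hp (z : C) : C := (/ (1 - z))%C.

Definition hpow (m : nat) (z : C) : C := (hp z ^ m)%C.

Lemma Delta_one_minus_neq_0 (z : C) : Delta z -> (1 - z)%C <> RtoC 0.
Proof.
  intros Hz E. assert (E' : z = RtoC 1).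
  { replace z with (1 - (1 - z))%C by ring. rewrite E. ring. }
  unfold Delta in Hz. rewrite E', Cmod_1 in Hz. lra.
Qed.

Lemma hp_neq_0 (z : C) : Delta z -> hp z <> RtoC 0.
Proof.
  intros Hz E. assert (N := Delta_one_minus_neq_0 z Hz).
  assert (H := Cinv_r _ N). unfold hp in E. rewrite E, Cmult_0_r in H.
  apply RtoC_inj in H. lra.
Qed.

Lemma Cmod_hp (z : C) : Delta z -> Cmod (hp z) = / Cmod (z - RtoC 1).
Proof.
  intros Hz. unfold hp. rewrite Cmod_inv by now apply Delta_one_minus_neq_0.
  now rewrite Cmod_sub_sym.
Qed.

Lemma Cmod_hpow (m : nat) (z : C) : Delta z -> Cmod (hpow m z) = (/ Cmod (z - RtoC 1)) ^ m.
Proof. intros Hz. unfold hpow. now rewrite Cmod_pow, Cmod_hp. Qed.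

Lemma hpow_1 (z : C) : hpow 1 z = hp z.
Proof. unfold hpow. simpl. ring. Qed.

Lemma cderiv_hp (z : C) : Delta z -> cderiv hp z (hp z ^ 2)%C.
Proof.
  intros Hz. assert (N := Delta_one_minus_neq_0 z Hz).
  replace (hp z ^ 2)%C with (- (RtoC 0 - RtoC 1) / (1 - z) ^ 2)%C
    by (unfold hp; field; exact N).
  apply (cderiv_inv (fun w => 1 - w)%C); [easy |].
  apply cderiv_minus; [apply cderiv_const | apply cderiv_id].
Qed.

Lemma cderiv_hpow (m : nat) (z : C) :
  Delta z -> cderiv (hpow m) z (RtoC (INR m) * hp z ^ S m)%C.
Proof.
  intros Hz. induction m as [|m IH].
  - replace (RtoC (INR 0) * hp z ^ 1)%C with (RtoC 0) by (simpl; ring).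
    apply (cderiv_const (RtoC 1)).
  - replace (RtoC (INR (S m)) * hp z ^ S (S m))%C
      with (hp z ^ 2 * hpow m z + hp z * (RtoC (INR m) * hp z ^ S m))%C.
    + apply (cderiv_mult hp (hpow m)); [now apply cderiv_hp | exact IH].
    + rewrite S_INR, RtoC_plus. unfold hpow. simpl. ring.
Qed.

Lemma Re_hp (z : C) : Delta z ->
  Re (hp z) = / 2 + (1 - Cmod z ^ 2) / (2 * Cmod (z - RtoC 1) ^ 2).
Proof.
  intros Hz. assert (N := Delta_one_minus_neq_0 z Hz). apply Cmod_gt_0 in N.
  rewrite Cmod_sub_sym in N.
  assert (E : Cmod (z - RtoC 1) ^ 2 <> 0) by (apply pow_nonzero; lra).
  rewrite !Cmod2_alt in *. destruct z as [x y].
  unfold hp, Re, Im, Cinv, Cminus, Cplus, Copp, RtoC in *; simpl in *.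
  field. intros E'. apply E. etransitivity; [| exact E']; ring.
Qed.

Lemma Re_hp_gt (z : C) : Delta z -> / 2 < Re (hp z).
Proof.
  intros Hz. rewrite Re_hp by easy. assert (N := Delta_one_minus_neq_0 z Hz).
  apply Cmod_gt_0 in N. rewrite Cmod_sub_sym in N.
  assert (0 < (1 - Cmod z ^ 2) / (2 * Cmod (z - RtoC 1) ^ 2)); [| lra].
  unfold Delta in Hz. generalize (Cmod_ge_0 z). intros Z.
  apply Rdiv_lt_0_compat; [nra |]. assert (0 < Cmod (z - RtoC 1) ^ 2) by now apply pow_lt.
  lra.
Qed.

Lemma hp_surjective (u : C) : / 2 < Re u -> Delta (1 - / u)%C /\ hp (1 - / u)%C = u.
Proof.
  intros Hu. assert (N : u <> RtoC 0). { intros ->. simpl in Hu. lra. }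
  split.
  - unfold Delta. replace (1 - / u)%C with ((u - 1) / u)%C by (field; exact N).
    rewrite Cmod_div by easy. apply Cmod_gt_0 in N. apply Rlt_div_l; [easy |].
    rewrite Rmult_1_l. apply Rsqr_incrst_0; try apply Cmod_ge_0.
    rewrite !Rsqr_pow2, !Cmod2_alt. destruct u as [x y].
    unfold Re, Im, Cminus, Cplus, Copp, RtoC in *; simpl in *. nra.
  - unfold hp. replace (1 - (1 - / u))%C with (/ u)%C by ring. field. exact N.
Qed.

Global Instance near_in_Delta_1_proper : ProperFilter near_in_Delta_1.
Proof.
  split; [| apply _]. intros P [d [Hd H]].
  set (s := Rmin (d / 2) (/ 2)). assert (S1 : s <= d / 2) by apply Rmin_l.
  assert (S2 : s <= / 2) by apply Rmin_r. assert (S3 : 0 < s) by (apply Rmin_glb_lt; lra).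
  exists (RtoC (1 - s)). apply H.
  - unfold Delta. rewrite Cmod_R, Rabs_pos_eq; lra.
  - rewrite <- RtoC_minus, Cmod_R, Rabs_left; lra.
Qed.

Lemma near_1_Delta : near_in_Delta_1 Delta.
Proof. exists 1; split; [lra | easy]. Qed.

Lemma clim_near_1_id : clim near_in_Delta_1 (fun z => z) (RtoC 1).
Proof. intros eps Heps. exists eps; split; auto. Qed.

(** Neighbourhoods of 1 in the disc are neighbourhoods of infinity in the coordinate [hpow m]. *)
Lemma near_1_hpow (m : nat) (P : C -> Prop) :
  (0 < m)%nat ->
  near_in_Delta_1 P <-> exists K, 0 < K /\ forall z, Delta z -> K < Cmod (hpow m z) -> P z.
Proof.
  intros Hm. split.
  - intros [d [Hd H]]. exists ((/ d) ^ m).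
    assert (Hd' : 0 < / d) by now apply Rinv_0_lt_compat.
    split; [now apply pow_lt |]. intros z Hz HK. apply H; [easy |].
    rewrite Cmod_hpow in HK by easy.
    assert (N := Delta_one_minus_neq_0 z Hz). apply Cmod_gt_0 in N.
    rewrite Cmod_sub_sym in N. apply Rnot_le_lt. intros L.
    assert (/ Cmod (z - RtoC 1) <= / d) by now apply Rinv_le_contravar.
    assert ((/ Cmod (z - RtoC 1)) ^ m <= (/ d) ^ m); [| lra].
    apply pow_incr. split; [| easy]. now apply Rlt_le, Rinv_0_lt_compat.
  (* With [K + 1] in place of [K] the modulus of [hp z] exceeds 1, so its [m]-th power is no smaller
     than itself. *)
  - intros [K [HK H]]. exists (/ (K + 1)). split; [apply Rinv_0_lt_compat; lra |].
    intros z Hz Hd. apply H; [easy |]. rewrite Cmod_hpow by easy.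
    assert (N := Delta_one_minus_neq_0 z Hz). apply Cmod_gt_0 in N.
    rewrite Cmod_sub_sym in N.
    assert (L : K + 1 < / Cmod (z - RtoC 1)).
    { rewrite <- (Rinv_inv (K + 1)). apply Rinv_lt_contravar; [| easy].
      apply Rmult_lt_0_compat; [easy | apply Rinv_0_lt_compat; lra]. }
    set (y := / Cmod (z - RtoC 1)) in *. clearbody y.
    destruct m as [|m]; [lia |]. simpl.
    assert (1 <= y ^ m) by (rewrite <- (pow1 m); apply pow_incr; lra). nra.
Qed.

(** In the coordinate [hpow m] the trajectories of the semigroup generated by [f]
    solve [u' = speed m f]. *)
Definition speed (m : nat) (f : C -> C) (z : C) : C :=
  (RtoC (INR m) * hp z ^ S m * - f z)%C.

(** A map that displaces [hpow m] by a bounded amount respects neighbourhoods of infinity. *)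
Lemma near_1_comp (m : nat) (phi : C -> C) (d : C) (P : C -> Prop) :
  (0 < m)%nat -> (forall z, Delta z -> Delta (phi z)) ->
  clim near_in_Delta_1 (fun z => hpow m (phi z) - hpow m z)%C d ->
  near_in_Delta_1 P -> near_in_Delta_1 (fun z => P (phi z)).
Proof.
  intros Hm Hphi Hd HP. apply (near_1_hpow m) in HP; [| easy].
  destruct HP as [K [HK HP]].
  assert (HK' : near_in_Delta_1 (fun z => K + (Cmod d + 1) < Cmod (hpow m z))).
  { apply (near_1_hpow m); [easy |]. exists (K + (Cmod d + 1)).
    split; [generalize (Cmod_ge_0 d); lra | easy]. }
  generalize (filter_and _ _ near_1_Delta (filter_and _ _ HK' (clim_bounded _ _ _ Hd))).
  apply filter_imp. intros z [Hz [H1 H2]]. apply HP; [now apply Hphi |].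
  assert (H3 := Cmod_reverse_triangle (hpow m z) (hpow m z - hpow m (phi z))).
  rewrite (Cmod_sub_sym (hpow m z) (hpow m (phi z))) in H3.
  replace (hpow m z - (hpow m z - hpow m (phi z)))%C with (hpow m (phi z)) in H3 by ring.
  lra.
Qed.

(** The scalar product of [hpow m z] and [c] as vectors of the plane: the advance in the direction
    [c], scaled by [Cmod c]. *)
Definition progress (m : nat) (c z : C) : R := Re (hpow m z * Cconj c)%C.

Lemma progress_le (m : nat) (c z : C) : progress m c z <= Cmod (hpow m z) * Cmod c.
Proof. unfold progress. rewrite <- (Cmod_conj c), <- Cmod_mult. apply Re_le_Cmod. Qed.

Lemma progress_increment (m : nat) (c z w : C) (s eps : R) :
  Cmod (hpow m w - hpow m z - c * RtoC s) <= eps ->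
  progress m c z + Cmod c ^ 2 * s - eps * Cmod c <= progress m c w.
Proof.
  intros H. unfold progress.
  assert (H1 := Re_ge_opp_Cmod ((hpow m w - hpow m z - c * RtoC s) * Cconj c)).
  rewrite Cmod_mult, Cmod_conj in H1.
  assert (Cmod (hpow m w - hpow m z - c * RtoC s) * Cmod c <= eps * Cmod c)
    by (apply Rmult_le_compat_r; [apply Cmod_ge_0 | easy]).
  assert (E : Re ((hpow m w - hpow m z - c * RtoC s) * Cconj c)
    = Re (hpow m w * Cconj c) - Re (hpow m z * Cconj c) - Cmod c ^ 2 * s).
  { rewrite Cmod2_alt. destruct (hpow m w), (hpow m z), c.
    unfold Re, Im, Cconj, Cminus, Cplus, Copp, Cmult, RtoC; simpl. ring. }
  lra.
Qed.

(** * Trajectories whose speed has a limit at 1 *)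

Section Trajectories.

Context (F : R -> C -> C) (f : C -> C) (m : nat) (c : C).
Hypotheses (HS : continuous_semigroup F) (HG : generates f F).
Hypothesis Hm : (0 < m)%nat.

Lemma trajectory_rderiv (t : R) (z : C) :
  0 <= t -> Delta z -> rderiv (fun s => hpow m (F s z)) t (speed m f (F t z)).
Proof.
  intros Ht Hz. apply (rderiv_comp (hpow m) (fun s => F s z)).
  - apply cderiv_hpow. now apply (sg_Delta F HS).
  - now apply (sg_rderiv F f HS HG).
Qed.

Lemma trajectory_left_cont (t : R) (z : C) :
  0 < t -> Delta z -> clim (left_near t) (fun s => hpow m (F s z)) (hpow m (F t z)).
Proof.
  intros Ht Hz. apply (clim_comp _ (fun s => F s z) (hpow m) (F t z)).
  - now apply sg_left_cont.
  - eapply cderiv_cont, cderiv_hpow, (sg_Delta F HS); [lra | easy].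
Qed.

(** The speed has to be close to [c] only at points which the estimate being proved can reach; the
    gap between [eps / 2] and [eps] lets the estimate propagate. *)
Lemma trajectory_bootstrap (eps T : R) (z : C) :
  0 < eps -> Delta z ->
  (forall s w, 0 <= s < T -> Delta w -> Cmod (hpow m w - hpow m z - c * RtoC s) <= eps * s ->
     Cmod (speed m f w - c) <= eps / 2) ->
  forall s, 0 <= s <= T -> Cmod (hpow m (F s z) - hpow m z - c * RtoC s) <= eps * s.
Proof.
  intros Heps Hz H. set (x := fun s : R => (hpow m (F s z) - c * RtoC s)%C).
  assert (E : forall s, (x s - x 0)%C = (hpow m (F s z) - hpow m z - c * RtoC s)%C).
  { intros s. unfold x. rewrite (sg_0 F HS) by easy. ring. }
  assert (Hb := increment_bound x T (eps / 2) eps ltac:(lra)).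
  intros s Hs. rewrite <- E. apply Hb; [| | easy].
  - intros t Ht. unfold x. apply clim_minus; [apply _ | |].
    + apply trajectory_left_cont; [lra | easy].
    + apply clim_mult; [apply _ | apply clim_const, _ | apply clim_left_RtoC].
  - intros t Ht HP. rewrite E in HP. exists (speed m f (F t z) - c)%C. split.
    + apply rderiv_minus; [| apply rderiv_linear]. apply trajectory_rderiv; tauto.
    + apply (H t); auto. apply (sg_Delta F HS); tauto.
Qed.

Hypothesis Hspeed : clim near_in_Delta_1 (speed m f) c.

Lemma speed_near (eps : R) : 0 < eps -> exists K, 0 < K /\
  forall w, Delta w -> K < Cmod (hpow m w) -> Cmod (speed m f w - c) < eps.
Proof. intros Heps. apply (near_1_hpow m); [easy |]. now apply Hspeed. Qed.

Lemma trajectory_asymptotics (T : R) :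
  0 <= T ->
  clim near_in_Delta_1 (fun z => hpow m (F T z) - hpow m z)%C (c * RtoC T)%C.
Proof.
  intros HT eps Heps.
  set (e := eps / (T + 1)). assert (He : 0 < e) by (apply Rdiv_lt_0_compat; lra).
  destruct (speed_near (e / 2) ltac:(lra)) as [K [HK Hw]].
  apply (near_1_hpow m); [easy |]. assert (Hc := Cmod_ge_0 c).
  (* Up to time [T] the point moves by at most [(Cmod c + e) * T] in the coordinate, so it stays
     where [K < Cmod (hpow m w)]. *)
  exists (K + (Cmod c + e) * T). split; [nra |].
  intros z Hz Hzk. assert (HeT : e * T < eps).
  { replace eps with (e * (T + 1)) by (unfold e; field; lra). lra. }
  eapply Rle_lt_trans; [| exact HeT].
  apply (trajectory_bootstrap e T z); auto; [| lra].
  intros s w Hs Dw Hws. apply Rlt_le, Hw; [easy |].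
  assert (H1 := Cmod_reverse_triangle (hpow m z) (hpow m z - hpow m w)).
  replace (hpow m z - (hpow m z - hpow m w))%C with (hpow m w) in H1 by ring.
  assert (H2 := Cmod_triangle (hpow m w - hpow m z - c * RtoC s) (c * RtoC s)).
  replace (hpow m w - hpow m z - c * RtoC s + c * RtoC s)%C with (hpow m w - hpow m z)%C
    in H2 by ring.
  rewrite Cmod_mult, Cmod_R, Rabs_pos_eq, Cmod_sub_sym in H2 by lra.
  assert ((Cmod c + e) * s <= (Cmod c + e) * T) by (apply Rmult_le_compat_l; lra). lra.
Qed.

Hypothesis Hc : c <> RtoC 0.

(** In contrast to [trajectory_asymptotics], the estimate holds for all times: an error of at most
    half of [Cmod c] per unit of time leaves a positive advance, so the point never returns to where
    the speed is uncontrolled. *)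
Lemma progress_trajectory (eps : R) :
  0 < eps -> eps <= Cmod c / 2 -> exists K, 0 < K /\
  forall z, Delta z -> K < progress m c z -> forall t, 0 <= t ->
    Cmod (hpow m (F t z) - hpow m z - c * RtoC t) <= eps * t /\
    progress m c z + Cmod c ^ 2 / 2 * t <= progress m c (F t z).
Proof.
  intros He Hec. assert (Hc' := Hc). apply Cmod_gt_0 in Hc'.
  destruct (speed_near (eps / 2) ltac:(lra)) as [K [HK Hw]].
  (* By [progress_le], progress above [K * Cmod c] forces [K < Cmod (hpow m z)]. *)
  exists (K * Cmod c). split; [nra |]. intros z Hz HzK t Ht.
  assert (Hp : forall s w, 0 <= s -> Cmod (hpow m w - hpow m z - c * RtoC s) <= eps * s ->
     progress m c z + Cmod c ^ 2 / 2 * s <= progress m c w).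
  { intros s w Hs Hws. assert (H := progress_increment m c z w s _ Hws).
    assert (eps * s * Cmod c <= Cmod c / 2 * s * Cmod c).
    { apply Rmult_le_compat_r; [lra |]. apply Rmult_le_compat_r; lra. }
    nra. }
  assert (H : Cmod (hpow m (F t z) - hpow m z - c * RtoC t) <= eps * t).
  { apply (trajectory_bootstrap eps t z); auto; [| lra].
    intros s w Hs Dw Hws. apply Rlt_le, Hw; [easy |].
    assert (H1 := Hp s w (proj1 Hs) Hws). assert (H2 := progress_le m c w).
    assert (0 <= Cmod c ^ 2 / 2 * s) by (apply Rmult_le_pos; nra).
    apply (Rmult_lt_reg_r (Cmod c)); lra. }
  split; [easy | now apply Hp].
Qed.

(** A point [a] that is far out in the direction [c] escapes at a linear rate; [sg_dist_to_1]
    carries the convergence over from [a] to [z0]. *)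
Lemma orbit_tends_to_1 (z0 : C) :
  (forall K, exists z, Delta z /\ K < progress m c z) ->
  Delta z0 -> forall P, near_in_Delta_1 P -> eventually (fun n => P (F (INR n) z0)).
Proof.
  intros Hex Hz0 P HP. assert (Hc' := Hc). apply Cmod_gt_0 in Hc'.
  destruct (progress_trajectory (Cmod c / 2)) as [K [HK Ht]]; [lra | lra |].
  destruct (Hex K) as [a [Da Ha]].
  assert (Hev : forall Q, near_in_Delta_1 Q -> eventually (fun n => Q (F (INR n) a))).
  { intros Q HQ. apply (near_1_hpow m) in HQ; [| easy]. destruct HQ as [L [HL HQ]].
    assert (Hc2 : 0 < Cmod c ^ 2 / 2) by nra.
    destruct (nfloor_ex (L * Cmod c / (Cmod c ^ 2 / 2))) as [n0 Hn0].
    { apply Rlt_le, Rdiv_lt_0_compat; nra. }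
    exists (S n0). intros n Hn. apply HQ; [apply (sg_Delta F HS); [apply pos_INR | easy] |].
    destruct (Ht a Da Ha (INR n) (pos_INR n)) as [_ H1].
    assert (H2 := progress_le m c (F (INR n) a)).
    apply le_INR in Hn. rewrite S_INR in Hn.
    assert (H3 : L * Cmod c / (Cmod c ^ 2 / 2) < INR n) by lra.
    apply Rlt_div_l in H3; [| easy]. apply (Rmult_lt_reg_r (Cmod c)); lra. }
  destruct HP as [d [Hd HP]].
  assert (M := Cmod_moebius_lt_1 a z0 Da Hz0). unfold Delta in M.
  assert (Hd' : 0 < d * (1 - Cmod (moebius a z0)) / 2) by (apply Rdiv_lt_0_compat; nra).
  generalize (Hev _ (clim_near_1_id _ Hd')). apply filter_imp. intros n Hn.
  apply HP; [apply (sg_Delta F HS); [apply pos_INR | easy] |].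
  assert (H := sg_dist_to_1 F HS (INR n) a z0 (pos_INR n) Da Hz0).
  rewrite (Cmod_sub_sym (RtoC 1) (F (INR n) a)) in H.
  rewrite Cmod_sub_sym. apply (Rmult_lt_reg_l (1 - Cmod (moebius a z0))); lra.
Qed.

End Trajectories.

(** * Commutation through the Fatou coordinate *)

Definition region (m : nat) (c : C) (K : R) (u : C) : Prop :=
  exists z, Delta z /\ hpow m z = u /\ K < Re (u * Cconj c)%C.

(** [sigma] inverts [hpow m] on the part of the disc where [hpow m] has advanced
    far enough in the direction [c]. *)
Definition chart (m : nat) (c : C) (sigma : C -> C) (K : R) : Prop :=
  convex (region m c K) /\ C_open (region m c K) /\ holo (region m c K) sigma /\
  (forall z, Delta z -> K < progress m c z -> sigma (hpow m z) = z).

Lemma Re_mult_segment (a b c : C) (t : R) :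
  Re ((a + RtoC t * (b - a)) * c)%C = (1 - t) * Re (a * c)%C + t * Re (b * c)%C.
Proof.
  destruct a, b, c. unfold Re, Cminus, Cplus, Copp, Cmult, RtoC; simpl. ring.
Qed.

Lemma half_plane_open (c : C) (K : R) : C_open (fun u => K < Re (u * c)%C).
Proof.
  intros u Hu. assert (Hc : 0 < Cmod c + 1) by (generalize (Cmod_ge_0 c); lra).
  exists ((Re (u * c) - K) / (Cmod c + 1)).
  split; [apply Rdiv_lt_0_compat; lra |]. intros w Hw.
  apply Rlt_div_r in Hw; [| easy].
  assert (H := Re_ge_opp_Cmod ((w - u) * c)). rewrite Cmod_mult in H.
  assert (E : Re ((w - u) * c) = Re (w * c) - Re (u * c)).
  { destruct u, w, c. unfold Re, Cminus, Cplus, Copp, Cmult; simpl. ring. }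
  generalize (Cmod_ge_0 (w - u)). lra.
Qed.

Lemma region_mono (m : nat) (c : C) (K K' : R) (u : C) :
  K <= K' -> region m c K' u <-> region m c K u /\ K' < Re (u * Cconj c)%C.
Proof.
  intros HK. split.
  - intros [z [Hz [E H]]]. split; [exists z; repeat split; auto; lra | easy].
  - intros [[z [Hz [E _]]] H]. now exists z.
Qed.

Lemma chart_mono (m : nat) (c : C) (sigma : C -> C) (K K' : R) :
  K <= K' -> chart m c sigma K -> chart m c sigma K'.
Proof.
  intros HK (H1 & H2 & H3 & H4). split; [| split; [| split]].
  - intros a b t Ha Hb Ht. rewrite (region_mono m c K K') in Ha, Hb |- * by easy.
    split; [now apply H1 |]. rewrite Re_mult_segment. now apply convex_combination_gt.
  - intros u Hu. apply (region_mono m c K K') in Hu; [| easy].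
    generalize (filter_and _ _ (H2 u (proj1 Hu)) (half_plane_open (Cconj c) K' u (proj2 Hu))).
    apply filter_imp. intros w Hw. now apply (region_mono m c K K').
  - intros u Hu. apply H3. now apply (region_mono m c K K') in Hu.
  - intros z Hz Hp. apply H4; [easy | lra].
Qed.

Lemma progress_near (m : nat) (c : C) (K : R) (z : C) :
  Delta z -> K < progress m c z -> near z (fun w => Delta w /\ K < progress m c w).
Proof.
  intros Hz Hp. apply filter_and; [now apply Delta_open |].
  destruct (half_plane_open (Cconj c) K (hpow m z) Hp) as [d [Hd H]].
  generalize (cderiv_cont _ _ _ (cderiv_hpow m z Hz) d Hd). apply filter_imp.
  intros w Hw. now apply H.
Qed.

(** Here [Cmod p >= 3 / 4 * Cmod c], so the relative error of the reciprocal is at most 1/3. This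
    puts it in the disc of radius [Cmod (/ c) / 2] that [convex_injective] and [convex_lipschitz]
    ask for. *)
Lemma inv_close (p c : C) :
  c <> RtoC 0 -> Cmod (p - c) <= Cmod c / 4 ->
  p <> RtoC 0 /\ Cmod (/ p - / c) <= Cmod (/ c) / 2.
Proof.
  intros Hc H. assert (Hc' := Hc). apply Cmod_gt_0 in Hc'.
  assert (H1 := Cmod_reverse_triangle c p). rewrite Cmod_sub_sym in H1.
  assert (Np : p <> RtoC 0) by (apply Cmod_gt_0; lra). split; [easy |].
  replace (/ p - / c)%C with (/ c * (- (p - c) / p))%C by (field; auto).
  rewrite Cmod_mult, Cmod_div, Cmod_opp by easy. unfold Rdiv at 2.
  apply Rmult_le_compat_l; [apply Cmod_ge_0 |]. apply Rle_div_l; lra.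
Qed.

Section FatouCoordinate.

Context (F : R -> C -> C) (f : C -> C) (m : nat) (c : C) (sigma : C -> C) (K0 : R).
Hypotheses (HS : continuous_semigroup F) (HG : generates f F).
Hypotheses (Hm : (0 < m)%nat) (Hc : c <> RtoC 0).
Hypothesis Hspeed : clim near_in_Delta_1 (speed m f) c.
Hypothesis Hchart : chart m c sigma K0.
Hypothesis Hfar : forall K, exists z, Delta z /\ K < progress m c z.

Lemma speed_holo : holo Delta (speed m f).
Proof.
  apply (holo_mult Delta (fun z => RtoC (INR m) * hp z ^ S m)%C (fun z => - f z)%C).
  - apply (holo_mult Delta (fun _ => RtoC (INR m)) (fun z => hp z ^ S m)%C);
      [apply holo_const |].
    apply holo_pow. intros z Hz. eexists. now apply cderiv_hp.
  - apply holo_opp. now apply (generator_holo F).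
Qed.

Lemma fatou_coordinate : exists K (h k : C -> C),
  chart m c sigma K /\ 0 < K /\
  (forall u, region m c K u -> cderiv h u (k u) /\ Cmod (k u - / c) <= Cmod (/ c) / 2) /\
  (forall z t, Delta z -> K < progress m c z -> 0 <= t ->
     Cmod (hpow m (F t z) - hpow m z - c * RtoC t) <= Cmod c / 2 * t /\
     progress m c z + Cmod c ^ 2 / 2 * t <= progress m c (F t z) /\
     h (hpow m (F t z)) = (h (hpow m z) + RtoC t)%C).
Proof.
  assert (Hc' := Hc). apply Cmod_gt_0 in Hc'.
  destruct (progress_trajectory F f m c HS HG Hm Hspeed Hc (Cmod c / 2))
    as [K1 [HK1 Ht]]; [lra | lra |].
  destruct (speed_near f m c Hm Hspeed (Cmod c / 4)) as [K2 [HK2 Hs]]; [lra |].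
  (* Beyond [K] three things hold: the chart exists, the flow advances for ever, and the speed is
     within [Cmod c / 4] of [c]. *)
  set (K := Rmax K0 (Rmax K1 (K2 * Cmod c))).
  assert (L0 : K0 <= K) by apply Rmax_l.
  assert (L1 : K1 <= K) by (eapply Rle_trans; [apply Rmax_l | apply Rmax_r]).
  assert (L2 : K2 * Cmod c <= K) by (eapply Rle_trans; [apply Rmax_r | apply Rmax_r]).
  assert (HK := chart_mono _ _ _ _ _ L0 Hchart).
  set (k := fun u => (/ speed m f (sigma u))%C).
  assert (Hsp : forall z, Delta z -> K < progress m c z ->
    Cmod (speed m f z - c) <= Cmod c / 4).
  { intros z Hz Hp. apply Rlt_le, Hs; [easy |].
    assert (H := progress_le m c z). apply (Rmult_lt_reg_r (Cmod c)); lra. }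
  destruct HK as (C1 & C2 & C3 & C4).
  assert (HkE : forall z, Delta z -> K < progress m c z ->
    k (hpow m z) = (/ speed m f z)%C) by (intros z Hz Hp; unfold k; now rewrite C4).
  assert (Hk : forall u, region m c K u -> exists z, Delta z /\ K < progress m c z /\
     hpow m z = u /\ sigma u = z).
  { intros u [z [Hz [E Hp]]]. rewrite <- E in Hp. exists z. repeat split; auto.
    rewrite <- E. now apply C4. }
  destruct (convex_primitive (region m c K) k C1 C2) as [h Hh].
  { apply (holo_inv (region m c K) (fun u => speed m f (sigma u))).
    - intros u Hu. destruct (Hk u Hu) as (z & Hz & Hp & _ & ->).
      now apply (inv_close _ c Hc), Hsp.
    - apply (holo_comp (region m c K) Delta); [| easy | apply speed_holo].
      intros u Hu. now destruct (Hk u Hu) as (z & Hz & Hp & _ & ->). }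
  exists K, h, k. split; [now repeat split | split; [lra | split]].
  - intros u Hu. split; [now apply Hh |].
    destruct (Hk u Hu) as (z & Hz & Hp & <- & _). rewrite HkE by easy.
    now apply inv_close, Hsp.
  - intros z t Hz Hp H0t.
    assert (Hadv : forall s, 0 <= s -> K < progress m c (F s z)).
    { intros s H0s. destruct (Ht z Hz ltac:(lra) s H0s) as [_ H].
      assert (0 <= Cmod c ^ 2 / 2 * s) by (apply Rmult_le_pos; nra). lra. }
    destruct (Ht z Hz ltac:(lra) t H0t) as [Ht1 Ht2]. split; [easy | split; [easy |]].
    assert (Hreg : forall s, 0 <= s -> region m c K (hpow m (F s z))).
    { intros s H0s. exists (F s z). split; [now apply (sg_Delta F HS) |].
      split; [easy | now apply Hadv]. }
    (* The derivative of [h] along the flow is [/ speed * speed = 1], so subtracting the time leaves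
       a constant. The factor [RtoC 1] matches [rderiv_linear]. *)
    set (x := fun s : R => (h (hpow m (F s z)) - RtoC 1 * RtoC s)%C).
    assert (Hx : x t = x 0).
    { apply (rderiv_0_constant x t); [| | lra]; unfold x.
      - intros s Hs'. apply clim_minus; [apply _ | |].
        + apply (clim_comp _ (fun s => hpow m (F s z)) h (hpow m (F s z))).
          * apply trajectory_left_cont; [easy | lra | easy].
          * eapply cderiv_cont, Hh, Hreg. lra.
        + apply clim_mult; [apply _ | apply clim_const, _ | apply clim_left_RtoC].
      - intros s Hs'. assert (Hd := sg_Delta F HS s z (proj1 Hs') Hz).
        assert (Ha := Hadv s (proj1 Hs')).
        assert (Ns : speed m f (F s z) <> RtoC 0) by now apply (inv_close _ c Hc), Hsp.
        replace (RtoC 0) with (/ speed m f (F s z) * speed m f (F s z) - RtoC 1)%C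
          by (field; exact Ns).
        apply rderiv_minus; [| apply rderiv_linear].
        apply (rderiv_comp h (fun s => hpow m (F s z))).
        + rewrite <- HkE by easy. apply Hh, Hreg; lra.
        + apply (trajectory_rderiv F f m HS HG); tauto. }
    unfold x in Hx. rewrite (sg_0 F HS z Hz) in Hx.
    replace (h (hpow m (F t z)))
      with (h (hpow m (F t z)) - RtoC 1 * RtoC t + RtoC t)%C by ring.
    rewrite Hx. ring.
Qed.

(** If [Gam] commutes with [F 1], then [Gam (F t z)] and [F t (Gam z)] have orbits
    under [F 1] that approach each other in the coordinate [hpow m]; since their
    Fatou coordinates differ by a constant, they coincide. *)
Lemma commute_with_time_one (Gam : C -> C) (d : C) :
  holo Delta Gam -> (forall z, Delta z -> Delta (Gam z)) ->
  commute_on_Delta (F 1) Gam ->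
  clim near_in_Delta_1 (fun z => hpow m (Gam z) - hpow m z)%C d ->
  forall t, 0 <= t -> commute_on_Delta (F t) Gam.
Proof.
  intros HGh HGD Hcom Hd t H0t.
  destruct fatou_coordinate as (K & h & k & HK & HK0 & Hh & Hadv).
  assert (Hc' := Hc). apply Cmod_gt_0 in Hc'.
  destruct (proj1 (near_1_hpow m _ Hm) (Hd 1 Rlt_0_1)) as [L [HL HdL]].
  (* Beyond [K1] the map [Gam] displaces the coordinate by less than [Cmod d + 1], which costs at
     most the last term in progress and keeps [Gam z] beyond [K]. *)
  set (K1 := Rmax K (L * Cmod c) + (Cmod d + 1) * Cmod c).
  assert (A1 := Rmax_l K (L * Cmod c)). assert (A2 := Rmax_r K (L * Cmod c)).
  assert (A3 : 0 <= (Cmod d + 1) * Cmod c) by (generalize (Cmod_ge_0 d); nra).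
  assert (HGam : forall z, Delta z -> K1 < progress m c z -> K < progress m c (Gam z)).
  { intros z Hz Hp.
    assert (HLz : L < Cmod (hpow m z)).
    { assert (H := progress_le m c z). apply (Rmult_lt_reg_r (Cmod c)); unfold K1 in Hp; lra. }
    assert (H := HdL z Hz HLz).
    assert (H1 := progress_increment m c z (Gam z) 0 (Cmod d + 1)).
    assert (H2 : Cmod (hpow m (Gam z) - hpow m z - c * RtoC 0) <= Cmod d + 1).
    { replace (hpow m (Gam z) - hpow m z - c * RtoC 0)%C
        with ((hpow m (Gam z) - hpow m z - d) + d)%C by ring.
      eapply Rle_trans; [apply Cmod_triangle |]. lra. }
    specialize (H1 H2). unfold K1 in Hp. lra. }
  assert (Hstep : forall z s, Delta z -> K < progress m c z -> 0 <= s ->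
    progress m c z <= progress m c (F s z)).
  { intros z s Hz Hp Hs. destruct (Hadv z s Hz Hp Hs) as (_ & H & _).
    assert (0 <= Cmod c ^ 2 / 2 * s) by (apply Rmult_le_pos; nra). lra. }
  (* Both orders of composition displace the coordinate by [d + c * RtoC t] in the limit, so their
     difference tends to 0. *)
  set (E := fun z => (hpow m (Gam (F t z)) - hpow m (F t (Gam z)))%C).
  assert (HE : clim near_in_Delta_1 E (RtoC 0)).
  { assert (HF := trajectory_asymptotics F f m c HS HG Hm Hspeed t H0t).
    assert (HFD := fun z Hz => sg_Delta F HS t z H0t Hz).
    assert (H : clim near_in_Delta_1 (fun z =>
      ((hpow m (Gam (F t z)) - hpow m (F t z)) + (hpow m (F t z) - hpow m z))
      - ((hpow m (F t (Gam z)) - hpow m (Gam z)) + (hpow m (Gam z) - hpow m z)))%C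
      ((d + c * RtoC t) - (c * RtoC t + d))%C).
    { apply clim_minus; [apply _ | |]; (apply clim_plus; [apply _ | |]); auto.
      - intros e He.
        exact (near_1_comp m (F t) _
                 (fun w => Cmod (hpow m (Gam w) - hpow m w - d) < e) Hm HFD HF (Hd e He)).
      - intros e He.
        exact (near_1_comp m Gam _
                 (fun w => Cmod (hpow m (F t w) - hpow m w - c * RtoC t) < e)
                 Hm HGD Hd (HF e He)). }
    replace (d + c * RtoC t - (c * RtoC t + d))%C with (RtoC 0) in H by ring.
    revert H. apply clim_ext; [apply _ |]. apply filter_forall. intros z. unfold E. ring. }
  assert (Hloc : forall z, Delta z -> K1 < progress m c z -> Gam (F t z) = F t (Gam z)).
  { intros z Hz Hp.
    assert (HpK : K < progress m c z) by (unfold K1 in Hp; lra).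
    set (A := Gam (F t z)). set (B := F t (Gam z)).
    assert (DA : Delta A) by (apply HGD, (sg_Delta F HS); auto).
    assert (DB : Delta B) by (apply (sg_Delta F HS); auto).
    assert (PA : K < progress m c A).
    { apply HGam; [now apply (sg_Delta F HS) |].
      eapply Rlt_le_trans; [exact Hp | now apply Hstep]. }
    assert (PB : K < progress m c B).
    { assert (H := HGam z Hz Hp).
      eapply Rlt_le_trans; [exact H | apply Hstep; auto]. }
    assert (Hreg : forall w, Delta w -> K < progress m c w -> region m c K (hpow m w)).
    { intros w Hw Pw. now exists w. }
    destruct HK as (C1 & C2 & C3 & C4).
    assert (Hhk : forall u, region m c K u -> cderiv h u (k u)) by (intros; now apply Hh).
    assert (Nic : (/ c)%C <> RtoC 0).
    { intros E0. assert (H := Cinv_r c Hc). rewrite E0, Cmult_0_r in H.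
      apply RtoC_inj in H. lra. }
    assert (Hdist : forall u v, region m c K u -> region m c K v ->
      Cmod (h v - h u) <= 2 * Cmod (/ c) * Cmod (v - u)).
    { apply (convex_lipschitz _ h k); auto. intros u Hu. now apply Hh. }
    assert (Hh0 : h (hpow m A) = h (hpow m B)).
    { symmetry. apply Cmod_eq_0_sub. apply Rle_antisym; [| apply Cmod_ge_0].
      apply Rnot_lt_le. intros Hlt.
      set (e := Cmod (h (hpow m B) - h (hpow m A))) in Hlt.
      assert (Hci : 0 < Cmod (/ c)) by now apply Cmod_gt_0.
      assert (He : 0 < e / (4 * Cmod (/ c))) by (apply Rdiv_lt_0_compat; lra).
      destruct (orbit_tends_to_1 F f m c HS HG Hm Hspeed Hc z Hfar Hz _ (HE _ He))
        as [n Hn]. specialize (Hn n (le_n n)). assert (Pn := pos_INR n).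
      unfold E in Hn. rewrite Csub_0_r in Hn.
      (* Moving [F (INR n)] to the outside, through [F t] and [Gam], turns [E] at the [n]-th orbit
         point of [z] into the distance between the orbits of [A] and [B]. *)
      rewrite (sg_plus F HS t (INR n)) in Hn by auto.
      rewrite Rplus_comm, <- (sg_plus F HS (INR n) t) in Hn by auto.
      rewrite !(sg_iter_commute F HS Gam n) in Hn by (auto; now apply (sg_Delta F HS)).
      rewrite (sg_plus F HS t (INR n)), Rplus_comm, <- (sg_plus F HS (INR n) t) in Hn by auto.
      fold A B in Hn.
      destruct (Hadv A (INR n) DA PA Pn) as (_ & _ & EA).
      destruct (Hadv B (INR n) DB PB Pn) as (_ & _ & EB).
      assert (PnA := Hstep A (INR n) DA PA Pn). assert (PnB := Hstep B (INR n) DB PB Pn).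
      (* Along both orbits [h] grows by [INR n]: the difference of the Fatou coordinates is frozen
         while the points approach each other. *)
      assert (H := Hdist (hpow m (F (INR n) B)) (hpow m (F (INR n) A))).
      rewrite EA, EB in H.
      replace (h (hpow m A) + RtoC (INR n) - (h (hpow m B) + RtoC (INR n)))%C
        with (h (hpow m A) - h (hpow m B))%C in H by ring.
      rewrite Cmod_sub_sym in H. fold e in H.
      assert (He' : e <= 2 * Cmod (/ c) * Cmod (hpow m (F (INR n) A) - hpow m (F (INR n) B))).
      { apply H; apply Hreg; try (now apply (sg_Delta F HS)); lra. }
      apply Rlt_div_r in Hn; lra. }
    rewrite <- (C4 A DA PA), <- (C4 B DB PB). f_equal.
    apply (convex_injective _ h k (/ c)%C C1 Hhk Nic); auto. intros u Hu. now apply Hh. }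
  destruct (Hfar K1) as [a [Da Pa]].
  assert (Hall : forall z, Delta z -> (Gam (F t z) - F t (Gam z))%C = RtoC 0).
  { apply (bounded_identity_theorem (fun z => Gam (F t z) - F t (Gam z))%C 2 a); auto.
    - assert (HFt := sg_holo F HS t H0t).
      assert (HFD := fun z Hz => sg_Delta F HS t z H0t Hz).
      apply (holo_minus Delta (fun z => Gam (F t z)) (fun z => F t (Gam z)));
        now apply (holo_comp Delta Delta).
    - intros z Hz. eapply Rle_trans; [apply Cmod_minus_le |].
      assert (D1 : Delta (Gam (F t z))) by (apply HGD, (sg_Delta F HS); auto).
      assert (D2 : Delta (F t (Gam z))) by (apply (sg_Delta F HS); auto).
      unfold Delta in D1, D2. lra.
    - generalize (progress_near m c K1 a Da Pa). apply filter_imp.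
      intros w [Dw Pw]. rewrite (Hloc w Dw Pw). ring. }
  intros z Hz. symmetry. apply Cmod_eq_0_sub. rewrite Hall by easy. apply Cmod_0.
Qed.

End FatouCoordinate.

(** * The first coefficients of the second generator *)

Lemma clim_Re_ge_0 {T : Type} (F : (T -> Prop) -> Prop) {FF : ProperFilter F}
    (f : T -> C) (l : C) :
  clim F f l -> F (fun x => 0 <= Re (f x)) -> 0 <= Re l.
Proof.
  intros Hl Hf. apply Rnot_lt_le. intros L. assert (He : 0 < - Re l) by lra.
  destruct (filter_ex _ (filter_and _ _ (Hl _ He) Hf)) as [x [H1 H2]].
  assert (H := Re_le_Cmod (f x - l)).
  unfold Re, Cminus, Cplus, Copp in *; simpl in *. lra.
Qed.

(** Approaching [1] along the straight lines [1 - s e], [Re e > 0]. *)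
Lemma nonneg_Re_ratio (phi : C -> C) (mu : C) :
  near_in_Delta_1 (fun z => 0 <= Re (phi z)) ->
  clim near_in_Delta_1 (fun z => phi z / (1 - z))%C mu ->
  Im mu = 0 /\ 0 <= Re mu.
Proof.
  intros Hphi Hmu.
  (* Along the ray [1 - s * e] the hypothesis yields [Re (mu * e) >= 0] for every [e = (p, q)] with
     [p > 0]; nearly vertical [e] then exclude an imaginary part of [mu]. *)
  assert (Hdir : forall p q, 0 < p -> 0 <= Re mu * p - Im mu * q).
  { intros p q Hp. set (e := (p, q) : C).
    assert (He : 0 < Cmod e).
    { apply Cmod_gt_0. intros E. apply (f_equal Re) in E. simpl in E. lra. }
    assert (Hray : forall P, near_in_Delta_1 P -> right_0 (fun s => P (1 - RtoC s * e)%C)).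
    { intros P [d [Hd HP]].
      assert (H2 : 0 < p / Cmod e ^ 2) by (apply Rdiv_lt_0_compat; [easy | now apply pow_lt]).
      (* The first bound keeps the ray close to 1; the second keeps it in the disc, as the squared
         modulus is [1 - 2 s p + s ^ 2 * Cmod e ^ 2]. *)
      exists (Rmin (d / Cmod e) (p / Cmod e ^ 2)).
      split; [apply Rmin_glb_lt; [now apply Rdiv_lt_0_compat | easy] |].
      intros s [Hs0 Hs].
      assert (S1 : s < d / Cmod e) by (eapply Rlt_le_trans; [exact Hs | apply Rmin_l]).
      assert (S2 : s < p / Cmod e ^ 2) by (eapply Rlt_le_trans; [exact Hs | apply Rmin_r]).
      apply Rlt_div_r in S1; [| easy]. apply Rlt_div_r in S2; [| now apply pow_lt].
      apply HP.
      - unfold Delta. apply Rsqr_incrst_0; [| apply Cmod_ge_0 | lra].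
        rewrite Rsqr_pow2, Rsqr_1, Cmod2_alt. rewrite Cmod2_alt in S2.
        unfold e, Re, Im, Cminus, Cplus, Copp, Cmult, RtoC in *; simpl in *. nra.
      - replace (1 - RtoC s * e - RtoC 1)%C with (- (RtoC s * e))%C by ring.
        rewrite Cmod_opp, Cmod_mult, Cmod_R, Rabs_pos_eq by lra. easy. }
    assert (Hl : clim right_0 (fun s => phi (1 - RtoC s * e) / RtoC s)%C (mu * e)%C).
    { assert (H : clim right_0
        (fun s => phi (1 - RtoC s * e) / (1 - (1 - RtoC s * e)) * e)%C (mu * e)%C).
      { apply clim_mult; [apply _ | | apply clim_const, _].
        intros eps Heps. exact (Hray _ (Hmu eps Heps)). }
      revert H. apply clim_ext; [apply _ |]. generalize right_0_pos. apply filter_imp.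
      intros s Hs. assert (Ne : e <> RtoC 0) by now apply Cmod_gt_0.
      replace (1 - (1 - RtoC s * e))%C with (RtoC s * e)%C by ring. field. auto. }
    assert (H := clim_Re_ge_0 _ _ _ Hl).
    replace (Re mu * p - Im mu * q) with (Re (mu * e)) by reflexivity.
    apply H. generalize (filter_and _ _ right_0_pos (filter_and _ _ (Hray _ Hphi)
      (ex_intro _ 1 (conj Rlt_0_1 (fun s (Hs : 0 < s < 1) => proj1 Hs)) :
         right_0 (fun s => 0 < s)))).
    apply filter_imp. intros s [N [H1 Hs]].
    replace (phi (1 - RtoC s * e) / RtoC s)%C with (RtoC (/ s) * phi (1 - RtoC s * e))%C
      by (rewrite RtoC_inv by lra; field; exact N).
    assert (0 < / s) by now apply Rinv_0_lt_compat.
    destruct (phi (1 - RtoC s * e)%C) as [x y].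
    unfold Re, Cmult, RtoC in *; simpl in *. nra. }
  assert (HIm : Im mu = 0).
  { apply NNPP. intros N. assert (N2 : 0 < Im mu ^ 2) by (simpl; nra).
    assert (Hr : 0 < Rabs (Re mu) + 1) by (generalize (Rabs_pos (Re mu)); lra).
    (* With [q = Im mu], this [p] is small enough for [Re mu * p < Im mu * q], against [Hdir]. *)
    assert (Hp : 0 < Im mu ^ 2 / (Rabs (Re mu) + 1)) by now apply Rdiv_lt_0_compat.
    assert (H := Hdir _ (Im mu) Hp).
    assert (H1 := Rle_abs (Re mu)).
    assert (H2 : Re mu * (Im mu ^ 2 / (Rabs (Re mu) + 1))
       <= Rabs (Re mu) * (Im mu ^ 2 / (Rabs (Re mu) + 1)))
      by (apply Rmult_le_compat_r; lra).
    assert (H3 : (Rabs (Re mu) + 1) * (Im mu ^ 2 / (Rabs (Re mu) + 1)) = Im mu ^ 2)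
      by (field; lra). nra. }
  split; [easy |]. assert (H := Hdir 1 0 Rlt_0_1). lra.
Qed.

Lemma near_1_convex (d : R) : convex (fun z => Delta z /\ Cmod (z - RtoC 1) < d).
Proof.
  intros a b t [Ha Ha'] [Hb Hb'] Ht.
  split; [now apply Delta_convex | now apply disc_convex].
Qed.

Lemma near_1_open (d : R) : C_open (fun z => Delta z /\ Cmod (z - RtoC 1) < d).
Proof.
  intros z [Hz Hd]. apply filter_and; [now apply Delta_open |].
  exists (d - Cmod (z - RtoC 1)). split; [lra |]. intros w Hw.
  assert (H := Cmod_sub_triangle w z (RtoC 1)). lra.
Qed.

(** If [g] does not vanish at [1], then a primitive [k] of [1 / g] near [1]
    satisfies [k o G_t - k = const] by the invariance of the generator; the
    constant is [0] when [G_t] fixes [1], and [k] is injective. *)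
Lemma generator_nonzero_at_1 (G : R -> C -> C) (g : C -> C) (b : C) (t : R) :
  continuous_semigroup G -> generates g G -> 0 <= t -> b <> RtoC 0 ->
  clim near_in_Delta_1 g b -> clim near_in_Delta_1 (G t) (RtoC 1) ->
  identity_on_Delta (G t).
Proof.
  intros HS HG Ht Hb Hgb HGt. assert (Hb' := Hb). apply Cmod_gt_0 in Hb'.
  assert (Hb4 : 0 < Cmod b / 4) by lra.
  destruct (Hgb _ Hb4) as [d [Hd Hgd]].
  destruct (HGt _ Hd) as [d1 [Hd1 HGd]].
  set (N := fun z => Delta z /\ Cmod (z - RtoC 1) < d).
  assert (HNc : convex N) by exact (near_1_convex d).
  assert (Hclose : forall z, N z -> g z <> RtoC 0 /\ Cmod (/ g z - / b) <= Cmod (/ b) / 2).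
  { intros z [Hz Hzd]. apply inv_close; [easy |]. now apply Rlt_le, Hgd. }
  destruct (convex_primitive N (fun z => / g z)%C (near_1_convex d) (near_1_open d))
    as [k Hk].
  { apply holo_inv; [intros z Hz; now apply Hclose |].
    intros z [Hz _]. now apply (generator_holo G g HG). }
  set (d2 := Rmin d d1). assert (L1 : d2 <= d) by apply Rmin_l.
  assert (L2 : d2 <= d1) by apply Rmin_r. assert (Hd2 : 0 < d2) by now apply Rmin_glb_lt.
  set (N' := fun z => Delta z /\ Cmod (z - RtoC 1) < d2).
  assert (HN : forall z, N' z -> N z /\ N (G t z)).
  { intros z [Hz Hzd]. split; split; auto; try lra.
    - now apply (sg_Delta G HS).
    - apply HGd; [easy | lra]. }
  assert (Hconst : forall z w, N' z -> N' w ->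
    (k (G t z) - k z = k (G t w) - k w)%C).
  { intros z w Hz Hw.
    apply (convex_cderiv_0_constant N' (fun z => k (G t z) - k z)%C (near_1_convex d2));
      [| easy | easy].
    intros y Hy. destruct (HN y Hy) as [N1 N2]. assert (Dy : Delta y) by apply Hy.
    destruct (sg_holo G HS t Ht y Dy) as [q Hq].
    assert (E := generator_invariance G g HS HG t y q Ht Dy Hq).
    (* [E] is the invariance [q * g y = g (G t y)], by which the two terms cancel. *)
    replace (RtoC 0) with (/ g (G t y) * q - / g y)%C.
    - apply cderiv_minus; [| now apply Hk]. apply (cderiv_comp k (G t)); [easy | now apply Hk].
    - rewrite <- E. assert (Ny := proj1 (Hclose y N1)).
      assert (Nq : q <> RtoC 0).
      { intros Eq. apply (proj1 (Hclose _ N2)). rewrite <- E, Eq. ring. }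
      field. auto. }
  assert (Hlip : forall u w, N u -> N w -> Cmod (k w - k u) <= 2 * Cmod (/ b) * Cmod (w - u)).
  { apply (convex_lipschitz N k (fun z => / g z)%C); auto.
    intros z Hz. exact (proj2 (Hclose z Hz)). }
  assert (Hib : 0 < Cmod (/ b)) by (rewrite Cmod_inv by easy; now apply Rinv_0_lt_compat).
  assert (Hid : forall z, N' z -> G t z = z).
  { intros z Hz. destruct (HN z Hz) as [N1 N2].
    apply (convex_injective N k (fun z => / g z)%C (/ b)%C); auto.
    - now apply Cmod_gt_0.
    - intros w Hw. exact (proj2 (Hclose w Hw)).
    - apply Cmod_eq_0_sub. apply Rle_antisym; [| apply Cmod_ge_0].
      apply Rnot_lt_le. intros L. set (e := Cmod (k (G t z) - k z)) in L.
      assert (HE : clim near_in_Delta_1 (fun w => G t w - w)%C (RtoC 0)).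
      { replace (RtoC 0) with (RtoC 1 - RtoC 1)%C by ring.
        apply clim_minus; [apply _ | easy | apply clim_near_1_id]. }
      assert (He : 0 < e / (2 * Cmod (/ b))) by (apply Rdiv_lt_0_compat; lra).
      assert (HN' : near_in_Delta_1 N') by (exists d2; split; [easy | now split]).
      destruct (filter_ex _ (filter_and _ _ HN' (HE _ He))) as [w [Hw Hwe]].
      rewrite Csub_0_r in Hwe. destruct (HN w Hw) as [W1 W2].
      assert (H := Hlip w (G t w) W1 W2). rewrite <- (Hconst z w Hz Hw) in H. fold e in H.
      apply Rlt_div_r in Hwe; lra. }
  assert (HN' : near_in_Delta_1 N') by (exists d2; split; [easy | now split]).
  destruct (filter_ex _ HN') as [a Ha].
  intros z Hz. apply Cmod_eq_0_sub.
  rewrite (bounded_identity_theorem (fun z => G t z - z)%C 2 a); auto.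
  - apply Cmod_0.
  - apply (holo_minus Delta (G t) (fun z => z)); [now apply (sg_holo G HS) | apply holo_id].
  - intros w Hw. eapply Rle_trans; [apply Cmod_minus_le |].
    assert (D := sg_Delta G HS t w Ht Hw). unfold Delta in D, Hw. lra.
  - apply Ha.
  - generalize (near_1_open d2 a Ha). apply filter_imp. intros w Hw.
    rewrite Hid by exact Hw. ring.
Qed.

(** The curve [x s = exp (- b s) * hp (G s z)] has logarithmic derivative [g w / (w - 1) - b] with
    [w = G s z]. This is small near 1, so [x] hardly moves relative to its initial value [hp z]. *)
Lemma flow_with_linear_part (G : R -> C -> C) (g : C -> C) (b : C) (T : R) :
  continuous_semigroup G -> generates g G -> 0 <= T ->
  clim near_in_Delta_1 (fun z => g z / (z - RtoC 1))%C b ->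
  clim near_in_Delta_1 (fun z => hp (G T z) / hp z)%C (cexp (b * RtoC T)).
Proof.
  intros HS HG HT Hb.
  assert (Hcexp : forall s, (cexp (b * RtoC s) * cexp (- b * RtoC s))%C = RtoC 1).
  { intros s. rewrite <- cexp_plus.
    replace (b * RtoC s + - b * RtoC s)%C with (RtoC 0) by ring. apply cexp_0. }
  assert (H1 : clim near_in_Delta_1 (fun z => cexp (- b * RtoC T) * (hp (G T z) / hp z))%C
                 (RtoC 1)).
  2: { assert (H : clim near_in_Delta_1
         (fun z => cexp (b * RtoC T) * (cexp (- b * RtoC T) * (hp (G T z) / hp z)))%C
         (cexp (b * RtoC T) * RtoC 1)%C)
         by (apply clim_mult; [apply _ | apply clim_const, _ | exact H1]).
       rewrite Cmult_1_r in H. revert H. apply clim_ext; [apply _ |].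
       apply filter_forall. intros z. rewrite Cmult_assoc, Hcexp. ring. }
  intros eps Heps.
  (* The first bound makes the final relative error smaller than [eps]; the second keeps
     [Cmod (x t)] between [M / 2] and [3 / 2 * M] during the bootstrap. *)
  set (eta := Rmin (eps / (T + 1)) (/ (2 * (T + 1)))).
  assert (E1 : eta <= eps / (T + 1)) by apply Rmin_l.
  assert (E2 : eta <= / (2 * (T + 1))) by apply Rmin_r.
  assert (Heta : 0 < eta).
  { apply Rmin_glb_lt; [apply Rdiv_lt_0_compat; lra | apply Rinv_0_lt_compat; lra]. }
  assert (E1' : eta * T < eps).
  { apply Rle_div_r in E1; [| lra]. nra. }
  assert (E2' : eta * T <= / 2).
  { assert (eta * (T + 1) <= / (2 * (T + 1)) * (T + 1)) by (apply Rmult_le_compat_r; lra).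
    replace (/ (2 * (T + 1)) * (T + 1)) with (/ 2) in H by (field; lra). nra. }
  assert (He2 : 0 < eta / 2) by lra.
  destruct (proj1 (near_1_hpow 1 _ Nat.lt_0_1) (Hb _ He2)) as [K [HK Hw]].
  (* [Q] bounds the factor [exp (- b s)] up to time [T]. From [Cmod (x t) >= M / 2] and
     [M > 2 * Q * K] it follows that [hp w] has modulus above [K]. *)
  set (Q := exp (Cmod b * T)). assert (HQ : 0 < Q) by apply exp_pos.
  apply (near_1_hpow 1); [lia |]. exists (2 * Q * K). split; [nra |].
  intros z Hz HzK. rewrite hpow_1 in HzK.
  set (x := fun s : R => (cexp (- b * RtoC s) * hp (G s z))%C).
  assert (X0 : x 0 = hp z).
  { unfold x. rewrite (sg_0 G HS) by easy.
    replace (- b * RtoC 0)%C with (RtoC 0) by ring. rewrite cexp_0. ring. }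
  set (M := Cmod (hp z)) in *. assert (HM : 0 < M) by nra.
  assert (Hx : Cmod (x T - x 0) <= eta * M * T).
  { apply (increment_bound x T (3 / 4 * (eta * M)) (eta * M)); [nra | | | lra].
    - intros t Ht. unfold x. apply clim_mult; [apply _ | |].
      + apply (clim_comp _ (fun s : R => - b * RtoC s)%C cexp (- b * RtoC t)%C).
        * apply clim_mult; [apply _ | apply clim_const, _ | apply clim_left_RtoC].
        * eapply cderiv_cont, cderiv_cexp.
      + apply (clim_comp _ (fun s => G s z) hp (G t z)).
        * apply sg_left_cont; [easy | lra | easy].
        * eapply cderiv_cont, cderiv_hp, (sg_Delta G HS); [lra | easy].
    - intros t Ht HP. set (w := G t z).
      assert (Dw : Delta w) by (apply (sg_Delta G HS); tauto).
      exists (cexp (- b * RtoC t) * - b * hp w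
              + cexp (- b * RtoC t) * (hp w ^ 2 * - g w))%C. split.
      + apply rderiv_mult.
        * apply (rderiv_comp cexp (fun s => - b * RtoC s)%C); [apply cderiv_cexp |].
          apply rderiv_linear.
        * apply (rderiv_comp hp (fun s => G s z)); [now apply cderiv_hp |].
          apply (sg_rderiv G g HS HG); tauto.
      + assert (N1 := Delta_one_minus_neq_0 w Dw).
        assert (N2 : (w - RtoC 1)%C <> RtoC 0).
        { intros E. apply N1. replace (1 - w)%C with (- (w - RtoC 1))%C by ring.
          rewrite E. ring. }
        replace (cexp (- b * RtoC t) * - b * hp w
              + cexp (- b * RtoC t) * (hp w ^ 2 * - g w))%C
          with (x t * (g w / (w - RtoC 1) - b))%C
          by (unfold x, hp; fold w; field; auto).
        assert (B1 : eta * M * t <= M / 2).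
        { assert (eta * M * t <= eta * M * T) by (apply Rmult_le_compat_l; nra). nra. }
        rewrite X0 in HP.
        assert (B2 := Cmod_reverse_triangle (x t) (hp z)).
        assert (B3 := Cmod_reverse_triangle (hp z) (x t)).
        rewrite (Cmod_sub_sym (hp z)) in B3. fold M in B2, B3.
        assert (B4 : Cmod (x t) <= Q * Cmod (hp w)).
        { unfold x. fold w. rewrite Cmod_mult. apply Rmult_le_compat_r; [apply Cmod_ge_0 |].
          rewrite Cmod_cexp. unfold Q.
          assert (Re (- b * RtoC t) <= Cmod b * T).
          { eapply Rle_trans; [apply Re_le_Cmod |].
            rewrite Cmod_mult, Cmod_opp, Cmod_R, Rabs_pos_eq by lra.
            apply Rmult_le_compat_l; [apply Cmod_ge_0 | lra]. }
          destruct H as [H | ->]; [now apply Rlt_le, exp_increasing | lra]. }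
        assert (B5 : Cmod (g w / (w - RtoC 1) - b) < eta / 2).
        { apply Hw; [easy |]. rewrite hpow_1. apply (Rmult_lt_reg_l Q); [easy |]. lra. }
        rewrite Cmod_mult.
        apply Rle_trans with (3 / 2 * M * (eta / 2)); [| lra].
        apply Rmult_le_compat; try apply Cmod_ge_0; lra. }
  assert (Nz := hp_neq_0 z Hz).
  replace (cexp (- b * RtoC T) * (hp (G T z) / hp z) - RtoC 1)%C
    with ((x T - x 0) / hp z)%C by (rewrite X0; unfold x; field; exact Nz).
  rewrite Cmod_div by exact Nz. fold M. apply Rlt_div_l; [easy |]. nra.
Qed.

(** The quotient [(1 - G T z) / (1 - z)] tends to [exp (- b T)], which [nonneg_Re_ratio] shows to be
    real for every [T >= 0]; at [T = PI / 2 / Rabs (Im b)] it would be imaginary up to a real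
    factor. *)
Lemma linear_part_real (G : R -> C -> C) (g : C -> C) (b : C) :
  continuous_semigroup G -> generates g G ->
  clim near_in_Delta_1 (fun z => g z / (z - RtoC 1))%C b -> Im b = 0.
Proof.
  intros HS HG Hb.
  assert (Hsin : forall T, 0 <= T -> sin (Im b * T) = 0).
  { intros T HT. assert (H := flow_with_linear_part G g b T HS HG HT Hb).
    assert (Nc : cexp (b * RtoC T) <> RtoC 0).
    { apply Cmod_gt_0. rewrite Cmod_cexp. apply exp_pos. }
    assert (Hi := clim_inv _ _ _ Nc H).
    assert (H1 : clim near_in_Delta_1 (fun z => (1 - G T z) / (1 - z))%C
                   (/ cexp (b * RtoC T))%C).
    { revert Hi. apply clim_ext; [apply _ |]. generalize near_1_Delta. apply filter_imp.
      intros z Hz. assert (N1 := Delta_one_minus_neq_0 z Hz).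
      assert (N2 := Delta_one_minus_neq_0 (G T z) (sg_Delta G HS T z HT Hz)).
      unfold hp. field. auto. }
    destruct (fun H => nonneg_Re_ratio (fun z => 1 - G T z)%C _ H H1) as [HIm _].
    - generalize near_1_Delta. apply filter_imp. intros z Hz.
      assert (D := sg_Delta G HS T z HT Hz). unfold Delta in D.
      assert (R := Re_le_Cmod (G T z)).
      unfold Re, Cminus, Cplus, Copp, RtoC in *; simpl in *. lra.
    - assert (E : (/ cexp (b * RtoC T))%C = cexp (- (b * RtoC T))).
      { assert (E : (cexp (b * RtoC T) * cexp (- (b * RtoC T)))%C = RtoC 1).
        { rewrite <- cexp_plus. replace (b * RtoC T + - (b * RtoC T))%C with (RtoC 0) by ring.
          apply cexp_0. }
        replace (cexp (- (b * RtoC T)))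
          with (/ cexp (b * RtoC T) * (cexp (b * RtoC T) * cexp (- (b * RtoC T))))%C
          by (field; exact Nc). rewrite E. ring. }
      rewrite E in HIm. unfold cexp in HIm; simpl in HIm.
      replace (- (fst b * 0 + snd b * T)) with (- (Im b * T)) in HIm by (unfold Im; ring).
      rewrite sin_neg in HIm. assert (P := exp_pos (- (fst b * T - snd b * 0))).
      assert (exp (- (fst b * T - snd b * 0)) * sin (Im b * T) = 0) by lra.
      apply Rmult_integral in H0. destruct H0; lra. }
  apply NNPP. intros N. assert (Pi := PI_RGT_0).
  assert (HT : 0 <= PI / 2 / Rabs (Im b)).
  { apply Rlt_le, Rdiv_lt_0_compat; [lra | now apply Rabs_pos_lt]. }
  specialize (Hsin _ HT). unfold Rabs in Hsin. destruct (Rcase_abs (Im b)) as [L | L].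
  - replace (Im b * (PI / 2 / - Im b)) with (- (PI / 2)) in Hsin by (field; lra).
    rewrite sin_neg, sin_PI2 in Hsin. lra.
  - replace (Im b * (PI / 2 / Im b)) with (PI / 2) in Hsin by (field; lra).
    rewrite sin_PI2 in Hsin. lra.
Qed.

Lemma cesaro_increments (u : nat -> C) (c : C) :
  clim eventually (fun n => u (S n) - u n)%C c ->
  clim eventually (fun n => u n / RtoC (INR n))%C c.
Proof.
  intros H eps Heps. assert (He : 0 < eps / 2) by lra.
  destruct (H _ He) as [N HN].
  assert (Hk : forall k, Cmod (u (N + k)%nat - u N - c * RtoC (INR k)) <= eps / 2 * INR k).
  { induction k as [|k IH].
    - rewrite Nat.add_0_r. simpl. replace (u N - u N - c * RtoC 0)%C with (RtoC 0) by ring.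
      rewrite Cmod_0. lra.
    - rewrite Nat.add_succ_r, S_INR, RtoC_plus.
      replace (u (S (N + k)) - u N - c * (RtoC (INR k) + RtoC 1))%C
        with ((u (N + k)%nat - u N - c * RtoC (INR k)) + (u (S (N + k)) - u (N + k)%nat - c))%C
        by ring.
      specialize (HN (N + k)%nat ltac:(lia)).
      eapply Rle_trans; [apply Cmod_triangle |]. lra. }
  (* The error made before the increments settle; division by [n] brings it below [eps / 2] once [n]
     exceeds [A / (eps / 2)]. *)
  set (A := Cmod (u N - c * RtoC (INR N))). assert (HA : 0 <= A) by apply Cmod_ge_0.
  destruct (nfloor_ex (A / (eps / 2))) as [p Hp].
  { apply Rmult_le_pos; [easy | apply Rlt_le, Rinv_0_lt_compat; lra]. }
  exists (S (N + p)). intros n Hn. destruct (Nat.le_exists_sub N n ltac:(lia)) as [k [Ek _]].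
  rewrite Nat.add_comm in Ek. subst n. specialize (Hk k).
  assert (Hpos : 0 < INR (N + k)) by (apply lt_0_INR; lia).
  assert (HpN : INR p + 1 <= INR (N + k)) by (rewrite <- S_INR; apply le_INR; lia).
  assert (Nn : RtoC (INR (N + k)) <> RtoC 0) by (apply RtoC_neq_0; lra).
  replace (u (N + k)%nat / RtoC (INR (N + k)) - c)%C
    with (((u (N + k)%nat - u N - c * RtoC (INR k)) + (u N - c * RtoC (INR N)))
          / RtoC (INR (N + k)))%C
    by (rewrite plus_INR in Nn |- *; rewrite RtoC_plus in Nn |- *; field; exact Nn).
  rewrite Cmod_div, Cmod_R, Rabs_pos_eq by (easy || lra).
  apply Rlt_div_l; [easy |]. eapply Rle_lt_trans; [apply Cmod_triangle |]. fold A.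
  assert (HAe : A < eps / 2 * INR (N + k)).
  { assert (A / (eps / 2) < INR (N + k)) by lra. apply Rlt_div_l in H0; lra. }
  assert (INR k <= INR (N + k)) by (apply le_INR; lia). nra.
Qed.

Lemma orbit_clim (F : R -> C -> C) (z l : C) (phi : C -> C) :
  (forall P, near_in_Delta_1 P -> eventually (fun n => P (F (INR n) z))) ->
  clim near_in_Delta_1 phi l -> clim eventually (fun n => phi (F (INR n) z)) l.
Proof. intros Ho Hl eps Heps. exact (Ho _ (Hl eps Heps)). Qed.

Section SecondSemigroup.

Context (F G : R -> C -> C) (f g : C -> C) (m : nat) (c : C).
Hypotheses (HSF : continuous_semigroup F) (HGF : generates f F).
Hypotheses (HSG : continuous_semigroup G) (HGG : generates g G).
Hypotheses (Hm : (0 < m)%nat) (Hc : c <> RtoC 0).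
Hypothesis Hspeed : clim near_in_Delta_1 (speed m f) c.
Hypothesis Hfar : forall K, exists z, Delta z /\ K < progress m c z.
Hypothesis Hcom : commute_on_Delta (F 1) (G 1).

Let orbit (z : C) (Hz : Delta z) :
  forall P, near_in_Delta_1 P -> eventually (fun n => P (F (INR n) z)) :=
  orbit_tends_to_1 F f m c HSF HGF Hm Hspeed Hc z Hfar Hz.

Lemma G_Delta (z : C) : Delta z -> Delta (G 1 z).
Proof. apply (sg_Delta G HSG). lra. Qed.

(** The points [G 1 (F n 0)] tend to [beta], but they are also the orbit of [G 1 0], which tends to
    1. *)
Lemma boundary_value_at_1 (beta : C) :
  clim near_in_Delta_1 (G 1) beta -> beta = RtoC 1.
Proof.
  intros Hb. apply (clim_unique eventually (fun n => G 1 (F (INR n) (RtoC 0)))); [apply _ | |].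
  - apply (orbit_clim F); [exact (orbit _ Delta_0) | easy].
  - assert (H := orbit_clim F _ _ _ (orbit _ (G_Delta _ Delta_0)) clim_near_1_id).
    revert H. apply clim_ext; [apply _ |]. apply filter_forall. intros n.
    symmetry. apply (sg_iter_commute F HSF (G 1)); auto using Delta_0, G_Delta.
Qed.

(** The increment of [hpow m] over each unit of time tends to [c], so the growth rate does not
    depend on the starting point. *)
Lemma orbit_growth (z : C) : Delta z ->
  clim eventually (fun n => hpow m (F (INR n) z) / RtoC (INR n))%C c.
Proof.
  intros Hz. apply (cesaro_increments (fun n => hpow m (F (INR n) z))).
  assert (H := trajectory_asymptotics F f m c HSF HGF Hm Hspeed 1 ltac:(lra)).
  rewrite Cmult_1_r in H. apply (orbit_clim F z) in H; [| now apply orbit].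
  revert H. apply clim_ext; [apply _ |]. apply filter_forall. intros n.
  rewrite (sg_plus F HSF) by (auto using pos_INR; lra).
  now rewrite S_INR, (Rplus_comm (INR n)).
Qed.

(** Along the orbit of 0 the ratio of [hpow m] at [G 1 w] and at [w] tends to [exp b ^ m] by the
    flow of [g], and to [c / c = 1] by [orbit_growth]. Taking moduli gives [Re b = 0], and [b] is
    already known to be real. *)
Lemma linear_part_vanishes (b : C) :
  clim near_in_Delta_1 (fun z => g z / (z - RtoC 1))%C b -> b = RtoC 0.
Proof.
  intros Hb. assert (HIm := linear_part_real G g b HSG HGG Hb).
  assert (H1 := flow_with_linear_part G g b 1 HSG HGG ltac:(lra) Hb).
  rewrite Cmult_1_r in H1.
  assert (H2 := clim_pow _ _ _ m (orbit_clim F _ _ _ (orbit _ Delta_0) H1)).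
  assert (G1 := orbit_growth _ Delta_0).
  assert (G2 := orbit_growth _ (G_Delta _ Delta_0)).
  assert (H3 := clim_div _ _ _ _ _ Hc G2 G1).
  assert (E : (cexp b ^ m)%C = RtoC 1).
  { apply (clim_unique eventually _ _ _ _ H2).
    replace (RtoC 1) with (c / c)%C by (field; exact Hc). revert H3.
    apply clim_ext; [apply _ |]. exists 1%nat. intros n Hn.
    assert (Nn : RtoC (INR n) <> RtoC 0)
      by (apply RtoC_neq_0; assert (0 < INR n) by (apply lt_0_INR; lia); lra).
    assert (D0 : Delta (F (INR n) (RtoC 0)))
      by (apply (sg_Delta F HSF); auto using pos_INR, Delta_0).
    assert (Nh := hp_neq_0 _ D0).
    rewrite <- (sg_iter_commute F HSF (G 1)) by auto using Delta_0, G_Delta.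
    unfold hpow, Cdiv. rewrite Cpow_mult_l, (Cpow_inv _ m Nh).
    assert (Np := Cpow_nz _ m Nh). field. auto. }
  apply (f_equal Cmod) in E. rewrite Cmod_pow, Cmod_cexp, Cmod_1 in E.
  assert (HRe : Re b = 0).
  { assert (P := exp_pos (Re b)).
    destruct (Rtotal_order (Re b) 0) as [L | [L | L]]; [| easy |].
    - apply exp_increasing in L. rewrite exp_0 in L.
      assert (exp (Re b) ^ m < 1) by (apply pow_lt_1_compat; [lra | lia]). lra.
    - apply exp_increasing in L. rewrite exp_0 in L.
      assert (1 < exp (Re b) ^ m) by (apply Rlt_pow_R1; [lra | lia]). lra. }
  destruct b as [x y]. simpl in *. now rewrite HIm, HRe.
Qed.

End SecondSemigroup.

(** * Generators vanishing to second order at [1] *)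

(** Maximum principle for [hp w - hp (F t w)]. Near 1 the difference tends to 0 because the speed
    does; near the rest of the circle [Re (hp w)] is close to 1/2, while [Re (hp (F t w))] exceeds
    1/2. *)
Lemma Re_trajectory_increases (F : R -> C -> C) (f : C -> C) (t : R) (z : C) :
  continuous_semigroup F -> generates f F -> clim near_in_Delta_1 (speed 1 f) (RtoC 0) ->
  0 <= t -> Delta z -> Re (hp z) <= Re (hp (F t z)).
Proof.
  intros HS HG Hs Ht Hz.
  assert (HD := fun w Hw => sg_Delta F HS t w Ht Hw).
  assert (Hasy := trajectory_asymptotics F f 1 _ HS HG Nat.lt_0_1 Hs t Ht).
  rewrite Cmult_0_l in Hasy.
  assert (Hh : holo Delta hp) by (intros w Hw; eexists; now apply cderiv_hp).
  assert (H := max_principle_Re (fun w => hp w - hp (F t w))%C 0).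
  assert (H1 : Re (hp z - hp (F t z)) <= 0).
  { apply H; [| | easy].
    - apply (holo_minus Delta hp (fun w => hp (F t w))); [easy |].
      apply (holo_comp Delta Delta hp (F t)); auto. now apply (sg_holo F HS).
    - intros eps Heps. destruct (Hasy eps Heps) as [d [Hd Hn]].
      assert (Hd2 : 0 < d ^ 2) by now apply pow_lt.
      (* At distance at least [d] from 1, this radius makes the excess of [Re (hp w)] over 1/2 at
         most [eps]. *)
      exists (1 - eps * d ^ 2). split; [nra |]. intros w Hw Hr.
      destruct (Rlt_le_dec (Cmod (w - RtoC 1)) d) as [L | L].
      + specialize (Hn w Hw L). rewrite !hpow_1, Csub_0_r, Cmod_sub_sym in Hn.
        assert (B := Re_le_Cmod (hp w - hp (F t w))). lra.
      + assert (B1 := Re_hp w Hw). assert (B2 := Re_hp_gt (F t w) (HD w Hw)).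
        assert (Hw' := Hw). unfold Delta in Hw'. assert (B0 := Cmod_ge_0 w).
        assert (B3 : (1 - Cmod w ^ 2) / (2 * Cmod (w - RtoC 1) ^ 2) <= eps).
        { assert (d ^ 2 <= Cmod (w - RtoC 1) ^ 2) by (apply pow_incr; lra).
          apply Rle_div_l; [lra |].
          assert (1 - Cmod w ^ 2 <= 2 * (eps * d ^ 2)) by nra.
          assert (eps * d ^ 2 <= eps * Cmod (w - RtoC 1) ^ 2)
            by (apply Rmult_le_compat_l; lra). lra. }
        replace (Re (hp w - hp (F t w))) with (Re (hp w) - Re (hp (F t w))) by reflexivity.
        lra. }
  replace (Re (hp z - hp (F t z))) with (Re (hp z) - Re (hp (F t z))) in H1 by reflexivity.
  lra.
Qed.

Lemma speed_nonneg_Re (F : R -> C -> C) (f : C -> C) (z : C) :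
  continuous_semigroup F -> generates f F -> clim near_in_Delta_1 (speed 1 f) (RtoC 0) ->
  Delta z -> 0 <= Re (speed 1 f z).
Proof.
  intros HS HG Hs Hz.
  assert (H := trajectory_rderiv F f 1 HS HG 0 z (Rle_refl 0) Hz).
  rewrite (sg_0 F HS z Hz) in H. apply (clim_Re_ge_0 _ _ _ H).
  exists 1; split; [lra |]. intros s Hs'.
  rewrite Rplus_0_l, !hpow_1, (sg_0 F HS z Hz).
  assert (H1 := Re_trajectory_increases F f s z HS HG Hs ltac:(lra) Hz).
  replace ((hp (F s z) - hp z) / RtoC s)%C with (RtoC (/ s) * (hp (F s z) - hp z))%C
    by (rewrite RtoC_inv by lra; field; apply RtoC_neq_0; lra).
  assert (0 < / s) by (apply Rinv_0_lt_compat; lra).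
  destruct (hp (F s z)) as [a1 a2], (hp z) as [b1 b2].
  unfold Re, Cminus, Cplus, Copp, Cmult, RtoC in *; simpl in *. nra.
Qed.

(** On the radius, at distance [s] from 1, [nonneg_Re_schwarz] bounds [s * Cmod (A - p) ^ 2] by
    [4 * Re A * Re p], with [A] the value of [P] there. If [p = P 0] is non-zero, [A] cannot be
    smaller than a fixed multiple of [s]. *)
Lemma nonneg_Re_rigidity (P : C -> C) :
  holo Delta P -> (forall z, Delta z -> 0 <= Re (P z)) ->
  clim near_in_Delta_1 (fun z => P z / (1 - z))%C (RtoC 0) ->
  forall z, Delta z -> P z = RtoC 0.
Proof.
  intros HP HRe Hl. set (p := P (RtoC 0)).
  assert (Hp : Cmod p = 0).
  { apply Rle_antisym; [| apply Cmod_ge_0]. apply Rnot_lt_le. intros L.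
    (* From [Cmod (A - p) >= Cmod p / 2] and [Cmod A <= e * s] one gets
       [s * Cmod p ^ 2 / 4 <= 4 * e * s * Cmod p]; with [e <= Cmod p / 20] the right side is at most
       [s * Cmod p ^ 2 / 5]. *)
    set (e := Rmin (/ 2) (/ 20) * Cmod p).
    assert (He : 0 < e) by (apply Rmult_lt_0_compat; [apply Rmin_glb_lt; lra | easy]).
    assert (He' : e <= / 20 * Cmod p) by (apply Rmult_le_compat_r; [lra | apply Rmin_r]).
    clearbody e. destruct (Hl e He) as [d [Hd H]].
    set (s := Rmin (d / 2) (/ 2)). assert (S1 : s <= d / 2) by apply Rmin_l.
    assert (S2 : s <= / 2) by apply Rmin_r. assert (S3 : 0 < s) by (apply Rmin_glb_lt; lra).
    assert (Dr : Delta (RtoC (1 - s))) by (unfold Delta; rewrite Cmod_R, Rabs_pos_eq; lra).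
    specialize (H _ Dr). rewrite <- RtoC_minus, Cmod_R, Rabs_left in H by lra.
    specialize (H ltac:(lra)). rewrite Csub_0_r, <- RtoC_minus in H.
    replace (1 - (1 - s)) with s in H by ring.
    rewrite Cmod_div, Cmod_R, Rabs_pos_eq in H by (try apply RtoC_neq_0; lra).
    apply Rlt_div_l in H; [| lra].
    assert (HQ := nonneg_Re_schwarz P _ HP HRe Dr). fold p in HQ.
    rewrite Cmod_R, Rabs_pos_eq in HQ by lra.
    assert (HRp : 0 <= Re p) by apply HRe, Delta_0.
    assert (HRA := HRe _ Dr). set (A := P (RtoC (1 - s))) in *.
    assert (Hsq : Cmod (A - p) ^ 2 <= (1 - s) ^ 2 * Cmod (A + Cconj p) ^ 2).
    { replace ((1 - s) ^ 2 * Cmod (A + Cconj p) ^ 2)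
        with (((1 - s) * Cmod (A + Cconj p)) ^ 2) by ring.
      apply pow_incr. split; [apply Cmod_ge_0 | easy]. }
    assert (Hid : Cmod (A + Cconj p) ^ 2 = Cmod (A - p) ^ 2 + 4 * (Re A * Re p)).
    { rewrite !Cmod2_alt. destruct A, p.
      unfold Re, Im, Cconj, Cminus, Cplus, Copp; simpl. ring. }
    assert (HAp : Re A * Re p <= Cmod A * Cmod p)
      by (apply Rmult_le_compat; auto using Re_le_Cmod).
    assert (HA0 := Cmod_ge_0 A).
    assert (Hdist : Cmod p / 2 <= Cmod (A - p)).
    { assert (B := Cmod_reverse_triangle p A). rewrite Cmod_sub_sym in B.
      assert (e * s <= e * 1) by (apply Rmult_le_compat_l; lra). lra. }
    assert (Hd2 : (Cmod p / 2) ^ 2 <= Cmod (A - p) ^ 2) by (apply pow_incr; lra).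
    rewrite Hid in Hsq.
    assert (Hs2 : s * Cmod (A - p) ^ 2 <= 4 * (Cmod A * Cmod p)).
    { set (X := Cmod (A - p) ^ 2) in *. set (Y := Re A * Re p) in *.
      assert (0 <= Y) by (unfold Y; nra). assert (0 <= X) by (unfold X; apply pow2_ge_0).
      assert ((1 - s) ^ 2 <= 1 - s) by nra.
      assert ((1 - s) ^ 2 * (X + 4 * Y) <= (1 - s) * (X + 4 * Y))
        by (apply Rmult_le_compat_r; lra). nra. }
    assert (s * (Cmod p / 2) ^ 2 <= s * Cmod (A - p) ^ 2) by (apply Rmult_le_compat_l; lra).
    assert (Cmod A * Cmod p <= e * s * Cmod p) by (apply Rmult_le_compat_r; lra).
    assert (e * s * Cmod p <= / 20 * Cmod p * s * Cmod p).
    { apply Rmult_le_compat_r; [lra |]. apply Rmult_le_compat_r; lra. }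
    assert (0 < s * Cmod p ^ 2) by (apply Rmult_lt_0_compat; [easy | now apply pow_lt]).
    replace (s * (Cmod p / 2) ^ 2) with (s * Cmod p ^ 2 / 4) in H0 by field.
    replace (/ 20 * Cmod p * s * Cmod p) with (s * Cmod p ^ 2 / 20) in H2 by field. lra. }
  (* With [P 0 = 0] the inequality reads [Cmod (P z) <= Cmod z * Cmod (P z)], where [Cmod z < 1]. *)
  apply Cmod_eq_0 in Hp. intros z Hz.
  assert (HQ := nonneg_Re_schwarz P z HP HRe Hz). fold p in HQ. rewrite Hp in HQ.
  replace (Cconj (RtoC 0)) with (RtoC 0) in HQ
    by (apply injective_projections; simpl; ring).
  rewrite Csub_0_r, Cplus_0_r in HQ. unfold Delta in Hz.
  apply Cmod_eq_0. generalize (Cmod_ge_0 (P z)). nra.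
Qed.

Lemma sub_1_neq_0 (z : C) : Delta z -> (z - RtoC 1)%C <> RtoC 0.
Proof.
  intros Hz E. apply (Delta_one_minus_neq_0 z Hz).
  replace (1 - z)%C with (- (z - RtoC 1))%C by ring. rewrite E. ring.
Qed.

(** The sign comes from [hp z = - 1 / (z - 1)] raised to the power [m + 1] and from the minus sign
    in [speed]. *)
Lemma speed_limit (m : nat) (f : C -> C) (a : C) :
  clim near_in_Delta_1 (fun z => f z / (z - RtoC 1) ^ S m)%C a ->
  clim near_in_Delta_1 (speed m f) (RtoC (INR m) * (- RtoC 1) ^ m * a)%C.
Proof.
  intros H.
  assert (H1 : clim near_in_Delta_1 (fun z => RtoC (INR m) * (- RtoC 1) ^ m *
    (f z / (z - RtoC 1) ^ S m))%C (RtoC (INR m) * (- RtoC 1) ^ m * a)%C)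
    by (apply clim_mult; [apply _ | apply clim_const, _ | easy]).
  revert H1. apply clim_ext; [apply _ |]. generalize near_1_Delta. apply filter_imp.
  intros z Hz. assert (N := sub_1_neq_0 z Hz). unfold speed.
  replace (hp z) with (- RtoC 1 * / (z - RtoC 1))%C.
  - rewrite Cpow_mult_l, Cpow_inv by exact N.
    assert (Np := Cpow_nz _ (S m) N). rewrite !(Cpow_S (- RtoC 1)). field. exact Np.
  - unfold hp. assert (N1 := Delta_one_minus_neq_0 z Hz). field. auto.
Qed.

Lemma third_order_generator (F : R -> C -> C) (f : C -> C) (a : C) :
  continuous_semigroup F -> generates f F ->
  clim near_in_Delta_1 (fun z => f z / (z - RtoC 1) ^ 3)%C a ->
  trivial_semigroup F \/ exists x, 0 < x /\ a = RtoC x.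
Proof.
  intros HS HG Ha.
  assert (H2 : clim near_in_Delta_1 (fun z => f z / (z - RtoC 1) ^ 2)%C (RtoC 0)).
  { assert (H : clim near_in_Delta_1
      (fun z => f z / (z - RtoC 1) ^ 3 * (z - RtoC 1))%C (a * (RtoC 1 - RtoC 1))%C).
    { apply clim_mult; [apply _ | easy |]. apply clim_minus; [apply _ | | apply clim_const, _].
      apply clim_near_1_id. }
    replace (a * (RtoC 1 - RtoC 1))%C with (RtoC 0) in H by ring. revert H.
    apply clim_ext; [apply _ |]. generalize near_1_Delta. apply filter_imp.
    intros z Hz. assert (N := sub_1_neq_0 z Hz). field. exact N. }
  assert (Hs := speed_limit 1 f _ H2). rewrite Cmult_0_r in Hs.
  assert (HRe := fun z Hz => speed_nonneg_Re F f z HS HG Hs Hz).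
  (* Exactly, [speed 1 f z / (1 - z) = f z / (z - 1) ^ 3], so the third coefficient becomes the
     boundary ratio of a function with nonnegative real part. *)
  assert (Hl : clim near_in_Delta_1 (fun z => speed 1 f z / (1 - z))%C a).
  { revert Ha. apply clim_ext; [apply _ |]. generalize near_1_Delta. apply filter_imp.
    intros z Hz. assert (N := sub_1_neq_0 z Hz). assert (N' := Delta_one_minus_neq_0 z Hz).
    unfold speed, hp. simpl INR. field. auto. }
  destruct (nonneg_Re_ratio (speed 1 f) a) as [HIm HR]; [| exact Hl |].
  { generalize near_1_Delta. apply filter_imp. exact HRe. }
  destruct HR as [HR | HR].
  - right. exists (Re a). split; [easy |]. destruct a as [x y]. simpl in *. now rewrite HIm.
  - left. apply (generator_0_trivial F f HS HG). intros z Hz.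
    assert (E : a = RtoC 0) by (destruct a as [x y]; simpl in *; now rewrite HIm, <- HR).
    rewrite E in Hl.
    assert (E0 := nonneg_Re_rigidity (speed 1 f) (speed_holo F f 1 HG) HRe Hl z Hz).
    assert (N := hp_neq_0 z Hz). unfold speed in E0. simpl INR in E0.
    replace (f z) with (RtoC 1 * hp z ^ 2 * - f z * (- / hp z ^ 2))%C by (field; exact N).
    rewrite E0. ring.
Qed.

(** With [Re c < 0], points of the half-plane [Re u > 1/2] close to its edge and far from the real
    axis would be carried out of it by time 1. *)
Lemma second_order_direction (F : R -> C -> C) (f : C -> C) (c : C) :
  continuous_semigroup F -> generates f F -> clim near_in_Delta_1 (speed 1 f) c ->
  0 <= Re c.
Proof.
  intros HS HG Hs. apply Rnot_lt_le. intros L.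
  assert (H := trajectory_asymptotics F f 1 c HS HG Nat.lt_0_1 Hs 1 ltac:(lra)).
  rewrite Cmult_1_r in H. assert (He : 0 < - Re c / 2) by lra.
  destruct (proj1 (near_1_hpow 1 _ Nat.lt_0_1) (H _ He)) as [K [HK Hz]].
  (* The real part exceeds 1/2 by [- Re c / 4], while time 1 lowers it by more than [- Re c / 2];
     the imaginary part makes the asymptotics applicable. *)
  set (u := (/ 2 + - Re c / 4, K + 1) : C).
  destruct (hp_surjective u) as [Dz Ez]; [simpl; lra |]. set (z := (1 - / u)%C) in *.
  specialize (Hz z Dz). rewrite !hpow_1, Ez in Hz.
  assert (Hu : K < Cmod u).
  { assert (B := Im_le_Cmod u). simpl in B. rewrite Rabs_pos_eq in B; lra. }
  specialize (Hz Hu). assert (B := Re_le_Cmod (hp (F 1 z) - u - c)).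
  assert (B1 := Re_hp_gt (F 1 z) (sg_Delta F HS 1 z ltac:(lra) Dz)).
  replace (Re (hp (F 1 z) - u - c)) with (Re (hp (F 1 z)) - Re u - Re c) in B by reflexivity.
  replace (Re u) with (/ 2 + - Re c / 4) in B by reflexivity. lra.
Qed.

(** * The charts *)

Lemma half_plane_convex (c : C) (K : R) : convex (fun u => K < Re (u * c)%C).
Proof.
  intros a b t Ha Hb Ht. rewrite Re_mult_segment. now apply convex_combination_gt.
Qed.

Lemma chart_ext_region (m : nat) (c : C) (sigma : C -> C) (K : R) (U : C -> Prop) :
  (forall u, region m c K u <-> U u) -> convex U -> C_open U -> holo U sigma ->
  (forall z, Delta z -> K < progress m c z -> sigma (hpow m z) = z) ->
  chart m c sigma K.
Proof.
  intros E HU HO Hs Hi. split; [| split; [| split]]; auto.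
  - intros a b t Ha Hb Ht. apply E. apply HU; auto; now apply E.
  - intros u Hu. generalize (HO u (proj1 (E u) Hu)). apply filter_imp. intros w. apply E.
  - intros u Hu. apply Hs. now apply E.
Qed.

Lemma chart_half_plane (c : C) : chart 1 c (fun u => 1 - / u)%C 0.
Proof.
  apply (chart_ext_region _ _ _ _
    (* The factor [RtoC 1] puts both conditions in the form of [half_plane_convex] and
       [half_plane_open]. *)
    (fun u => / 2 < Re (u * RtoC 1)%C /\ 0 < Re (u * Cconj c)%C)).
  - intros u. rewrite Cmult_1_r. split.
    + intros [z [Hz [E H]]]. split; [| easy]. rewrite hpow_1 in E. rewrite <- E.
      now apply Re_hp_gt.
    + intros [H1 H2]. destruct (hp_surjective u H1) as [D E].
      exists (1 - / u)%C. now rewrite hpow_1.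
  - intros a b t [Ha Ha'] [Hb Hb'] Ht. split; now apply half_plane_convex.
  - intros u [Hu Hu']. apply filter_and; now apply half_plane_open.
  - apply (holo_minus _ (fun _ => RtoC 1) (fun u => / u)%C); [apply holo_const |].
    apply (holo_inv _ (fun u => u)); [| apply holo_id].
    intros u [Hu _] E. rewrite E, Cmult_0_l in Hu. simpl in Hu. lra.
  - intros z Hz _. rewrite hpow_1. unfold hp. assert (N := Delta_one_minus_neq_0 z Hz).
    field. exact N.
Qed.

(** The points [1 + s * c] with [s > 0] remain in [Re u > 1/2] because [Re c >= 0]. *)
Lemma half_plane_far (c : C) (K : R) :
  c <> RtoC 0 -> 0 <= Re c -> exists z, Delta z /\ K < progress 1 c z.
Proof.
  intros Hc HRe. apply Cmod_gt_0 in Hc. assert (Hc2 : 0 < Cmod c ^ 2) by now apply pow_lt.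
  set (s := (Rabs K + 1) / Cmod c ^ 2).
  assert (Hs : 0 < s) by (apply Rdiv_lt_0_compat; [generalize (Rabs_pos K); lra | easy]).
  set (u := (RtoC 1 + RtoC s * c)%C).
  destruct (hp_surjective u) as [D E].
  { unfold u. destruct c as [x y]. unfold Re, Cplus, Cmult, RtoC in *; simpl in *. nra. }
  exists (1 - / u)%C. split; [easy |]. unfold progress. rewrite hpow_1, E.
  assert (E1 : Re (u * Cconj c) = Re c + s * Cmod c ^ 2).
  { rewrite Cmod2_alt. unfold u. destruct c as [x y].
    unfold Re, Im, Cconj, Cplus, Cmult, RtoC; simpl. ring. }
  rewrite E1. unfold s. generalize (Rle_abs K).
  replace ((Rabs K + 1) / Cmod c ^ 2 * Cmod c ^ 2) with (Rabs K + 1) by (field; lra). lra.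
Qed.

(** The principal square root by the half-angle formula; only its values for [Re u > 0] matter,
    where [r > 0]. *)
Definition csqrt (u : C) : C :=
  let r := sqrt ((Cmod u + Re u) / 2) in (r, Im u / (2 * r)).

Lemma csqrt_spec (u : C) : 0 < Re u -> sqrt (Re u) <= Re (csqrt u) /\ (csqrt u ^ 2)%C = u.
Proof.
  intros Hu. assert (Hm := Re_le_Cmod u).
  set (r := sqrt ((Cmod u + Re u) / 2)).
  assert (Hr : r ^ 2 = (Cmod u + Re u) / 2) by (unfold r; apply pow2_sqrt; lra).
  assert (Hr0 : 0 < r) by (apply sqrt_lt_R0; lra).
  split; [apply sqrt_le_1_alt; lra |].
  assert (Hsq := Cmod2_alt u). unfold csqrt. fold r.
  assert (HI : (Im u / (2 * r)) ^ 2 = (Cmod u - Re u) / 2).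
  { replace ((Im u / (2 * r)) ^ 2) with (Im u ^ 2 / (4 * r ^ 2)) by (field; lra).
    replace (Im u ^ 2) with ((Cmod u - Re u) * (Cmod u + Re u)) by (simpl in *; lra).
    rewrite Hr. field. lra. }
  destruct u as [x y]. simpl in *. apply injective_projections; simpl.
  - rewrite !Rmult_1_r in *. lra.
  - field. lra.
Qed.

Lemma square_injective (u v : C) :
  0 < Re u -> 0 < Re v -> (u ^ 2)%C = (v ^ 2)%C -> u = v.
Proof.
  intros Hu Hv E. apply Cmod_eq_0_sub.
  assert (N : (u + v)%C <> RtoC 0).
  { intros E'. apply (f_equal Re) in E'. unfold Re, Cplus in *; simpl in *. lra. }
  assert (P : ((u - v) * (u + v))%C = RtoC 0).
  { replace ((u - v) * (u + v))%C with (u ^ 2 - v ^ 2)%C by ring. rewrite E. ring. }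
  apply (f_equal Cmod) in P. rewrite Cmod_mult, Cmod_0 in P.
  apply Cmod_gt_0 in N. apply Rmult_integral in P. destruct P; lra.
Qed.

(** The difference quotient is [/ (csqrt w + csqrt u)], and the denominator is bounded below since
    both roots have positive real part. This gives continuity first, then the derivative. *)
Lemma csqrt_holo : holo (fun u => 0 < Re u) csqrt.
Proof.
  intros u Hu. destruct (csqrt_spec u Hu) as [S1 S2].
  assert (Hs := sqrt_lt_R0 _ Hu).
  assert (Hnear : near u (fun w => 0 < Re w)).
  { generalize (half_plane_open (RtoC 1) 0 u). rewrite Cmult_1_r. intros H.
    generalize (H Hu). apply filter_imp. intros w. now rewrite Cmult_1_r. }
  assert (HN : forall w, 0 < Re w -> sqrt (Re u) <= Cmod (csqrt w + csqrt u)).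
  { intros w Hw. destruct (csqrt_spec w Hw) as [W1 _].
    assert (Hsw := sqrt_lt_R0 _ Hw). assert (B := Re_le_Cmod (csqrt w + csqrt u)).
    replace (Re (csqrt w + csqrt u)) with (Re (csqrt w) + Re (csqrt u)) in B by reflexivity.
    lra. }
  assert (HE : forall w, 0 < Re w -> (csqrt w - csqrt u = (w - u) / (csqrt w + csqrt u))%C).
  { intros w Hw. destruct (csqrt_spec w Hw) as [_ W2].
    assert (N : (csqrt w + csqrt u)%C <> RtoC 0).
    { apply Cmod_gt_0. specialize (HN w Hw). lra. }
    rewrite <- W2 at 2. rewrite <- S2 at 2. field. exact N. }
  assert (Hcont : clim (near u) csqrt (csqrt u)).
  { intros eps Heps. assert (He : 0 < eps * sqrt (Re u)) by nra.
    generalize (filter_and _ _ Hnear (clim_near_id u _ He)). apply filter_imp.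
    intros w [Hw Hwe]. specialize (HN w Hw). rewrite (HE w Hw).
    rewrite Cmod_div by (apply Cmod_gt_0; lra). apply Rlt_div_l; [lra |]. nra. }
  assert (N0 : (csqrt u + csqrt u)%C <> RtoC 0).
  { apply Cmod_gt_0. specialize (HN u Hu). lra. }
  exists (/ (csqrt u + csqrt u))%C. apply cderiv_of_eps. intros eps Heps.
  assert (Hq : clim (near u) (fun w => / (csqrt w + csqrt u))%C (/ (csqrt u + csqrt u))%C).
  { apply clim_inv; [apply _ | exact N0 |].
    apply clim_plus; [apply _ | exact Hcont | apply clim_const, _]. }
  generalize (filter_and _ _ Hnear (Hq eps Heps)). apply filter_imp. intros w [Hw Hwe].
  rewrite (HE w Hw).
  replace ((w - u) / (csqrt w + csqrt u) - / (csqrt u + csqrt u) * (w - u))%C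
    with ((/ (csqrt w + csqrt u) - / (csqrt u + csqrt u)) * (w - u))%C by (unfold Cdiv; ring).
  rewrite Cmod_mult. apply Rmult_le_compat_r; [apply Cmod_ge_0 | lra].
Qed.

Lemma Re_mult_conj_real (u : C) (x : R) : Re (u * Cconj (RtoC x))%C = x * Re u.
Proof. destruct u. unfold Re, Cconj, Cmult, RtoC; simpl. ring. Qed.

Lemma csqrt_Re_gt (u : C) : 1 < Re u -> / 2 < Re (csqrt u).
Proof.
  intros Hu. destruct (csqrt_spec u ltac:(lra)) as [H _].
  assert (1 < sqrt (Re u)) by (rewrite <- sqrt_1; apply sqrt_lt_1; lra). lra.
Qed.

(** The threshold [x] makes the region the half-plane [Re u > 1]: there the root has real part above
    1/2, so it lies in the image of [hp]. *)
Lemma chart_square (x : R) : 0 < x -> chart 2 (RtoC x) (fun u => 1 - / csqrt u)%C x.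
Proof.
  intros Hx. apply (chart_ext_region _ _ _ _ (fun u => 1 < Re (u * RtoC 1)%C)).
  - intros u. rewrite Cmult_1_r. split.
    + intros [z [_ [_ H]]]. rewrite Re_mult_conj_real in H. nra.
    + intros H. destruct (hp_surjective _ (csqrt_Re_gt u H)) as [D E].
      exists (1 - / csqrt u)%C. split; [easy | split].
      * unfold hpow. rewrite E. apply csqrt_spec. lra.
      * rewrite Re_mult_conj_real. nra.
  - apply half_plane_convex.
  - apply half_plane_open.
  - apply (holo_minus _ (fun _ => RtoC 1) (fun u => / csqrt u)%C); [apply holo_const |].
    apply (holo_inv _ csqrt).
    + intros u Hu E. rewrite Cmult_1_r in Hu. assert (H := csqrt_Re_gt u Hu).
      rewrite E in H. simpl in H. lra.
    + intros u Hu. apply csqrt_holo. rewrite Cmult_1_r in Hu. lra.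
  - intros z Hz Hp. unfold progress in Hp. rewrite Re_mult_conj_real in Hp.
    assert (H1 : 1 < Re (hpow 2 z)) by nra.
    destruct (csqrt_spec (hpow 2 z) ltac:(lra)) as [_ S2].
    assert (E : csqrt (hpow 2 z) = hp z).
    { apply square_injective; [| | exact S2].
      - assert (H := csqrt_Re_gt _ H1). lra.
      - assert (H := Re_hp_gt z Hz). lra. }
    rewrite E. unfold hp. assert (N := Delta_one_minus_neq_0 z Hz). field. exact N.
Qed.

Lemma square_far (x K : R) : 0 < x -> exists z, Delta z /\ K < progress 2 (RtoC x) z.
Proof.
  intros Hx. set (y := (Rabs K + 1) / x + 1).
  assert (Hy : 0 < (Rabs K + 1) / x)
    by (apply Rdiv_lt_0_compat; [generalize (Rabs_pos K); lra | easy]).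
  destruct (hp_surjective (RtoC y)) as [D E]; [unfold y; simpl; lra |].
  exists (1 - / RtoC y)%C. split; [easy |]. unfold progress.
  rewrite Re_mult_conj_real. unfold hpow. rewrite E.
  replace (RtoC y ^ 2)%C with (RtoC (y ^ 2)) by apply RtoC_pow. simpl.
  assert (Hxy : Rabs K + 1 < x * y).
  { unfold y. replace (x * ((Rabs K + 1) / x + 1)) with (Rabs K + 1 + x) by (field; lra). lra. }
  generalize (Rle_abs K), (Rabs_pos K). unfold y in *. nra.
Qed.

(** * Boundary expansions and the theorem *)

Lemma near_1_of_within (P : C -> Prop) :
  within Delta (locally (RtoC 1)) P -> near_in_Delta_1 P.
Proof.
  intros H. unfold within in H. apply locally_C in H. destruct H as [d H].
  exists d. split; [apply cond_pos |]. intros z Hz Hd. now apply H.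
Qed.

Lemma expansion_leading_term (n k : nat) (f : C -> C) (a : nat -> C) :
  boundary_expansion n (RtoC 1) f a -> (k <= n)%nat ->
  (forall j, (j < k)%nat -> a j = RtoC 0) ->
  clim near_in_Delta_1 (fun z => f z / (z - RtoC 1) ^ k)%C (a k).
Proof.
  intros [gam [_ [Hgam Hf]]] Hk Ha.
  assert (Hg : clim near_in_Delta_1 (fun z => gam z / (z - RtoC 1) ^ n)%C (RtoC 0)).
  { intros eps Heps. apply near_1_of_within. exact (clim_of_filterlim _ _ _ Hgam eps Heps). }
  assert (Hpow : forall i, clim near_in_Delta_1 (fun z => (z - RtoC 1) ^ i)%C
                    ((RtoC 1 - RtoC 1) ^ i)%C).
  { intros i. apply clim_pow; [apply _ |].
    apply clim_minus; [apply _ | apply clim_near_1_id | apply clim_const, _]. }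
  assert (E0 : (RtoC 1 - RtoC 1)%C = RtoC 0) by ring. rewrite E0 in Hpow.
  set (psum := fun N z => sum_n (fun j : nat => (a j * (z - RtoC 1) ^ j)%C) N : C).
  assert (psum_S : forall N z, psum (S N) z
     = (psum N z + a (S N) * (z - RtoC 1) ^ S N)%C).
  { intros N z. unfold psum. rewrite sum_Sn. reflexivity. }
  assert (psum_0 : forall N, (N < k)%nat -> forall z, psum N z = RtoC 0).
  { induction N as [|N IH]; intros HN z.
    - unfold psum. rewrite sum_O, Ha by easy. ring.
    - rewrite psum_S, IH, Ha by lia. ring. }
  assert (Hpsum : forall N, (k <= N)%nat ->
    clim near_in_Delta_1 (fun z => psum N z / (z - RtoC 1) ^ k)%C (a k)).
  { induction N as [|N IH]; intros HN.
    - replace k with 0%nat by lia.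
      apply (clim_ext _ (fun _ => a 0%nat)); [| apply clim_const, _].
      apply filter_forall. intros z. unfold psum. rewrite sum_O. simpl. field.
    - destruct (Nat.eq_dec k (S N)) as [-> | NE].
      + apply (clim_ext _ (fun _ => a (S N))); [| apply clim_const, _].
        generalize near_1_Delta. apply filter_imp. intros z Hz.
        rewrite psum_S, psum_0 by lia.
        assert (Np := Cpow_nz _ (S N) (sub_1_neq_0 z Hz)). field. exact Np.
      + assert (H : clim near_in_Delta_1 (fun z => psum N z / (z - RtoC 1) ^ k
            + a (S N) * (z - RtoC 1) ^ (S N - k))%C
            (a k + a (S N) * RtoC 0 ^ (S N - k))%C).
        { apply clim_plus; [apply _ | apply IH; lia |].
          apply clim_mult; [apply _ | apply clim_const, _ | apply Hpow]. }
        replace (RtoC 0 ^ (S N - k))%C with (RtoC 0) in H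
          by (destruct (S N - k)%nat eqn:Ed; [lia | simpl; ring]).
        rewrite Cmult_0_r, Cplus_0_r in H. revert H. apply clim_ext; [apply _ |].
        generalize near_1_Delta. apply filter_imp. intros z Hz. rewrite psum_S.
        assert (Np := Cpow_nz _ k (sub_1_neq_0 z Hz)).
        assert (Ep : ((z - RtoC 1) ^ S N
          = (z - RtoC 1) ^ k * (z - RtoC 1) ^ (S N - k))%C)
          by (rewrite <- Cpow_add_r; f_equal; lia).
        rewrite Ep. field. exact Np. }
  assert (H : clim near_in_Delta_1 (fun z => psum n z / (z - RtoC 1) ^ k
     + gam z / (z - RtoC 1) ^ n * (z - RtoC 1) ^ (n - k))%C
     (a k + RtoC 0 * RtoC 0 ^ (n - k))%C).
  { apply clim_plus; [apply _ | now apply Hpsum |]. apply clim_mult; [apply _ | easy | apply Hpow]. }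
  rewrite Cmult_0_l, Cplus_0_r in H. revert H. apply clim_ext; [apply _ |].
  generalize near_1_Delta. apply filter_imp. intros z Hz. rewrite Hf by easy. fold (psum n z).
  assert (Np := Cpow_nz _ k (sub_1_neq_0 z Hz)).
  assert (Nq := Cpow_nz _ (n - k) (sub_1_neq_0 z Hz)).
  assert (Ep : ((z - RtoC 1) ^ n = (z - RtoC 1) ^ k * (z - RtoC 1) ^ (n - k))%C)
    by (rewrite <- Cpow_add_r; f_equal; lia).
  rewrite Ep. field. auto.
Qed.

Lemma expansion_value (n : nat) (f : C -> C) (a : nat -> C) :
  boundary_expansion n (RtoC 1) f a -> clim near_in_Delta_1 f (a 0%nat).
Proof.
  intros Ha. generalize (expansion_leading_term n 0 _ _ Ha ltac:(lia) ltac:(lia)).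
  apply clim_ext; [apply _ |]. apply filter_forall. intros z. simpl. field.
Qed.

Lemma expansion_slope (n : nat) (f : C -> C) (a : nat -> C) :
  boundary_expansion n (RtoC 1) f a -> (1 <= n)%nat -> a 0%nat = RtoC 0 ->
  clim near_in_Delta_1 (fun z => f z / (z - RtoC 1))%C (a 1%nat).
Proof.
  intros Ha Hn E.
  assert (H : clim near_in_Delta_1 (fun z => f z / (z - RtoC 1) ^ 1)%C (a 1%nat)).
  { apply (expansion_leading_term n); auto. intros j Hj. now replace j with 0%nat by lia. }
  revert H. apply clim_ext; [apply _ |]. apply filter_forall. intros z. now rewrite Cpow_1_r.
Qed.

Lemma at_left_1_real (P : R -> Prop) :
  at_left 1 P -> exists d, 0 < d /\ forall r, 1 - d < r < 1 -> P r.
Proof.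
  intros [d H]. exists d. split; [apply cond_pos |]. intros r Hr. apply H; [| lra].
  change (Rabs (r - 1) < d). rewrite Rabs_left; lra.
Qed.

Lemma near_1_real (P : C -> Prop) :
  near_in_Delta_1 P -> exists d, 0 < d <= 1 /\ forall r, 1 - d < r < 1 -> P (RtoC r).
Proof.
  intros [d [Hd H]]. exists (Rmin d 1). assert (A := Rmin_l d 1). assert (B := Rmin_r d 1).
  split; [split; [apply Rmin_glb_lt; lra | easy] |]. intros r Hr. apply H.
  - unfold Delta. rewrite Cmod_R, Rabs_pos_eq; lra.
  - rewrite <- RtoC_minus, Cmod_R, Rabs_left; lra.
Qed.

Lemma boundary_null_point_value (f : C -> C) (a : C) :
  boundary_null_point_1 f -> clim near_in_Delta_1 f a -> a = RtoC 0.
Proof.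
  intros Hn Ha. apply Cmod_eq_0_sub. apply Rle_antisym; [| apply Cmod_ge_0].
  apply Rnot_lt_le. intros L. assert (He : 0 < Cmod (a - RtoC 0) / 2) by lra.
  destruct (at_left_1_real _ (clim_of_filterlim _ _ _ Hn _ He)) as [d1 [Hd1 H1]].
  destruct (near_1_real _ (Ha _ He)) as [d2 [Hd2 H2]].
  set (s := Rmin d1 d2 / 2). assert (A := Rmin_l d1 d2). assert (B := Rmin_r d1 d2).
  assert (Hm : 0 < Rmin d1 d2) by (apply Rmin_glb_lt; lra).
  specialize (H1 (1 - s) ltac:(unfold s; lra)). specialize (H2 (1 - s) ltac:(unfold s; lra)).
  assert (T := Cmod_sub_triangle a (f (RtoC (1 - s))) (RtoC 0)).
  rewrite (Cmod_sub_sym a (f (RtoC (1 - s)))) in T. lra.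
Qed.

(** On the radius, integrating the small derivative from [r] to a point close to 1, where [f] is
    negligible, gives [Cmod (f r) <= Cmod b / 2 * (1 - r)]. For [b <> 0] this contradicts the
    quotient being within [Cmod b / 4] of [b]. *)
Lemma angular_derivative_value (f : C -> C) (b : C) :
  holomorphic_on_Delta f -> angular_derivative_1 f (RtoC 0) ->
  clim near_in_Delta_1 f (RtoC 0) ->
  clim near_in_Delta_1 (fun z => f z / (z - RtoC 1))%C b -> b = RtoC 0.
Proof.
  intros Hh Hang H0 Hb. apply Cmod_eq_0_sub. apply Rle_antisym; [| apply Cmod_ge_0].
  apply Rnot_lt_le. intros L. rewrite Csub_0_r in L.
  assert (He : 0 < Cmod b / 4) by lra.
  assert (Pi := PI_RGT_0).
  assert (Hd : exists d, 0 < d <= 1 /\ forall r, 1 - d < r < 1 ->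
     Cmod (C_derive f (RtoC r)) < Cmod b / 4).
  { assert (Hal : 0 < PI / 4 < PI / 2) by lra.
    assert (HA := clim_of_filterlim _ _ _ (Hang _ Hal) _ He).
    unfold within in HA. apply locally_C in HA. destruct HA as [d HA].
    assert (Hd0 := cond_pos d). exists (Rmin d 1).
    assert (A := Rmin_l d 1). assert (B := Rmin_r d 1).
    split; [split; [apply Rmin_glb_lt; lra | easy] |]. intros r Hr.
    specialize (HA (RtoC r)). rewrite Csub_0_r in HA. apply HA.
    - change (Cmod (RtoC r - RtoC 1) < d).
      rewrite <- RtoC_minus, Cmod_R, Rabs_left; lra.
    - split.
      + unfold Delta. rewrite Cmod_R, Rabs_pos_eq; lra.
      + unfold arg_right_half_plane. simpl.
        replace ((0 + - 0) / (1 + - r)) with 0 by (field; lra).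
        rewrite atan_0, Rabs_R0. lra. }
  destruct Hd as [d [Hd HD]].
  destruct (near_1_real _ (Hb _ He)) as [d1 [Hd1 H1]].
  set (r := 1 - Rmin d d1 / 2). assert (A := Rmin_l d d1). assert (B := Rmin_r d d1).
  assert (Hm : 0 < Rmin d d1) by (apply Rmin_glb_lt; lra).
  set (s := Rmin d d1 / 2) in *. assert (Hs : 0 < s) by (unfold s; lra).
  specialize (H1 r ltac:(unfold r, s; lra)).
  assert (He2 : 0 < Cmod b / 4 * s) by (apply Rmult_lt_0_compat; lra).
  destruct (near_1_real _ (H0 _ He2)) as [d2 [Hd2 H2]].
  (* As [f] has no value at 1, the endpoint is replaced by an [r'], chosen after [r], at which [f]
     is below [Cmod b / 4 * s] with [s = 1 - r]. *)
  set (r' := 1 - Rmin d2 s / 2). assert (A' := Rmin_l d2 s). assert (B' := Rmin_r d2 s).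
  assert (Hm' : 0 < Rmin d2 s) by (apply Rmin_glb_lt; lra).
  specialize (H2 r' ltac:(unfold r'; lra)). rewrite Csub_0_r in H2.
  assert (Hr : 1 - d < r < 1) by (unfold r, s in *; lra).
  assert (Hr' : r < r' < 1) by (unfold r', r in *; lra).
  assert (HMV : Cmod (f (RtoC r') - f (RtoC r) - RtoC 0 * (RtoC r' - RtoC r))
     <= Cmod b / 4 * Cmod (RtoC r' - RtoC r)).
  { apply (convex_mean_value Delta f (C_derive f)).
    - exact Delta_convex.
    - intros z Hz. apply cderiv_of_is_derive. apply C_derive_correct; [exact z | now apply Hh].
    - unfold Delta. rewrite Cmod_R, Rabs_pos_eq; lra.
    - unfold Delta. rewrite Cmod_R, Rabs_pos_eq; lra.
    - intros t Ht. rewrite Csub_0_r.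
      replace (RtoC r + RtoC t * (RtoC r' - RtoC r))%C with (RtoC (r + t * (r' - r)))
        by (rewrite RtoC_plus, RtoC_mult, RtoC_minus; ring).
      apply Rlt_le, HD. split; nra. }
  rewrite <- RtoC_minus, Cmod_R, Rabs_pos_eq in HMV by lra.
  rewrite RtoC_minus in HMV.
  replace (f (RtoC r') - f (RtoC r) - RtoC 0 * (RtoC r' - RtoC r))%C
    with (f (RtoC r') - f (RtoC r))%C in HMV by ring.
  assert (Hfr : Cmod (f (RtoC r)) <= Cmod b / 2 * s).
  { assert (T := Cmod_reverse_triangle (f (RtoC r)) (f (RtoC r'))).
    rewrite Cmod_sub_sym in T.
    assert (Cmod b / 4 * (r' - r) <= Cmod b / 4 * s)
      by (apply Rmult_le_compat_l; unfold r in *; lra). lra. }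
  assert (T := Cmod_reverse_triangle b (f (RtoC r) / (RtoC r - RtoC 1))).
  rewrite Cmod_sub_sym in T. rewrite <- RtoC_minus in T, H1.
  rewrite Cmod_div, Cmod_R, Rabs_left in T by (try apply RtoC_neq_0; lra).
  assert (Cmod (f (RtoC r)) / - (r - 1) <= Cmod b / 2).
  { apply Rle_div_l; unfold r in *; lra. }
  lra.
Qed.

Lemma trivial_semigroups_commute (F G : R -> C -> C) :
  continuous_semigroup F -> continuous_semigroup G ->
  trivial_semigroup F \/ trivial_semigroup G -> semigroups_commute F G.
Proof.
  intros HSF HSG H s t Hs Ht z Hz.
  assert (DF := sg_Delta F HSF t z Ht Hz). assert (DG := sg_Delta G HSG s z Hs Hz).
  destruct H as [H | H].
  - now rewrite (H t Ht _ DG), (H t Ht _ Hz).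
  - now rewrite (H s Hs _ DF), (H s Hs _ Hz).
Qed.

Lemma semigroups_commute_of_charts (F G : R -> C -> C) (f g : C -> C) (m : nat)
    (c d : C) (sigma tau : C -> C) (K L : R) :
  continuous_semigroup F -> continuous_semigroup G -> generates f F -> generates g G ->
  commute_on_Delta (F 1) (G 1) -> (0 < m)%nat -> c <> RtoC 0 -> d <> RtoC 0 ->
  clim near_in_Delta_1 (speed m f) c -> clim near_in_Delta_1 (speed m g) d ->
  chart m c sigma K -> chart m d tau L ->
  (forall M, exists z, Delta z /\ M < progress m c z) ->
  (forall M, exists z, Delta z /\ M < progress m d z) ->
  semigroups_commute F G.
Proof.
  intros HSF HSG HGF HGG Hcom Hm Hc Hd Hf Hg Hchc Hchd Hfc Hfd s t Hs Ht.
  assert (H1 : commute_on_Delta (F t) (G 1)).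
  { apply (commute_with_time_one F f m c sigma K HSF HGF Hm Hc Hf Hchc Hfc (G 1) (d * RtoC 1)%C);
      auto.
    - apply (sg_holo G HSG). lra.
    - intros z Hz. apply (sg_Delta G HSG); [lra | easy].
    - apply (trajectory_asymptotics G g m d HSG HGG Hm Hg). lra. }
  assert (H2 : commute_on_Delta (G s) (F t)).
  { apply (commute_with_time_one G g m d tau L HSG HGG Hm Hd Hg Hchd Hfd (F t) (c * RtoC t)%C);
      auto.
    - now apply (sg_holo F HSF).
    - intros z Hz. now apply (sg_Delta F HSF).
    - intros z Hz. symmetry. now apply H1.
    - now apply (trajectory_asymptotics F f m c HSF HGF Hm Hf). }
  intros z Hz. symmetry. now apply H2.
Qed.

Lemma first_coefficients_vanish (F G : R -> C -> C) (f g : C -> C) (m n : nat) (c : C)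
    (b : nat -> C) :
  continuous_semigroup F -> continuous_semigroup G -> generates f F -> generates g G ->
  commute_on_Delta (F 1) (G 1) -> (0 < m)%nat -> c <> RtoC 0 ->
  clim near_in_Delta_1 (speed m f) c ->
  (forall K, exists z, Delta z /\ K < progress m c z) ->
  class_C 0 (RtoC 1) (G 1) ->
  (1 <= n)%nat -> boundary_expansion n (RtoC 1) g b ->
  identity_on_Delta (G 1) \/ (b 0%nat = RtoC 0 /\ b 1%nat = RtoC 0).
Proof.
  intros HSF HSG HGF HGG Hcom Hm Hc Hf Hfar [_ [beta Hbeta]] Hn Hb.
  assert (HG1 := expansion_value 0 _ _ Hbeta).
  rewrite (boundary_value_at_1 F G f m c HSF HGF HSG Hm Hc Hf Hfar Hcom _ HG1) in HG1.
  assert (Hg0 := expansion_value n _ _ Hb).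
  destruct (classic (b 0%nat = RtoC 0)) as [E | N].
  - right. split; [easy |].
    apply (linear_part_vanishes F G f g m c HSF HGF HSG HGG Hm Hc Hf Hfar Hcom).
    now apply (expansion_slope n).
  - left. exact (generator_nonzero_at_1 G g _ 1 HSG HGG ltac:(lra) N Hg0 HG1).
Qed.

Theorem theorem4 :
  forall (F G : R -> C -> C) (f g : C -> C),
    continuous_semigroup F ->
    continuous_semigroup G ->
    generates f F ->
    generates g G ->
    commute_on_Delta (F 1) (G 1) ->
    nondegenerate_pair F G ->
    boundary_null_point_1 f ->
    angular_derivative_1 f (RtoC 0) ->
    semigroup_in_C0_1 F ->
    semigroup_in_C0_1 G ->
    ((class_C 2 (RtoC 1) f /\ class_C 2 (RtoC 1) g /\
      (exists f2 : C,
         boundary_derivative 2 (RtoC 1) f 2 f2 /\ f2 <> RtoC 0) /\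
      (exists g2 : C,
         boundary_derivative 2 (RtoC 1) g 2 g2 /\ g2 <> RtoC 0))
     \/
     (class_C 3 (RtoC 1) f /\ class_C 3 (RtoC 1) g /\
      boundary_derivative 3 (RtoC 1) f 2 (RtoC 0) /\
      boundary_derivative 3 (RtoC 1) g 2 (RtoC 0))) ->
    semigroups_commute F G.
Proof.
  intros F G f g HSF HSG HGF HGG Hcom Hnd Hnull Hang _ HCG Hcase.
  assert (HC1 : class_C 0 (RtoC 1) (G 1)) by (apply HCG; lra).
  assert (Hf01 : forall n a, (1 <= n)%nat -> boundary_expansion n (RtoC 1) f a ->
    a 0%nat = RtoC 0 /\ a 1%nat = RtoC 0).
  { intros n a Hn Ha.
    assert (H0 := expansion_value n _ _ Ha).
    assert (E0 := boundary_null_point_value f _ Hnull H0). split; [easy |].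
    rewrite E0 in H0. apply (angular_derivative_value f); auto; [apply HGF |].
    now apply (expansion_slope n). }
  assert (N2 : RtoC (INR (fact 2)) <> RtoC 0) by (apply RtoC_neq_0; simpl; lra).
  destruct Hcase as [(_ & _ & [f2 [[_ [a [Ha Ef]]] Nf]] & [g2 [[_ [b [Hb Eg]]] Ng]])
                    | (_ & _ & [_ [a [Ha Ef]]] & [_ [b [Hb Eg]]])].
  - assert (Na : a 2%nat <> RtoC 0) by (intros E; apply Nf; rewrite Ef, E; ring).
    assert (Nb : b 2%nat <> RtoC 0) by (intros E; apply Ng; rewrite Eg, E; ring).
    assert (Hlim : forall u e, boundary_expansion 2 (RtoC 1) u e ->
      e 0%nat = RtoC 0 /\ e 1%nat = RtoC 0 ->
      clim near_in_Delta_1 (speed 1 u) (- e 2%nat)%C).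
    { intros u e He [E0 E1].
      assert (H := expansion_leading_term 2 2 _ _ He (le_n 2)).
      assert (H2 := speed_limit 1 u (e 2%nat)).
      replace (RtoC (INR 1) * (- RtoC 1) ^ 1 * e 2%nat)%C with (- e 2%nat)%C in H2
        by (simpl; ring).
      apply H2, H. intros j Hj. destruct j as [|[|j]]; [easy | easy | lia]. }
    assert (Hneg : forall x, x <> RtoC 0 -> (- x)%C <> RtoC 0).
    { intros x Nx E. apply Nx. replace x with (- - x)%C by ring. rewrite E. ring. }
    assert (Hf := Hlim f a Ha (Hf01 2%nat a ltac:(lia) Ha)).
    assert (Hfar : forall K, exists z, Delta z /\ K < progress 1 (- a 2%nat)%C z).
    { intros K. apply half_plane_far; [now apply Hneg |].
      exact (second_order_direction F f _ HSF HGF Hf). }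
    destruct (first_coefficients_vanish F G f g 1 2 _ b HSF HSG HGF HGG Hcom Nat.lt_0_1
      (Hneg _ Na) Hf Hfar HC1 ltac:(lia) Hb) as [Hid | Hb01].
    (* If [G 1] is the identity, non-degeneracy of the pair makes one of the semigroups trivial. *)
    { apply trivial_semigroups_commute; auto. }
    assert (Hg := Hlim g b Hb Hb01).
    apply (semigroups_commute_of_charts F G f g 1 (- a 2%nat)%C (- b 2%nat)%C
      (fun u => 1 - / u)%C (fun u => 1 - / u)%C 0 0 HSF HSG HGF HGG Hcom Nat.lt_0_1);
      auto using chart_half_plane.
    intros K. apply half_plane_far; [now apply Hneg |].
    exact (second_order_direction G g _ HSG HGG Hg).
  - assert (Ea : a 2%nat = RtoC 0).
    { replace (a 2%nat) with (RtoC (INR (fact 2)) * a 2%nat * / RtoC (INR (fact 2)))%C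
        by (field; exact N2). rewrite <- Ef. ring. }
    assert (Eb : b 2%nat = RtoC 0).
    { replace (b 2%nat) with (RtoC (INR (fact 2)) * b 2%nat * / RtoC (INR (fact 2)))%C
        by (field; exact N2). rewrite <- Eg. ring. }
    assert (Hlim : forall u e, boundary_expansion 3 (RtoC 1) u e ->
      e 0%nat = RtoC 0 /\ e 1%nat = RtoC 0 -> e 2%nat = RtoC 0 ->
      clim near_in_Delta_1 (fun z => u z / (z - RtoC 1) ^ 3)%C (e 3%nat)).
    { intros u e He [E0 E1] E2. apply (expansion_leading_term 3 3); auto.
      intros j Hj. destruct j as [|[|[|j]]]; [easy | easy | easy | lia]. }
    assert (Hf := Hlim f a Ha (Hf01 3%nat a ltac:(lia) Ha) Ea).
    (* For [m = 2] the sign [(- 1) ^ m] is positive and the exponent contributes the factor 2. *)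
    assert (Hspeed : forall u x, clim near_in_Delta_1 (fun z => u z / (z - RtoC 1) ^ 3)%C (RtoC x)
      -> clim near_in_Delta_1 (speed 2 u) (RtoC (2 * x))).
    { intros u x Hx. assert (H := speed_limit 2 u _ Hx).
      replace (RtoC (INR 2) * (- RtoC 1) ^ 2 * RtoC x)%C with (RtoC (2 * x)) in H
        by (replace (INR 2) with 2 by (simpl; ring); rewrite RtoC_mult; simpl; ring).
      exact H. }
    destruct (third_order_generator F f _ HSF HGF Hf) as [HF | [x [Hx Ex]]].
    { apply trivial_semigroups_commute; auto. }
    rewrite Ex in Hf. assert (Hsf := Hspeed f x Hf).
    assert (Nx : RtoC (2 * x) <> RtoC 0) by (apply RtoC_neq_0; lra).
    assert (Hfar : forall K, exists z, Delta z /\ K < progress 2 (RtoC (2 * x)) z)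
      by (intros K; apply square_far; lra).
    destruct (first_coefficients_vanish F G f g 2 3 _ b HSF HSG HGF HGG Hcom Nat.lt_0_2
      Nx Hsf Hfar HC1 ltac:(lia) Hb) as [Hid | Hb01].
    { apply trivial_semigroups_commute; auto. }
    assert (Hg := Hlim g b Hb Hb01 Eb).
    destruct (third_order_generator G g _ HSG HGG Hg) as [HG | [y [Hy Ey]]].
    { apply trivial_semigroups_commute; auto. }
    rewrite Ey in Hg. assert (Hsg := Hspeed g y Hg).
    apply (semigroups_commute_of_charts F G f g 2 (RtoC (2 * x)) (RtoC (2 * y))
      (fun u => 1 - / csqrt u)%C (fun u => 1 - / csqrt u)%C (2 * x) (2 * y)
      HSF HSG HGF HGG Hcom Nat.lt_0_2 Nx); auto.
    + apply RtoC_neq_0. lra.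
    + apply chart_square. lra.
    + apply chart_square. lra.
    + intros K. apply square_far. lra.
Qed.
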